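(* Let $D=\mathrm{Spec}\,\mathcal{O}_D$ with $\mathcal{O}_D$ a complete discrete valuation ring whose residue field $k$ is algebraically closed, and let $G$ be a finite group acting faithfully on $V=\mathbb{A}_D^d=\mathrm{Spec}\,\mathcal{O}_D[x_1,\dots,x_d]$ over $D$ by permutations of the coordinates. Let $\mathsf{v}\subset V$ be the $G$-stable hyperplane defined by $x_1+\cdots+x_d=0$, with the induced linear $G$-action. Let $E\to D$ be a $G$-cover, let $C\to D$ be the degree $d$ cover associated to $E$, and let $C=\bigsqcup_{j=1}^{l}C_j$ be its decomposition into connected components. Then $$\mathbf{v}_{\mathsf{v}}(E)=\frac{d_{C/D}}{2}-\min\left\{\left\lfloor\frac{d_{C_j/D}}{[C_j:D]}\right\rfloor \;\middle|\; 1\le j\le l\right\},$$ where $[C_j:D]$ is the degree of $C_j\to D$.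
   Context: Conventions: a left $G$-action on an affine scheme corresponds to a right $G$-action on its coordinate ring by pull-back of functions. $K(X)$ denotes the function field (total fraction ring) of $X$; $\mathfrak{m}_D$ is the maximal ideal of $\mathcal{O}_D$. $\lfloor r\rfloor$ is the largest integer $\le r$. $G$-covers: a $G$-cover of $D$ is a $D$-scheme $E$ with a left $G$-action such that $E\otimes_{\mathcal{O}_D}K(D)$ is an étale $G$-torsor over $\mathrm{Spec}\,K(D)$ and $E$ is the normalization of $D$ in it. Fix a connected component $F$ of $E$ with stabilizer $H\subset G$ (so $F$ is a connected $H$-cover of $D$); the quantities below do not depend on the choice of $F$. The function $\mathbf{v}$: for a free $\mathcal{O}_D$-module $N$ of finite rank with a right $\mathcal{O}_D$-linear $G$-action, and $\mathsf{w}=\mathrm{Spec}\,S^\bullet_{\mathcal{O}_D}N$ (an affine space over $D$ with linear $G$-action), put $\Xi_F=\mathrm{Hom}^H_{\mathcal{O}_D}(N,\mathcal{O}_F)$ ($H$-equivariant $\mathcal{O}_D$-linear maps) and $$\mathbf{v}_{\mathsf{w}}(E)=\frac{1}{\sharp H}\,\mathrm{length}\,\frac{\mathrm{Hom}_{\mathcal{O}_D}(N,\mathcal{O}_F)}{\mathcal{O}_F\cdot\Xi_F}.$$ For the hyperplane $\mathsf{v}$, $N=\big(\bigoplus_i\mathcal{O}_Dx_i\big)/\mathcal{O}_D\cdot(x_1+\cdots+x_d)$. Covers: a cover $C\to D$ is the normalization of $D$ in a finite étale (not necessarily Galois) $K(D)$-algebra. Its discriminant exponent $d_{C/D}$ is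 defined by: the discriminant of $K(C)/K(D)$ is $\mathfrak{m}_D^{d_{C/D}}$. Thus $d_{C/D}=\sum_j d_{C_j/D}$. The associated cover $C$: let $O_1,\dots,O_l$ be the $H$-orbits in $\{x_1,\dots,x_d\}$; for each $j$ choose an element of $O_j$ and let $H_j\subset H$ be its stabilizer. Then $C_j=\mathrm{Spec}\,(\mathcal{O}_F)^{H_j}$, a connected cover of $D$ of degree $[C_j:D]=\sharp O_j$, and $C=\bigsqcup_{j=1}^l C_j$. Equivalently, $C$ is the normalization of $D$ in the étale $K(D)$-algebra corresponding to the action of the absolute Galois group of $K(D)$ on $\{1,\dots,d\}$ through the homomorphism to $G$ defining $E$. *)

(* Defs.v *)
From HB Require Import structures.
From mathcomp Require Import all_boot all_order all_algebra all_fingroup all_field.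
From mathcomp Require Import ring_quotient generic_quotient.
From mathcomp Require Import boolp classical_sets.

Set Implicit Arguments.
Unset Strict Implicit.
Unset Printing Implicit Defensive.

Import GRing.Theory.
Local Open Scope classical_set_scope.
Local Open Scope ring_scope.

Notation "x %:F" := (@tofrac _ x) : ring_scope.

Section DVR.
Variable R : idomainType.
Implicit Types I J P : set R.

Definition is_ideal I :=
  [/\ I 0, forall x y, I x -> I y -> I (x + y) & forall a x, I x -> I (a * x)].

Definition is_principal I := exists a, I = [set r * a | r in [set: R]].

Definition is_prime_ideal P :=
  [/\ is_ideal P, ~ P 1 & forall x y, P (x * y) -> P x \/ P y].

Definition is_dvr :=
  (forall I, is_ideal I -> is_principal I) /\
  (exists! P, is_prime_ideal P /\ P <> [set 0]).

(* The maximal ideal of a local ring. *)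
Definition maxideal : set R := [set x | x \isn't a GRing.unit].

Definition ideal_span (S : set R) : set R :=
  [set r | exists n (a s : 'I_n -> R),
     (forall i, S (s i)) /\ r = \sum_(i < n) a i * s i].

Definition ideal_mul I J : set R :=
  ideal_span [set z | exists x y, [/\ I x, J y & z = x * y]].

Definition ideal_exp I (n : nat) : set R := iter n (ideal_mul I) [set: R].

Definition adic_cauchy (u : nat -> R) :=
  forall n, exists N, forall i j, (N <= i)%N -> (N <= j)%N ->
    ideal_exp maxideal n (u i - u j).

Definition adic_limit (u : nat -> R) (l : R) :=
  forall n, exists N, forall i, (N <= i)%N -> ideal_exp maxideal n (u i - l).

(* Separatedness is automatic for a DVR, by Krull's intersection theorem. *)
Definition is_complete_dvr :=
  is_dvr /\ (forall u, adic_cauchy u -> exists l, adic_limit u l).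

Definition is_residue_field (k : fieldType) (res : {rmorphism R -> k}) :=
  (forall y, exists x, res x = y) /\ (forall x, res x = 0 <-> maxideal x).

End DVR.

Record glmod (R : nzRingType) (gT : finGroupType) := GLmod {
  glmod_sort :> lmodType R;
  glact : gT -> {linear glmod_sort -> glmod_sort};
  glact1 : forall x, glact 1%g x = x;
  glactM : forall g h x, glact (g * h)%g x = glact h (glact g x);
  glmod_free : exists n (f : {linear 'rV[R]_n -> glmod_sort}), bijective f }.

(* The cover E -> Spec R is encoded by A = K(E), an R-cover being affine and    *)
(* determined by its generic fibre.  The right action of G on A is the          *)
(* pull-back of functions.  The map A (x)_K A -> prod_(g in G) A sending        *)
(* a (x) b to (a * (b . g))_g is dual to G x Spec A -> Spec A x Spec A,         *)
(* (g, t) |-> (t, g t); it is written here after identifying A (x)_K A with a   *)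
(* power of A by means of a K-basis of the second factor.  A torsor under a     *)
(* finite constant group is automatically etale.                                *)
Definition torsor_map (K : fieldType) (A : falgType K) (gT : finGroupType)
    (act : gT -> 'AEnd(A)) (a : {ffun 'I_(\dim {:A}) -> A}) : {ffun gT -> A} :=
  [ffun g => \sum_i a i * act g (vbasis {:A})`_i].

Record gcover (R : idomainType) (gT : finGroupType) := GCover {
  gcover_alg :> falgType {fraction R};
  gcover_mulC : commutative (@GRing.mul gcover_alg);
  gcact : gT -> 'AEnd(gcover_alg);
  gcact1 : forall a, gcact 1%g a = a;
  gcactM : forall g h a, gcact (g * h)%g a = gcact h (gcact g a);
  gcover_torsor : bijective (torsor_map gcact) }.

Section Components.
Variables (R : idomainType) (gT : finGroupType) (E : gcover R gT).

Definition ring_of_cover : set E :=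
  [set a | integralOver (in_alg E \o @tofrac R) a].

(* Connected components of the affine scheme E correspond to primitive         *)
(* idempotents of its coordinate ring, the component of e being Spec (e O_E).  *)
Definition is_component (e : E) :=
  [/\ ring_of_cover e, e * e = e, e != 0 &
      forall f, ring_of_cover f -> f * f = f -> e * f = f -> f = 0 \/ f = e].

Variable e : E.

Definition ring_of_component : set E := [set e * a | a in ring_of_cover].

Definition comp_stab : {set gT} := [set g | gcact E g e == e]%SET.

Section VFunction.
Variable N : glmod R gT.

Definition homs : set (N -> E) :=
  [set f | (forall c x y, f (c *: x + y) = c%:F *: f x + f y) /\
           (forall x, ring_of_component (f x))].

Definition equiv_homs : set (N -> E) :=
  [set f | homs f /\
     forall h x, h \in comp_stab -> f (glact N h x) = gcact E h (f x)].

Definition span_equiv_homs : set (N -> E) :=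
  [set f | exists n (a : 'I_n -> E) (u : 'I_n -> N -> E),
     [/\ forall i, ring_of_component (a i), forall i, equiv_homs (u i) &
         f = fun x => \sum_(i < n) a i * u i x]].

Definition is_subhoms (S : set (N -> E)) :=
  [/\ S (fun=> 0), forall f g, S f -> S g -> S (fun x => f x + g x) &
      forall a f, ring_of_component a -> S f -> S (fun x => a * f x)].

(* Submodules of P / Q are submodules between Q and P. *)
Definition submod_chain (Q P : set (N -> E)) (n : nat) :=
  exists c : nat -> set (N -> E),
    [/\ c 0%N = Q, c n = P, forall i, (i <= n)%N -> is_subhoms (c i) &
        forall i, (i < n)%N -> c i `<` c i.+1].

Definition has_length (Q P : set (N -> E)) (n : nat) :=
  submod_chain Q P n /\ forall m, submod_chain Q P m -> (m <= n)%N.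

(* Length of the O_F-module P / Q, with None standing for infinite length. *)
Definition quot_length (Q P : set (N -> E)) : option nat :=
  xget None [set Some n | n in has_length Q P].

Definition vfun : option rat :=
  omap (fun n : nat => n%:Q / #|comp_stab|%:Q)
       (quot_length span_equiv_homs homs).

End VFunction.
End Components.

(* [V] with the product [mul] is an ambient space for the finite etale algebra *)
(* [U] over the fraction field of R, and [O] is the normalization of R in [U]. *)
(* The unit of [U] plays no role here and need not be that of the ambient      *)
(* space.                                                                      *)
Section Discriminant.
Variables (R : idomainType) (V : vectType {fraction R}) (mul : V -> V -> V).
Variables (U : {vspace V}) (O : set V).

Definition alg_trace (u : V) : {fraction R} :=
  \sum_(i < \dim U) coord (vbasis U) i (mul u (vbasis U)`_i).

Definition basis_disc (b : (\dim U).-tuple V) : {fraction R} :=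
  \det (\matrix_(i < \dim U, j < \dim U) alg_trace (mul b`_i b`_j)).

Definition disc_ideal : set R :=
  ideal_span [set r | exists b : (\dim U).-tuple V,
    [/\ basis_of U b, forall i, O (tnth b i) & r%:F = basis_disc b]].

Definition disc_exp : nat :=
  xget 0%N [set n | disc_ideal = ideal_exp (@maxideal R) n].

End Discriminant.

Section AssociatedCover.
Variables (R : idomainType) (gT : finGroupType) (d : nat).
Variables (to : {action gT &-> 'I_d}) (E : gcover R gT) (e : E).

(* [x j] is the chosen element of the j-th orbit. *)
Variables (l : nat) (x : 'I_l -> 'I_d).

Definition orbit_reps := forall i, exists! j, i \in orbit to (comp_stab e) (x j).

(* K(C_j) = K(F)^(H_j), where K(F) = K(E) * e. *)
Definition assoc_comp (j : 'I_l) : {vspace E} :=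
  (({:E} * <[e]>) :&: \bigcap_(h in 'C_(comp_stab e)[x j | to]%g)
                          fixedSpace (gcact E h))%VS.

Definition ring_of_assoc_comp (j : 'I_l) : set E :=
  [set a | ring_of_component e a /\
     forall h, h \in 'C_(comp_stab e)[x j | to]%g -> gcact E h a = a].

Definition assoc_comp_deg (j : 'I_l) : nat := \dim (assoc_comp j).

Definition assoc_comp_disc_exp (j : 'I_l) : nat :=
  disc_exp *%R (assoc_comp j) (ring_of_assoc_comp j).

(* K(C) is the product of the K(C_j), inside the power of K(E). *)
Definition assoc_cover : {vspace {ffun 'I_l -> E}} :=
  (\bigcap_(j < l) (linfun (fun f : {ffun 'I_l -> E} => f j) @^-1: assoc_comp j))%VS.

Definition ring_of_assoc_cover : set {ffun 'I_l -> E} :=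
  [set f | forall j, ring_of_assoc_comp j (f j)].

Definition assoc_disc_exp : nat :=
  disc_exp (fun f g : {ffun 'I_l -> E} => [ffun j => f j * g j])
    assoc_cover ring_of_assoc_cover.

End AssociatedCover.

(* The minimum of the family if it is nonempty, 0 otherwise. *)
Definition min_over (l : nat) (f : 'I_l -> nat) : nat :=
  \big[minn/(\max_(j < l) f j)%N]_(j < l) f j.

Section Hyperplane.
Variables (R : comNzRingType) (d : nat).

Definition sum_coords : 'rV[R]_d := \sum_(i < d) delta_mx 0 i.

Definition sum_line : {pred 'rV[R]_d} :=
  [pred v | `[< exists a, v = a *: sum_coords >]].

Fact sum_line_zmod_closed : zmod_closed sum_line.
Proof.
split=> [|u v /asboolP[a ->] /asboolP[b ->]]; apply/asboolP.
  by exists 0; rewrite scale0r.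
by exists (a - b); rewrite scalerBl.
Qed.
HB.instance Definition _ :=
  GRing.isZmodClosed.Build _ sum_line sum_line_zmod_closed.

Definition hyp_mod := Quotient.quot sum_line.
HB.instance Definition _ := GRing.Zmodule.on hyp_mod.

Definition hyp_pi : 'rV[R]_d -> hyp_mod := (\pi_(Quotient.quot sum_line))%qT.
Definition hyp_repr : hyp_mod -> 'rV[R]_d := repr : Quotient.quot sum_line -> _.

Lemma hyp_reprK : cancel hyp_repr hyp_pi. Proof. exact: reprK. Qed.

Lemma hyp_piP u v : hyp_pi u = hyp_pi v <-> exists a, u - v = a *: sum_coords.
Proof.
split=> [/eqP|uv]; first by rewrite -Quotient.idealrBE => /asboolP.
by apply/eqP; rewrite -Quotient.idealrBE; apply/asboolP.
Qed.

Lemma hyp_pi_surj q : exists v, hyp_pi v = q.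
Proof. by exists (hyp_repr q); exact: hyp_reprK. Qed.

Fact hyp_pi_zmod_morphism : zmod_morphism hyp_pi.
Proof. by move=> u v; rewrite /hyp_pi raddfB. Qed.
HB.instance Definition _ := GRing.isZmodMorphism.Build _ _ hyp_pi
  hyp_pi_zmod_morphism.

Definition hyp_scale (a : R) (q : hyp_mod) : hyp_mod := hyp_pi (a *: hyp_repr q).

Lemma hyp_scale_pi a v : hyp_scale a (hyp_pi v) = hyp_pi (a *: v).
Proof.
apply/hyp_piP; have: hyp_pi (hyp_repr (hyp_pi v)) = hyp_pi v by exact: hyp_reprK.
by case/hyp_piP=> b e; exists (a * b); rewrite -scalerBr e scalerA.
Qed.

Fact hyp_scaleA a b q : hyp_scale a (hyp_scale b q) = hyp_scale (a * b) q.
Proof.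
by have [v <-] := hyp_pi_surj q; rewrite !hyp_scale_pi scalerA.
Qed.
Fact hyp_scale1 : left_id 1 hyp_scale.
Proof. by move=> q; have [v <-] := hyp_pi_surj q; rewrite hyp_scale_pi scale1r. Qed.
Fact hyp_scaleDr : right_distributive hyp_scale +%R.
Proof.
move=> a p q; have [u <-] := hyp_pi_surj p; have [v <-] := hyp_pi_surj q.
by rewrite -raddfD !hyp_scale_pi -raddfD scalerDr.
Qed.
Fact hyp_scaleDl q : {morph hyp_scale^~ q : a b / a + b}.
Proof.
move=> a b /=; have [v <-] := hyp_pi_surj q.
by rewrite !hyp_scale_pi -raddfD scalerDl.
Qed.
HB.instance Definition _ := GRing.Zmodule_isLmodule.Build R hyp_mod
  hyp_scaleA hyp_scale1 hyp_scaleDr hyp_scaleDl.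

Fact hyp_pi_scalable : scalable hyp_pi.
Proof. by move=> a v; rewrite -hyp_scale_pi. Qed.
HB.instance Definition _ := GRing.isScalable.Build R _ _ _ hyp_pi hyp_pi_scalable.

Lemma sum_coordsE : sum_coords = const_mx 1.
Proof.
apply/rowP=> j; rewrite mxE /sum_coords summxE (bigD1 j) //= mxE !eqxx big1 ?addr0 //.
by move=> i; rewrite mxE eqxx eq_sym => /negPf->.
Qed.

End Hyperplane.

Lemma hyp_mod_free (R : comNzRingType) d :
  exists n (f : {linear 'rV[R]_n -> hyp_mod R d}), bijective f.
Proof.
case: d => [|d].
  exists 0%N, (@hyp_pi R 0 : {linear _ -> _}); exists (fun=> 0) => [w|q].
    by rewrite [w]thinmx0.
  by have [v <-] := hyp_pi_surj q; rewrite [v]thinmx0.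
pose f (w : 'rV[R]_d) : hyp_mod R d.+1 := hyp_pi (row_mx (0 : 'rV_1) w).
have f_lin : linear f.
  move=> a u v; rewrite /f -linearP; congr hyp_pi.
  apply/rowP=> j; rewrite !mxE; case: splitP => k _; rewrite !mxE //.
  by rewrite mulr0 addr0.
pose fL := GRing.isLinear.Build _ _ _ _ f f_lin.
pose F : {linear 'rV[R]_d -> hyp_mod R d.+1} := HB.pack f fL.
exists d, F; pose g (q : hyp_mod R d.+1) : 'rV[R]_d :=
  \row_j (hyp_repr q 0 (lift ord0 j) - hyp_repr q 0 ord0).
have gE (v : 'rV[R]_d.+1) j : g (hyp_pi v) 0 j = v 0 (lift ord0 j) - v 0 ord0.
  have: hyp_pi (hyp_repr (hyp_pi v)) = hyp_pi v by exact: hyp_reprK.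
  case/hyp_piP=> a; rewrite sum_coordsE => /rowP e; rewrite mxE.
  have := e (lift ord0 j); have := e ord0; rewrite !mxE mulr1.
  move=> /eqP; rewrite subr_eq => /eqP-> /eqP; rewrite subr_eq => /eqP->.
  by rewrite opprD addrACA subrr add0r.
have liftE (w : 'rV[R]_d) j : row_mx (0 : 'rV_1) w 0 (lift ord0 j) = w 0 j.
  have -> : lift ord0 j = rshift 1 j by apply: val_inj.
  by rewrite row_mxEr.
have ord0E (w : 'rV[R]_d) : row_mx (0 : 'rV_1) w 0 ord0 = 0.
  have -> : ord0 = lshift d (0 : 'I_1) by apply: val_inj.
  by rewrite row_mxEl mxE.
exists g => [w|q]; first by apply/rowP=> j; rewrite gE liftE ord0E subr0.
have [v <-] := hyp_pi_surj q.
apply/hyp_piP; exists (- v 0 ord0); rewrite sum_coordsE; apply/rowP=> j.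
rewrite [LHS]mxE [X in _ + X]mxE [RHS]mxE [const_mx _ _ _]mxE mulr1.
case: (unliftP ord0 j) => [k ->|->]; last by rewrite ord0E sub0r.
by rewrite liftE gE addrAC subrr add0r.
Qed.

Section PermModule.
Variables (R : comNzRingType) (gT : finGroupType) (d : nat).
Variable to : {action gT &-> 'I_d}.

(* Permutation of the coordinate functions, x_i . g = x_(i . g). *)
Definition perm_lin (g : gT) (v : 'rV[R]_d) : 'rV[R]_d :=
  \sum_(i < d) v 0 i *: delta_mx 0 (to i g).

Lemma perm_linE g v j : perm_lin g v 0 j = v 0 (to j g^-1%g).
Proof.
rewrite summxE (bigD1 (to j g^-1%g)) //= big1 => [|i ij].
  by rewrite !mxE actKV !eqxx mulr1 addr0.
rewrite !mxE eqxx /=; case: eqP => [jE|]; last by rewrite mulr0.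
by rewrite jE actK eqxx in ij.
Qed.

Lemma perm_lin_linear g : linear (perm_lin g).
Proof. by move=> a u v; apply/rowP=> j; rewrite perm_linE !mxE !perm_linE. Qed.

Definition hyp_act (g : gT) (q : hyp_mod R d) : hyp_mod R d :=
  hyp_pi (perm_lin g (hyp_repr q)).

Lemma hyp_act_pi g v : hyp_act g (hyp_pi v) = hyp_pi (perm_lin g v).
Proof.
have: hyp_pi (hyp_repr (hyp_pi v)) = hyp_pi v by exact: hyp_reprK.
case/hyp_piP=> a; rewrite sum_coordsE => /rowP e; apply/hyp_piP; exists a.
rewrite sum_coordsE; apply/rowP=> j; have := e (to j g^-1%g).
by rewrite [in X in _ -> X]mxE ![in X in _ -> _ = X]mxE !mxE !perm_linE => ->.
Qed.

Fact hyp_act_linear g : linear (hyp_act g).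
Proof.
move=> a p q; have [u <-] := hyp_pi_surj p; have [v <-] := hyp_pi_surj q.
by rewrite -linearP !hyp_act_pi -linearP perm_lin_linear.
Qed.
HB.instance Definition _ g := GRing.isLinear.Build R _ _ _ (hyp_act g)
  (hyp_act_linear g).

Fact hyp_act1 q : hyp_act 1%g q = q.
Proof.
have [v <-] := hyp_pi_surj q; rewrite hyp_act_pi; congr hyp_pi.
by apply/rowP=> j; rewrite perm_linE invg1 act1.
Qed.

Fact hyp_actM g h q : hyp_act (g * h)%g q = hyp_act h (hyp_act g q).
Proof.
have [v <-] := hyp_pi_surj q; rewrite !hyp_act_pi; congr hyp_pi.
by apply/rowP=> j; rewrite !perm_linE invMg actM.
Qed.

(* The module (R x_1 + ... + R x_d) / R (x_1 + ... + x_d) of linear forms on   *)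
(* the hyperplane x_1 + ... + x_d = 0.                                         *)
Definition hyperplane : glmod R gT :=
  @GLmod R gT (hyp_mod R d) hyp_act hyp_act1 hyp_actM (hyp_mod_free R d).

End PermModule.

(* Main.v *)
(* Let L be the function field of F, n = #H, and sigma_1, ..., sigma_d the      *)
(* embeddings of K(C) into L, indexed by the coordinates x_i.  A homomorphism   *)
(* to O_F is given by its values at the x_i, and the equivariant ones are the   *)
(* (sigma_i f)_i with f in O_C of trace zero.  Take an R-basis of O_C made of   *)
(* one element whose trace p^t generates Tr(O_C) and of elements of trace zero. *)
(* Adding up columns, det(sigma_i b_j) equals p^t times the determinant of the  *)
(* matrix spanning O_F Xi in the coordinates x_i, i <> i0; since its square is  *)
(* the discriminant of C and L/K is totally ramified, the length in question is *)
(* n d_C / 2 - n t.  Finally t is the minimum over j of the largest s with      *)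
(* Tr(O_(C_j)) in p^s R; as C_j -> D is totally ramified, its different has     *)
(* valuation d_(C_j) and this s is the integral part of d_(C_j) / [C_j : D].    *)
(* Total ramification comes from lifting idempotents, k being algebraically     *)
(* closed and R complete.                                                       *)
Require Import Defs.
From HB Require Import structures.
From mathcomp Require Import all_boot all_order all_algebra all_fingroup all_field.
From mathcomp Require Import generic_quotient.
From mathcomp Require Import boolp classical_sets.
From mathcomp Require Import ring zify.

Set Implicit Arguments.
Unset Strict Implicit.
Unset Printing Implicit Defensive.

Import GRing.Theory.
Local Open Scope ring_scope.


(** * Valuations and lattices *)

(** Write L for the function field of F, O for the integral closure of O_D in L, n for the order of
    H and p for a uniformizer of O_D.

    The length is the valuation of a determinant. A homomorphism from the linear forms on the
    hyperplane to O is a vector of d values with sum zero. Dropping one coordinate i0 identifies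
    these with rows of length d - 1 ([coords_homK], [hom_coordsK]). The equivariant ones are the
    vectors of conjugates of the trace-zero elements of O_C ([equiv_homs_cover],
    [cover_equiv_homs]). The quotient is then that of a free O-module by the row span of a square
    matrix M, and has length the valuation of det M ([row_chain_exists], [row_chain_bound],
    [quot_length_row]).

    To compute det M, let S be the matrix of conjugates of an O_D-basis of O_C. Its square
    determinant is the discriminant of C ([cover_basis]), and its row sums are the traces. Clearing
    rows with a basis element whose trace has least order t gives det S = (that trace) times det M
    ([det_row_sums]). As p has valuation n in O ([comp_ramified]), 2 (n t + length) = n d_C.
    Dividing by 2 n gives the formula, with t in place of the minimum.

    It remains to find t, the exponent of the trace ideal of O_C, which is the least exponent among
    those of the C_j. The linear forms on O_(C_j) form a free module of rank one over it. The trace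
    is a generator times some delta of norm the discriminant up to a unit, and p^s divides all
    traces exactly when [C_j : D] s is at most d_(C_j) ([different_exponent], [comp_trace_disc]).
    This is where the integral part comes from.

    Both halves need F and C_j to be totally ramified over D ([totally_ramified]). Idempotents
    modulo p lift by completeness, and a domain has only 0 and 1; the residue field being
    algebraically closed, every element is then congruent to one of O_D modulo the maximal ideal,
    and integral closedness makes that ideal principal. The Galois theory of L over K(D) is
    extracted from the torsor isomorphism ([component_field], [comp_data_exists]). *)

Section Uniformizer.
Variables (F : fieldType) (S : subringClosed F) (p : F).

(** S is a discrete valuation ring with uniformizer p. F may be larger than its field of fractions,
    so that rings of invariants can be handled inside L. *)
Definition uniformizer :=
  [/\ p \in S, p^-1 \notin S & forall z, z \in S -> z != 0 ->
      exists n u, [/\ u \in S, u^-1 \in S & z = u * p ^+ n]].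

Definition has_val (z : F) (n : nat) :=
  [&& z != 0, z / p ^+ n \in S & p ^+ n / z \in S].

Hypothesis unif : uniformizer.

Lemma unif_mem : p \in S. Proof. by case: unif. Qed.

Lemma unif_neq0 : p != 0.
Proof. by case: unif => _ /negP pV _; apply/eqP => p0; apply: pV; rewrite p0 invr0 rpred0. Qed.

Let p0 := unif_neq0.
Let pn0 n : p ^+ n != 0. Proof. by rewrite expf_neq0. Qed.

Lemma unif_pow_mem m n : (p ^+ m / p ^+ n \in S) = (n <= m)%N.
Proof.
case: leqP => [le|lt]; first by rewrite -expfB_cond ?(negPf p0) // rpredX ?unif_mem.
apply/negP => H; case: unif => _ /negP pV _; apply: pV.
have -> : p^-1 = p ^+ (n - m).-1 * (p ^+ m / p ^+ n).
  have -> : p ^+ n = p ^+ m * (p ^+ (n - m).-1 * p).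
    by rewrite -exprSr -exprD; congr (_ ^+ _); lia.
  by rewrite !invfM; field; rewrite p0 !pn0.
by rewrite rpredM // rpredX ?unif_mem.
Qed.

Lemma has_val_ex z : z \in S -> z != 0 -> exists n, has_val z n.
Proof.
move=> Sz z0; case: unif => _ _ /(_ z Sz z0)[n [u [Su SuV zE]]].
have u0 : u != 0 by apply: contraNneq z0 => u0; rewrite zE u0 mul0r.
exists n; rewrite /has_val z0 zE mulfK // Su /=.
by rewrite invfM mulrCA mulfV ?mulr1.
Qed.

Lemma has_val_mem z n s : has_val z n -> (z / p ^+ s \in S) = (s <= n)%N.
Proof.
case/and3P=> z0 Sz SzV; rewrite -unif_pow_mem; apply/idP/idP => H.
  have -> : p ^+ n / p ^+ s = (p ^+ n / z) * (z / p ^+ s) by field; rewrite z0 pn0.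
  exact: rpredM.
have -> : z / p ^+ s = (z / p ^+ n) * (p ^+ n / p ^+ s) by field; rewrite !pn0.
exact: rpredM.
Qed.

Lemma has_val_uniq z m n : has_val z m -> has_val z n -> m = n.
Proof.
move=> zm zn; apply/eqP; rewrite eqn_leq -(has_val_mem _ zn) -(has_val_mem _ zm).
by case/and3P: zm => _ -> _; case/and3P: zn => _ -> _.
Qed.

Lemma has_valM y z m n : has_val y m -> has_val z n -> has_val (y * z) (m + n).
Proof.
case/and3P=> y0 Sy SyV /and3P[z0 Sz SzV]; rewrite /has_val mulf_neq0 // exprD.
by rewrite invfM mulrACA rpredM // invfM mulrACA rpredM.
Qed.

Lemma has_val0P z : has_val z 0 <-> [/\ z != 0, z \in S & z^-1 \in S].
Proof.
by rewrite /has_val expr0 divr1 div1r; split=> [/and3P|] // [-> -> ->].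
Qed.

Lemma has_val_unif : has_val p 1.
Proof. by rewrite /has_val expr1 mulfV // rpred1 p0. Qed.

Lemma has_valX z m n : has_val z m -> has_val (z ^+ n) (m * n).
Proof.
move=> zm; elim: n => [|n IHn]; last by rewrite exprS mulnS has_valM.
by rewrite muln0; apply/has_val0P; rewrite expr0 invr1 oner_neq0 rpred1.
Qed.

Lemma mem_nunit z : z \in S -> z != 0 -> z^-1 \notin S -> z / p \in S.
Proof.
move=> Sz z0 SzV; have [[|n] zn] := has_val_ex Sz z0.
  by case/has_val0P: zn => _ _; rewrite (negPf SzV).
by rewrite -[p]expr1 (has_val_mem _ zn).
Qed.

Section Rows.
Variable m : nat.

Definition row_submod (Q : set 'rV[F]_m) :=
  [/\ Q 0, forall u v, Q u -> Q v -> Q (u + v)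
    & forall a u, a \in S -> Q u -> Q (a *: u)].

Definition row_span k (T : 'M[F]_(k, m)) : set 'rV[F]_m :=
  [set v | exists2 c, c \is a mxOver S & v = c *m T]%classic.

Lemma row_span_submod k (T : 'M[F]_(k, m)) : row_submod (row_span T).
Proof.
split=> [|u v [c cS ->] [c' c'S ->]|a u aS [c cS ->]].
- by exists 0; rewrite ?mul0mx // mxOver0 ?rpred0.
- by exists (c + c'); [apply/mxOverP=> i j; rewrite mxE rpredD ?(mxOverP _) | rewrite mulmxDl].
by exists (a *: c); [apply/mxOverP=> i j; rewrite mxE rpredM ?(mxOverP _) | rewrite scalemxAl].
Qed.

End Rows.

Lemma mxOver_mulS k l n (A : 'M[F]_(k, l)) (B : 'M[F]_(l, n)) :
  A \is a mxOver S -> B \is a mxOver S -> A *m B \is a mxOver S.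
Proof.
move=> AS BS; apply/mxOverP=> i j; rewrite mxE rpred_sum // => a _.
by rewrite rpredM ?(mxOverP AS) ?(mxOverP BS).
Qed.

Lemma det_mem n (A : 'M[F]_n) : A \is a mxOver S -> \det A \in S.
Proof.
move=> AS; rewrite rpred_sum // => s _; rewrite rpredM ?rpred_sign //.
by rewrite rpred_prod // => i _; apply: (mxOverP AS).
Qed.

Lemma adj_mxOver n (A : 'M[F]_n) : A \is a mxOver S -> \adj A \is a mxOver S.
Proof.
move=> AS; apply/mxOverP=> i j; rewrite mxE rpredM ?rpred_sign //.
by apply: det_mem; apply/mxOverP=> a b; rewrite !mxE (mxOverP AS).
Qed.

Lemma row_span_sub m k l (T : 'M[F]_(k, m)) (T' : 'M[F]_(l, m)) :
  (row_span T `<=` row_span T')%classic <->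
  exists2 C, C \is a mxOver S & T = C *m T'.
Proof.
split=> [sub|[C CS ->] v [c cS ->]]; last first.
  by exists (c *m C); rewrite ?mulmxA // mxOver_mulS.
have /choice[C CP] i : exists c, (c \is a mxOver S) /\ row i T = c *m T'.
  case: (sub (row i T)); last by move=> c; exists c.
  exists (delta_mx 0 i); last by rewrite rowE.
  by apply/mxOverP=> a b; rewrite mxE; case: (_ && _); rewrite ?rpred1 ?rpred0.
exists (\matrix_i C i).
  by apply/mxOverP=> i j; rewrite mxE; apply: (mxOverP (CP i).1).
by apply/row_matrixP=> i; rewrite row_mul rowK (CP i).2.
Qed.

(* Hermite reduction: a vector with first coordinate of minimal valuation      *)
(* clears the first coordinates of all others.                                 *)
Lemma row_submod_free m (Q : set 'rV[F]_m) N :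
    row_submod Q -> (forall v, Q v -> v \is a mxOver S) ->
    (forall i, Q (p ^+ N *: delta_mx 0 i)) ->
  exists T, \det T != 0 /\ Q = row_span T.
Proof.
elim: m Q => [|m IHm]; first move=> Q Qsub QS QN.
  exists 1%:M; rewrite det1 oner_neq0; split=> //.
  apply/predeqP=> v; split=> _; last by rewrite thinmx0; case: Qsub.
  by exists 0; rewrite ?mxOver0 ?rpred0 // [v]thinmx0 mul0mx.
rewrite -[m.+1]/(1 + m)%N => Q Qsub QS QN.
pose val0 n := `[< exists v, Q v /\ has_val (v 0 0) n >].
have val0N : exists n, val0 n.
  exists N; apply/asboolP; exists (p ^+ N *: delta_mx 0 0); split=> //.
  by rewrite !mxE !eqxx mulr1 /has_val pn0 mulfV // rpred1.
case: (ex_minnP val0N) => n /asboolP[q [Qq qn]] n_min.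
have [q00 Sq SqV] := and3P qn.
(* The vectors of Q with zero first coordinate, to which induction applies. *)
pose Q' : set 'rV[F]_m := fun v => Q (row_mx (0 : 'M_1) v).
have [Q0 QD QZ] := Qsub.
have [T [T0 Q'E]] : exists T, \det T != 0 /\ Q' = row_span T.
  apply: IHm => [|v /QS vS|i].
  - split=> [|u v Qu Qv|a u aS Qu]; rewrite /Q' ?row_mx0 //.
      by rewrite -[0]addr0 -add_row_mx; apply: QD.
    by rewrite -[0](scaler0 _ a) -scale_row_mx; apply: QZ.
  - by apply/mxOverP=> i j; have := mxOverP vS i (rshift 1 j); rewrite row_mxEr.
  suff -> : Q' (p ^+ N *: delta_mx 0 i) = Q (p ^+ N *: delta_mx 0 (rshift 1 i)) by [].
  rewrite /Q'; congr Q; apply/rowP=> j; rewrite -[j]splitK.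
  case: split => k /=; rewrite ?row_mxEl ?row_mxEr !mxE ?eq_lrshift ?andbF ?mulr0 //.
pose T' : 'M[F]_(1 + m) := block_mx (lsubmx q) (rsubmx q) 0 T.
have l00 : lsubmx q = (q 0 0)%:M.
  by apply/rowP=> i; rewrite !mxE !ord1; congr (q _ _); apply/val_inj.
have T'row : forall c (c' : 'rV_m),
    row_mx c%:M c' *m T' = c *: q + row_mx (0 : 'M_1) (c' *m T).
  move=> c c'; rewrite mul_row_block mulmx0 addr0 !mul_scalar_mx.
  rewrite -[in RHS](hsubmxK q) scale_row_mx add_row_mx addr0.
  by [].
exists T'; split; first by rewrite det_ublock l00 det_scalar1 mulf_neq0.
apply/predeqP=> v; split=> [Qv|[c cS ->]].
  pose a := v 0 0 / q 0 0.
  have aS : a \in S.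
    have [v0|v0] := eqVneq (v 0 0) 0; first by rewrite /a v0 mul0r rpred0.
    have vS := mxOverP (QS _ Qv) 0 0.
    have [n' vn'] := has_val_ex vS v0.
    have le : (n <= n')%N by apply: n_min; apply/asboolP; exists v.
    have -> : a = (v 0 0 / p ^+ n) * (p ^+ n / q 0 0) by rewrite /a; field; rewrite q00 pn0.
    by rewrite rpredM // (has_val_mem _ vn').
  have Qw : Q (v - a *: q).
    by rewrite -scaleNr; apply: QD => //; apply: QZ => //; rewrite rpredN.
  have wE : v - a *: q = row_mx (0 : 'M_1) (rsubmx (v - a *: q)).
    rewrite -[LHS]hsubmxK; congr row_mx.
    apply/rowP=> i; rewrite !mxE ord1.
    have -> : lshift m (0 : 'I_1) = 0 by apply/val_inj.
    by rewrite /a mulfVK // subrr.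
  have : Q' (rsubmx (v - a *: q)) by rewrite /Q' -wE.
  rewrite Q'E => -[c' c'S c'E]; exists (row_mx a%:M c').
    apply/mxOverP=> i j; rewrite mxE; case: split => k; last exact: (mxOverP c'S).
    by rewrite !ord1 mxE eqxx mulr1n.
  by rewrite T'row -c'E -wE addrC subrK.
have -> : c = row_mx (c 0 0)%:M (rsubmx c).
  rewrite -[LHS](hsubmxK c); congr row_mx.
  by apply/rowP=> i; rewrite !mxE !ord1; congr (c _ _); apply/val_inj.
rewrite T'row; apply: QD; first by apply: QZ => //; apply: (mxOverP cS).
have : row_span T (rsubmx c *m T).
  by eexists=> //; apply/mxOverP=> i j; rewrite mxE (mxOverP cS).
by rewrite -Q'E.
Qed.

End Uniformizer.


(** * Chains of lattices *)

Section Length.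
Variables (F : fieldType) (S : subringClosed F) (p : F).
Hypothesis unif : uniformizer S p.
Variable m : nat.
Implicit Types (T C : 'M[F]_m) (Q P : set 'rV[F]_m).
Local Open Scope classical_set_scope.

Let Sp := unif_mem unif.
Let p0 := unif_neq0 unif.
Let pn0 n : p ^+ n != 0. Proof. by rewrite expf_neq0. Qed.

Definition row_chain Q P n :=
  exists c : nat -> set 'rV[F]_m,
    [/\ c 0%N = Q, c n = P, forall i, (i <= n)%N -> row_submod S (c i) &
        forall i, (i < n)%N -> c i `<` c i.+1].

Lemma row_chain_inv Q P n : row_chain Q P n ->
  (n = 0%N /\ Q = P) \/ exists n' Q', [/\ n = n'.+1, Q `<` Q', row_submod S Q & row_chain Q' P n'].
Proof.
case: n => [|n] [c [c0 cn csub clt]]; first by left; rewrite -c0 -cn.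
right; exists n, (c 1%N); split=> //; first by rewrite -c0; apply: clt.
  by rewrite -c0; apply: csub.
by exists (fun i => c i.+1); split=> // i lei; [apply: csub | apply: clt].
Qed.

Lemma row_chain_cons Q Q' P n : row_submod S Q -> Q `<` Q' ->
  row_chain Q' P n -> row_chain Q P n.+1.
Proof.
move=> Qsub lt [c [c0 cn csub clt]]; exists (fun i => if i is j.+1 then c j else Q).
split=> // [[|i]|[|i]] // lei; [exact: csub | by rewrite c0 | exact: clt].
Qed.

Lemma row_chain_sub Q P n : row_chain Q P n -> Q `<=` P.
Proof.
elim: n Q => [|n IHn] Q /row_chain_inv[[// _ ->]|[n' [Q' [// [<-] [sub _] _ /IHn]]]] //.
exact: subset_trans.
Qed.

Lemma row_chain_submod Q P n : row_chain Q P n -> row_submod S Q.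
Proof. by case=> c [<- _ csub _]; apply: csub. Qed.

Lemma row_span_full T : T \is a mxOver S -> (\det T)^-1 \in S -> \det T != 0 ->
  row_span S T = [set v | v \is a mxOver S].
Proof.
move=> TS dS d0; apply/predeqP=> v; split=> [[c cS ->]|vS]; first exact: mxOver_mulS.
exists (v *m invmx T); last by rewrite mulmxKV // unitmxE unitfE.
apply: mxOver_mulS => //; rewrite /invmx unitmxE unitfE d0.
by apply/mxOverP=> i j; rewrite mxE rpredM // (mxOverP (adj_mxOver TS)).
Qed.

Lemma det_replace_row n (c : 'rV[F]_n) j :
  \det (\matrix_i (if i == j then c else delta_mx 0 i)) = c 0 j.
Proof.
pose C := \matrix_i (if i == j then c else delta_mx 0 i).
(* The cofactors along row j do not involve row j, so they are those of the identity matrix. *)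
have cofE k : cofactor C j k = (\adj 1%:M) k j.
  rewrite mxE /cofactor; congr (_ * \det _); apply/matrixP=> a b.
  by rewrite !mxE [_ == j]eq_sym (negPf (neq_lift j a)) !mxE eqxx /= eq_sym.
rewrite (expand_det_row _ j) (bigD1 j) //= cofE adj1 !mxE eqxx mulr1 big1 ?addr0 // => k kj.
by rewrite cofE adj1 !mxE (negPf kj) mulr0.
Qed.

(** Induction on the valuation of det T. If it is positive, some row i of the inverse of T is not
    integral. Scaled by the least power p^(a+1) that makes it integral, it becomes a row c with a
    unit coordinate c_j. Replacing row j of T by c T / p, which is p^a times a unit vector, enlarges
    the row lattice and multiplies the determinant by c_j / p. *)
Lemma row_chain_exists N T : T \is a mxOver S -> has_val S p (\det T) N ->
  row_chain (row_span S T) [set v | v \is a mxOver S] N.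
Proof.
elim: N T => [|N IHN] T TS dN.
  have [//|d0 _ dS] := (has_val0P S p (\det T)).1.
  exists (fun=> row_span S T); rewrite (row_span_full TS) //; split=> // i _.
  by rewrite -(row_span_full TS) //; apply: row_span_submod.
have d0 : \det T != 0 by case/and3P: dN.
have Tu : T \in unitmx by rewrite unitmxE unitfE.
have nVS : ~~ (invmx T \is a mxOver S).
  apply/negP=> /det_mem; rewrite det_inv => dV.
  have /(has_val_uniq unif dN) // : has_val S p (\det T) 0.
  by apply/has_val0P; split=> //; apply: det_mem.
have [i iS] : exists i, row i (invmx T) \isn't a mxOver S.
  apply: contrapT => /forallNP iS; move/negP: nVS; apply.
  apply/mxOverP=> i j; have /negP := iS i; rewrite negbK => /mxOverP/(_ 0 j).
  by rewrite mxE.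
pose good a := p ^+ a *: row i (invmx T) \is a mxOver S.
have good_ex : exists a, good a.
  exists N.+1; apply/mxOverP=> k j; rewrite !mxE /invmx Tu mxE mulrA.
  by rewrite rpredM ?(mxOverP (adj_mxOver TS)) //; case/and3P: dN.
case: (ex_minnP good_ex) => -[|a]; first by rewrite /good expr0 scale1r (negPf iS).
rewrite /good; set c := _ *: _ => cS a_min.
have cT : c *m T = p ^+ a.+1 *: delta_mx 0 i.
  by rewrite -scalemxAl -row_mul mulVmx // row1.
have [j cj] : exists j, c 0 j / p \notin S.
  apply: contrapT => /forallNP cpS.
  suff /a_min : good a by rewrite ltnn.
  apply/mxOverP=> k j; have /negP := cpS j; rewrite negbK ord1 !mxE exprS.
  by rewrite mulrAC [p * _]mulrC mulfK.
have cjS := mxOverP cS 0 j.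
have cj0 : c 0 j != 0 by apply: contraNneq cj => ->; rewrite mul0r rpred0.
have cjV : (c 0 j)^-1 \in S.
  by apply: contraR cj => cjV; apply: (mem_nunit unif).
clearbody c; pose C : 'M[F]_m := \matrix_k (if k == j then p^-1 *: c else delta_mx 0 k).
pose T' := C *m T.
have T'E : T' = \matrix_k (if k == j then p ^+ a *: delta_mx 0 i else row k T).
  apply/row_matrixP=> k; rewrite row_mul !rowK; case: eqP => _; last by rewrite -rowE.
  by rewrite -scalemxAl cT scalerA exprS mulKf.
have T'S : T' \is a mxOver S.
  rewrite T'E; apply/mxOverP=> k l; rewrite mxE; case: eqP => _; rewrite !mxE.
    by rewrite rpredM ?rpredX //; case: (_ && _); rewrite ?rpred1 ?rpred0.
  exact: (mxOverP TS).
have dT' : has_val S p (\det T') N.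
  have pdT' : p * \det T' = c 0 j * \det T.
    by rewrite det_mulmx /C det_replace_row mxE mulrA mulVKf.
  have cj_val : has_val S p (c 0 j) 0 by apply/has_val0P.
  have : has_val S p (p * \det T') N.+1.
    by rewrite pdT' -[N.+1]add0n; apply: has_valM.
  have dT'0 : \det T' != 0.
    by apply: contraTneq (mulf_neq0 cj0 d0) => d'0; rewrite -pdT' d'0 mulr0 eqxx.
  have [k kN] := has_val_ex unif (det_mem T'S) dT'0.
  move=> /(has_val_uniq unif (has_valM (has_val_unif unif) kN)); rewrite add1n => -[<-].
  exact: kN.
apply: (row_chain_cons (Q' := row_span S T')) (IHN _ T'S dT').
  exact: row_span_submod.
split.
  (* Row j of T is recovered from c T = p (row j of T') by solving for its coefficient c_j, a
     unit. *)
  apply/row_span_sub; exists (\matrix_k (if k == j then (c 0 j)^-1 *: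
     (p *: delta_mx 0 j - \sum_(l | l != j) c 0 l *: delta_mx 0 l) else delta_mx 0 k)).
    apply/mxOverP=> k l; rewrite mxE; case: eqP => _; rewrite !mxE.
      rewrite rpredM ?rpredB //.
        by rewrite rpredM //; case: (_ && _); rewrite ?rpred1 ?rpred0.
      rewrite summxE rpred_sum // => b _; rewrite !mxE rpredM ?(mxOverP cS) //.
      by case: (_ && _); rewrite ?rpred1 ?rpred0.
    by case: (_ && _); rewrite ?rpred1 ?rpred0.
  apply/row_matrixP=> k; rewrite row_mul rowK.
  case: (eqVneq k j) => [->|kj]; last by rewrite -rowE T'E rowK (negPf kj).
  rewrite -scalemxAl mulmxBl -scalemxAl -rowE [in row j T']T'E rowK eqxx scalerA -exprS -cT.
  have -> : (\sum_(l | l != j) c 0 l *: delta_mx 0 l) *m T' =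
            \sum_(l | l != j) c 0 l *: row l T.
    rewrite mulmx_suml; apply: eq_bigr => l lj.
    by rewrite -scalemxAl -rowE T'E rowK (negPf lj).
  rewrite mulmx_sum_row (bigD1 j) //= addrK scalerA mulVf ?scale1r //.
(* If T' were spanned by T, its determinant would be a multiple of det T, whose valuation is
   larger. *)
move=> /row_span_sub [D DS DE].
have dE : \det T' = \det D * \det T by rewrite DE det_mulmx.
have D0 : \det D != 0.
  by apply: contraTneq dT' => D0; rewrite dE D0 mul0r /has_val eqxx.
have [k kD] := has_val_ex unif (det_mem DS) D0.
rewrite dE in dT'; have E := has_val_uniq unif dT' (has_valM kD dN).
by move: (leqnn N); rewrite {1}E addnS ltnNge leq_addl.
Qed.

(** The next member of a chain is again the row lattice of some square T', by [row_submod_free].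
    Then T = D T' with D integral, and det D is not a unit since the inclusion is strict. So each
    step lowers the valuation of the determinant. *)
Lemma row_chain_bound N T n : T \is a mxOver S -> has_val S p (\det T) N ->
  row_chain (row_span S T) [set v | v \is a mxOver S] n -> (n <= N)%N.
Proof.
elim: n N T => [//|n IHn] N T TS dN /row_chain_inv[[//]|].
move=> [n' [Q' [[<-] [sub nsub] _ chain]]].
have d0 : \det T != 0 by case/and3P: dN.
have [T' [d'0 Q'E]] : exists T', \det T' != 0 /\ Q' = row_span S T'.
  apply: (row_submod_free (p := p) unif (N := N)) => [|v|i].
  - exact: row_chain_submod chain.
  - exact: (row_chain_sub chain).
  (* Up to a unit, p^N is det T, and the adjugate shows that det T times each unit vector lies in
     the row lattice. *)
  apply: sub; exists (p ^+ N *: delta_mx 0 i *m invmx T); last first.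
    by rewrite mulmxKV // unitmxE unitfE.
  rewrite -scalemxAl -rowE; apply/mxOverP=> k j.
  rewrite !mxE /invmx unitmxE unitfE d0 mxE mulrA.
  by rewrite rpredM ?(mxOverP (adj_mxOver TS)) //; case/and3P: dN.
have T'S : T' \is a mxOver S.
  apply/mxOverP=> i j; have : row_span S T' (row i T').
    by exists (delta_mx 0 i); rewrite ?rowE //; apply/mxOverP=> a b; rewrite mxE;
       case: (_ && _); rewrite ?rpred1 ?rpred0.
  by rewrite -Q'E => /(row_chain_sub chain)/mxOverP/(_ 0 j); rewrite mxE.
have [N' dN'] := has_val_ex unif (det_mem T'S) d'0.
move: sub; rewrite Q'E => /row_span_sub[D DS DE].
have dE : \det T = \det D * \det T' by rewrite DE det_mulmx.
have D0 : \det D != 0 by apply: contraTneq d0 => D0; rewrite dE D0 mul0r eqxx.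
have [k kD] := has_val_ex unif (det_mem DS) D0.
rewrite dE in dN; rewrite (has_val_uniq unif dN (has_valM kD dN')).
rewrite Q'E in chain; have := IHn _ _ T'S dN' chain.
case: k kD => [|k _]; last by rewrite addSn ltnS => /leq_trans; apply; apply: leq_addl.
case/has_val0P=> _ _ DV; case: nsub; rewrite Q'E; apply/row_span_sub.
exists (invmx D); last by rewrite DE mulKmx // unitmxE unitfE.
rewrite /invmx unitmxE unitfE D0.
by apply/mxOverP=> i j; rewrite mxE rpredM // (mxOverP (adj_mxOver DS)).
Qed.

End Length.


(** * The base ring *)

Lemma residue_prime (R : idomainType) (k : fieldType) (res : {rmorphism R -> k}) :
  is_residue_field res -> is_prime_ideal (@maxideal R).
Proof.
case=> _ resE; split; first split.
- by apply/resE; rewrite rmorph0.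
- by move=> x y /resE rx /resE ry; apply/resE; rewrite rmorphD rx ry addr0.
- by move=> a x /resE rx; apply/resE; rewrite rmorphM rx mulr0.
- by rewrite /maxideal /= unitr1.
move=> x y /resE/eqP; rewrite rmorphM mulf_eq0.
by case/orP => /eqP/resE; [left | right].
Qed.

(** The nonunits form an ideal, generated by some p, which is nonzero because a nonzero prime ideal
    exists. The intersection of the (p^n) is principal and equal to p times itself, hence zero as p
    is not a unit. So every nonzero element has an exact order at p. *)
Lemma dvr_uniformizer_exists (R : idomainType) (k : fieldType) (res : {rmorphism R -> k}) :
    is_dvr R -> is_residue_field res ->
  exists p : R, [/\ p != 0, forall x, maxideal x <-> exists y, x = y * p &
    forall r, r != 0 -> exists n u, u \is a GRing.unit /\ r = u * p ^+ n].
Proof.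
move=> [pid [P [[P_prime P0] P_uniq]]] kres.
have max_prime := residue_prime kres.
have [max_ideal _ _] := max_prime; have [_ maxD maxM] := max_ideal.
have [p pE] := pid _ max_ideal.
have maxE x : maxideal x <-> exists y, x = y * p.
  by rewrite pE; split=> [[y _ <-]|[y ->]]; [exists y | exists y].
have p0 : p != 0.
  apply/eqP => p0; case: P_prime => [[PI0 PID PIM] P1 _]; apply: P0.
  apply/predeqP=> x; split=> [Px|->//]; apply/eqP; apply: contrapT => /negP x0.
  case: (EM (maxideal x)) => [/maxE[y xE]|]; first by rewrite xE p0 mulr0 eqxx in x0.
  by rewrite /maxideal /= => /negP/negPn xu; apply: P1; rewrite -(mulVr xu); apply: PIM.
exists p; split=> // r r0.
have max_p : maxideal p by apply/maxE; exists 1; rewrite mul1r.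
pose I : set R := fun x => forall n, exists y, x = y * p ^+ n.
have I_ideal : is_ideal I.
  split=> [n|x y Ix Iy n|a x Ix n]; first by exists 0; rewrite mul0r.
    by have [[x' ->] [y' ->]] := (Ix n, Iy n); exists (x' + y'); rewrite mulrDl.
  by have [x' ->] := Ix n; exists (a * x'); rewrite mulrA.
have [a IE] := pid _ I_ideal.
have Ia : I a by rewrite IE; exists 1; rewrite ?mul1r.
have a0 : a = 0.
  have [b aE] := Ia 1%N; rewrite expr1 in aE.
  have : I b.
    move=> n; have [y aE'] := Ia n.+1; exists y; apply: (mulIf p0).
    by rewrite -aE aE' exprSr mulrA.
  rewrite IE => -[c _ bE]; apply/eqP; apply: contraT => a0.
  have : p \is a GRing.unit.
    apply/unitrPr; exists c; apply: (mulIf a0).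
    by rewrite mul1r -mulrA bE mulrC -aE.
  by move: max_p; rewrite /maxideal /= => /negP.
have nIr : ~ I r by rewrite IE => -[b _ rE]; rewrite -rE a0 mulr0 eqxx in r0.
have ex_n : exists n, `[< ~ exists y, r = y * p ^+ n >].
  by move/existsNP: nIr => [n rn]; exists n; apply/asboolP.
case: (ex_minnP ex_n) => -[|n] /asboolP rn n_min; first by case: rn; exists r; rewrite expr0 mulr1.
have [y rE] : exists y, r = y * p ^+ n.
  by apply: contrapT => /asboolP/n_min; rewrite ltnn.
exists n, y; split=> //; apply: contrapT => /negP yu; apply: rn.
by have /maxE[z yE] : maxideal y := yu; exists z; rewrite rE yE exprS mulrA.
Qed.

Lemma frac_ratio (R : idomainType) (x : {fraction R}) :
  exists r s : R, s != 0 /\ x * s%:F = r%:F.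
Proof.
elim/quotW: x => x; exists (frac x).1, (frac x).2; split; first exact: denom_ratioP.
unlock FracField.tofrac; rewrite -[LHS]FracField.pi_mul; apply/eqmodP.
rewrite /= FracField.equivfE /FracField.mulf !numden_Ratio ?oner_neq0 ?mulr1 //; [by rewrite mulrC | exact: (denom_ratioP x)..].
Qed.

Section ParamTheory.
Variables (R : idomainType) (p : R).
Hypothesis p0 : p != 0.
Hypothesis maxE : forall x : R, maxideal x <-> exists y, x = y * p.
Hypothesis factor : forall r : R, r != 0 ->
  exists n u, u \is a GRing.unit /\ r = u * p ^+ n.

Lemma param_nunit : p \isn't a GRing.unit.
Proof. by have : maxideal p by apply/maxE; exists 1; rewrite mul1r. Qed.

Lemma param_sep (r : R) : (forall n, exists y, r = y * p ^+ n) -> r = 0.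
Proof.
move=> rI; apply/eqP; apply: contraT => /factor[n [u [uu rE]]].
have [y rE'] := rI n.+1; have pn0 : p ^+ n != 0 by rewrite expf_neq0.
have uE : u = y * p by apply: (mulIf pn0); rewrite -rE rE' exprS mulrA.
by move: uu; rewrite uE unitrM (negPf param_nunit) andbF.
Qed.

Lemma ideal_exp_param n : ideal_exp (@maxideal R) n = [set r * p ^+ n | r in [set: R]]%classic.
Proof.
elim: n => [|n IHn].
  by apply/predeqP=> x; split=> // _; exists x; rewrite ?expr0 ?mulr1.
rewrite /ideal_exp iterS -/(ideal_exp _ _) IHn; apply/predeqP=> x; split.
  move=> [m [a [s [sP ->]]]]; elim/big_ind: _ => [|_ _ [r _ <-] [r' _ <-]|i _].
  - by exists 0; rewrite ?mul0r.
  - by exists (r + r'); rewrite ?mulrDl.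
  have [y [_ [/maxE[z ->] [r _ <-] ->]]] := sP i.
  by exists (a i * z * r) => //; rewrite exprS; ring.
move=> [r _ <-]; exists 1%N, (fun=> r), (fun=> p ^+ n.+1); split.
  move=> _; exists p, (p ^+ n); rewrite exprS; split=> //; last by exists 1; rewrite ?mul1r.
  exact: param_nunit.
by rewrite big_ord1.
Qed.

Lemma param_dvd_unit (m n : nat) (u y : R) :
  u \is a GRing.unit -> u * p ^+ m = y * p ^+ n -> (n <= m)%N.
Proof.
move=> uu uE; rewrite leqNgt; apply/negP=> lt.
have pm0 : p ^+ m != 0 by rewrite expf_neq0.
have uE' : u = y * p ^+ (n - m).
  by apply: (mulIf pm0); rewrite uE -mulrA -exprD subnK // ltnW.
move: uu; rewrite uE' unitrM -(prednK (_ : 0 < n - m)%N) ?subn_gt0 //.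
by rewrite exprS unitrM (negPf param_nunit) andbF.
Qed.

Lemma disc_exp_eq (V : vectType {fraction R}) (mul : V -> V -> V) U O n u :
  u \is a GRing.unit -> disc_ideal mul U O = [set r * (u * p ^+ n) | r in [set: R]]%classic ->
  disc_exp mul U O = n.
Proof.
move=> uu dE; rewrite /disc_exp; case: xgetP => [m _ /=|/(_ n) []].
  rewrite dE ideal_exp_param => mE.
  have : [set r * p ^+ m | r in [set: R]]%classic (u * p ^+ n) by rewrite -mE; exists 1; rewrite ?mul1r.
  have : [set r * (u * p ^+ n) | r in [set: R]]%classic (p ^+ m) by rewrite mE; exists 1; rewrite ?mul1r.
  move=> [y _ yE] [z _ zE]; apply/eqP; rewrite eqn_leq.
  rewrite (param_dvd_unit uu (esym zE)) andTb.
  by rewrite (@param_dvd_unit m n 1 (y * u)) ?unitr1 // mul1r -mulrA.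
rewrite /= dE ideal_exp_param; apply/predeqP=> x; split=> -[r _ <-].
  by exists (r * u); rewrite // mulrA.
by exists (r / u); rewrite // !mulrA divrK.
Qed.

Section Frac.
Definition int_frac : {pred {fraction R}} := [pred x | `[< exists r : R, x = r%:F >]].
Lemma int_frac_closed : subring_closed int_frac.
Proof.
split=> [|x y|x y]; first by apply/asboolP; exists 1; rewrite rmorph1.
  by move=> /asboolP[r ->] /asboolP[s ->]; apply/asboolP; exists (r - s); rewrite rmorphB.
by move=> /asboolP[r ->] /asboolP[s ->]; apply/asboolP; exists (r * s); rewrite rmorphM.
Qed.
HB.instance Definition _ := GRing.isSubringClosed.Build _ int_frac int_frac_closed.
End Frac.

Lemma int_fracP x : reflect (exists r : R, x = r%:F) (x \in int_frac).
Proof. exact: asboolP. Qed.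

Lemma int_frac_uniformizer : uniformizer int_frac p%:F.
Proof.
split=> [||z /int_fracP[r ->]]; first by apply/int_fracP; exists p.
  apply/negP=> /int_fracP[r rE]; have /negP := param_nunit; apply.
  apply/unitrPr; exists r; apply/eqP; rewrite -tofrac_eq tofracM tofrac1 -rE mulfV //.
  by rewrite tofrac_eq0.
rewrite tofrac_eq0 => /factor[n [u [uu ->]]]; exists n, u%:F.
rewrite rmorphM rmorphXn; split=> //; first by apply/int_fracP; exists u.
apply/int_fracP; exists u^-1; have u0 : u%:F != 0.
  by rewrite tofrac_eq0; apply: contraTneq uu => ->; rewrite unitr0.
by apply: (mulfI u0); rewrite mulfV // -tofracM mulrV // tofrac1.
Qed.

Lemma frac_denom (x : {fraction R}) : exists n, x * p%:F ^+ n \in int_frac.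
Proof.
have [r [s [s0 xE]]] := frac_ratio x; have [n [u [uu sE]]] := factor s0.
exists n; apply/int_fracP; exists (r / u); apply: (@mulIf _ u%:F).
  by rewrite tofrac_eq0; apply: contraTneq uu => ->; rewrite unitr0.
by rewrite -tofracXn -mulrA -!tofracM divrK // -xE sE [u * _]mulrC.
Qed.

End ParamTheory.


(** * Complete extensions are totally ramified *)

(** The family [mu] is a nonzero eigenvector, with eigenvalue x, of a matrix over R, so x is a root
    of the characteristic polynomial. *)
Lemma integral_stable (R : comNzRingType) (L : fieldType) (iota : {rmorphism R -> L}) n
    (mu : 'I_n -> L) (x : L) i0 : mu i0 != 0 ->
    (forall i, exists r : 'I_n -> R, x * mu i = \sum_j iota (r j) * mu j) ->
  integralOver iota x.
Proof.
move=> mu0 /choice[M ME]; pose A := \matrix_(i, j) M j i.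
exists (char_poly A); first exact: char_poly_monic.
rewrite map_char_poly -eigenvalue_root_char; apply/eigenvalueP.
exists (\row_i mu i).
  apply/rowP=> i; rewrite !mxE ME; apply: eq_bigr => j _.
  by rewrite !mxE mulrC.
by apply: contraNneq mu0 => /rowP/(_ i0); rewrite !mxE => ->.
Qed.

Section CompleteExtension.
Variables (R : idomainType) (p : R).
Hypothesis p0 : p != 0.
Hypothesis maxE : forall x : R, maxideal x <-> exists y, x = y * p.
Hypothesis factor : forall r : R, r != 0 ->
  exists n u, u \is a GRing.unit /\ r = u * p ^+ n.
Hypothesis complete : forall u : nat -> R, adic_cauchy u -> exists l, adic_limit u l.

Variables (L : fieldType) (iota : {rmorphism R -> L}).
Hypothesis iota_inj : injective iota.
Variables (S : subringClosed L) (n : nat) (w : 'I_n -> L).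
Hypothesis S_span : forall z, z \in S <-> exists c : 'I_n -> R, z = \sum_i iota (c i) * w i.
Hypothesis w_free : forall c : 'I_n -> R, \sum_i iota (c i) * w i = 0 -> forall i, c i = 0.

Notation q := (iota p).

Let q0 : q != 0. Proof. by rewrite -(rmorph0 iota) (inj_eq iota_inj). Qed.
Let qn0 k : q ^+ k != 0. Proof. by rewrite expf_neq0. Qed.

Lemma span_scale r z : z \in S -> iota r * z \in S.
Proof.
case/S_span=> c ->; apply/S_span; exists (fun i => r * c i); rewrite mulr_sumr.
by apply: eq_bigr => i _; rewrite rmorphM mulrA.
Qed.

Lemma iota_mem r : iota r \in S.
Proof. by rewrite -[iota r]mulr1 span_scale ?rpred1. Qed.

Lemma w_mem i : w i \in S.
Proof.
apply/S_span; exists (fun j => (j == i)%:R).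
rewrite (bigD1 i) //= eqxx rmorph1 mul1r big1 ?addr0 // => j ji.
by rewrite (negPf ji) rmorph0 mul0r.
Qed.

Lemma coord_inj (c d : 'I_n -> R) :
  \sum_i iota (c i) * w i = \sum_i iota (d i) * w i -> c =1 d.
Proof.
move=> E i; apply/eqP; rewrite -subr_eq0; apply/eqP.
apply: (w_free (c := fun i => c i - d i)).
move/eqP: E; rewrite -subr_eq0 -sumrB => /eqP E; rewrite -[RHS]E.
by apply: eq_bigr => j _; rewrite rmorphB mulrBl.
Qed.

Lemma coord_dvd (c : 'I_n -> R) k :
  (\sum_i iota (c i) * w i) / q ^+ k \in S -> forall i, exists d, c i = d * p ^+ k.
Proof.
case/S_span=> d dE i; exists (d i); apply: (coord_inj (d := fun i => d i * p ^+ k)).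
rewrite -[LHS](divfK (qn0 k)) dE mulr_suml; apply: eq_bigr => j _.
by rewrite rmorphM rmorphXn mulrAC.
Qed.

Lemma span_sep z : (forall k, z / q ^+ k \in S) -> z = 0.
Proof.
move=> zS; have := zS 0%N; rewrite expr0 divr1 => /S_span[c zE].
rewrite zE big1 // => i _; suff -> : c i = 0 by rewrite rmorph0 mul0r.
by apply: (param_sep p0 maxE factor) => k; apply: coord_dvd; rewrite -zE.
Qed.

Lemma qV_nmem : q^-1 \notin S.
Proof.
apply/negP => qV; suff /eqP : (1 : L) = 0 by rewrite oner_eq0.
by apply: span_sep => k; rewrite div1r -exprVn rpredX.
Qed.

(** Completeness passes from R to S coordinate by coordinate, because q^k divides an element of S
    exactly when p^k divides its coordinates. *)
Lemma span_complete (u : nat -> L) :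
    (forall k, u k \in S) -> (forall k, (u k.+1 - u k) / q ^+ k \in S) ->
  exists2 y, y \in S & forall k, (y - u k) / q ^+ k \in S.
Proof.
move=> uS du; have /choice[c cE] k : exists c : 'I_n -> R, u k = \sum_i iota (c i) * w i.
  exact/S_span.
have dc k i : exists d, c k.+1 i - c k i = d * p ^+ k.
  apply: (@coord_dvd (fun i => c k.+1 i - c k i)).
  rewrite (_ : \sum_i _ = u k.+1 - u k) // !cE -sumrB.
  by apply: eq_bigr => j _; rewrite rmorphB mulrBl.
have dc_add k j i : exists d, c (k + j)%N i - c k i = d * p ^+ k.
  elim: j => [|j [d dE]]; first by exists 0; rewrite addn0 subrr mul0r.
  have [d' d'E] := dc (k + j)%N i; exists (d' * p ^+ j + d).
  by rewrite addnS -(subrK (c (k + j)%N i) (c _ i)) d'E -addrA dE exprD; ring.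
have /choice[l lP] i : exists l, adic_limit (fun k => c k i) l.
  apply: complete => m; exists m => a b ma mb; rewrite (ideal_exp_param maxE).
  have [d dE] := dc_add m (a - m)%N i; have [d' d'E] := dc_add m (b - m)%N i.
  exists (d - d') => //; rewrite mulrBl -dE -d'E !subnKC //; ring.
exists (\sum_i iota (l i) * w i); first by apply/S_span; exists l.
move=> k; rewrite cE -sumrB mulr_suml rpred_sum // => i _.
have [N /(_ (N + k)%N (leq_addr _ _))] := lP i k.
rewrite (ideal_exp_param maxE) => -[d _ dE].
have [d' d'E] := dc_add k N i.
have -> : iota (l i) * w i - iota (c k i) * w i = iota ((d' - d) * p ^+ k) * w i.
  rewrite -mulrBl -rmorphB; congr (iota _ * _).
  by rewrite mulrBl dE -d'E addnC; ring.
by rewrite rmorphM rmorphXn mulrAC mulfK ?span_scale ?w_mem.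
Qed.

(* The inverse is the sum of a geometric series. *)
Lemma one_sub_unit s : s \in S -> (1 - q * s)^-1 \in S.
Proof.
move=> sS; pose u k := \sum_(i < k) (q * s) ^+ i.
have qS := iota_mem p.
have [y yS yE] : exists2 y, y \in S & forall k, (y - u k) / q ^+ k \in S.
  apply: span_complete => k; first by rewrite rpred_sum // => i _; rewrite rpredX ?rpredM.
  by rewrite /u big_ord_recr /= [X in X - _]addrC addrK exprMn mulrAC mulfV // mul1r rpredX.
suff <- : y = (1 - q * s)^-1 by [].
have yE1 : y * (1 - q * s) = 1.
  apply/eqP; rewrite -subr_eq0; apply/eqP; apply: span_sep => k.
  have -> : y * (1 - q * s) - 1 = (y - u k) * (1 - q * s) - (q * s) ^+ k.
    have : 1 - (q * s) ^+ k = (1 - q * s) * u k.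
      by rewrite -[1 in LHS](expr1n _ k) subrXX /u; congr (_ * _);
        apply: eq_bigr => i _; rewrite expr1n mul1r.
    move=> E; rewrite mulrBl [u k * _]mulrC -E; ring.
  rewrite mulrBl rpredB //.
    by rewrite mulrAC rpredM // rpredB ?rpred1 ?rpredM.
  by rewrite exprMn mulrAC mulfV // mul1r rpredX.
have nz : 1 - q * s != 0.
  by apply: contraTneq (oner_neq0 L) => z0; rewrite -yE1 z0 mulr0 eqxx.
by apply: (mulIf nz); rewrite yE1 mulVf.
Qed.

(* Newton iteration x |-> 3x^2 - 2x^3. *)
Lemma idempotent_lift x : x \in S -> (x ^+ 2 - x) / q \in S ->
  x / q \in S \/ (1 - x) / q \in S.
Proof.
move=> xS xq; pose f (y : L) := y ^+ 2 *+ 3 - y ^+ 3 *+ 2.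
pose u k := iter k f x; have qS := iota_mem p.
have uS k : u k \in S by elim: k => //= k IH; rewrite rpredB // rpredMn // rpredX.
have u2 k : (u k ^+ 2 - u k) / q ^+ k.+1 \in S.
  elim: k => [|k IH]; first by rewrite expr1.
  (* One Newton step squares the defect of idempotence, up to a factor in S. *)
  have -> : u k.+1 ^+ 2 - u k.+1 =
      (u k ^+ 2 - u k) ^+ 2 * (u k ^+ 2 *+ 4 - u k *+ 4 - 3%:R).
    by rewrite /= /f; ring.
  set t := u k ^+ 2 - u k in IH *.
  have -> : t ^+ 2 * (u k ^+ 2 *+ 4 - u k *+ 4 - 3%:R) / q ^+ k.+2 =
     (t / q ^+ k.+1) * (t / q ^+ k.+1) * q ^+ k * (u k ^+ 2 *+ 4 - u k *+ 4 - 3%:R).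
    by rewrite [q ^+ k.+2]exprS [q ^+ k.+1]exprS; field; rewrite q0 qn0.
  rewrite rpredM //; first by rewrite rpredM ?rpredX // rpredM.
  by apply: rpredB; first apply: rpredB; rewrite ?rpred_nat // rpredMn ?rpredX.
have du k : (u k.+1 - u k) / q ^+ k.+1 \in S.
  have -> : u k.+1 - u k = (u k ^+ 2 - u k) * (1 - u k *+ 2) by rewrite /= /f; ring.
  by rewrite mulrAC rpredM // rpredB ?rpred1 ?rpredMn.
have [y yS yE] : exists2 y, y \in S & forall k, (y - u k.+1) / q ^+ k \in S.
  apply: span_complete => k //.
  have -> : (u k.+2 - u k.+1) / q ^+ k = (u k.+2 - u k.+1) / q ^+ k.+2 * q ^+ 2.
    by rewrite !exprS; field; rewrite q0 qn0.
  by rewrite rpredM // rpredX.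
have y2 : y ^+ 2 - y = 0.
  apply: span_sep => k.
  have yuS : y + u k.+1 - 1 \in S by rewrite rpredB ?rpred1 // rpredD.
  have -> : y ^+ 2 - y = (y - u k.+1) * (y + u k.+1 - 1) + (u k.+1 ^+ 2 - u k.+1) by ring.
  rewrite mulrDl rpredD //; first by rewrite mulrAC rpredM.
  have -> : (u k.+1 ^+ 2 - u k.+1) / q ^+ k = (u k.+1 ^+ 2 - u k.+1) / q ^+ k.+2 * q ^+ 2.
    by rewrite !exprS; field; rewrite q0 qn0.
  by rewrite rpredM // rpredX.
have yx : (y - x) / q \in S.
  have H2 := yE 1%N; have H1 := du 1%N; have H0 := du 0%N.
  rewrite !expr1 in H0 H2.
  have -> : (y - x) / q = (y - u 2) / q + (u 2 - u 1%N) / q ^+ 2 * q + (u 1%N - u 0%N) / q.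
    by rewrite -[u 0%N]/x; move: (u 2) (u 1%N) => a b; field.
  by rewrite rpredD // rpredD // rpredM.
(* In the field L the lifted idempotent y is 0 or 1, and x is congruent to y modulo q. *)
have : y * (y - 1) == 0 by rewrite mulrBr mulr1 -expr2 y2.
rewrite mulf_eq0 subr_eq0 => /orP[/eqP yE0|/eqP yE1]; [left|right].
  by rewrite -rpredN -mulNr -[- x]add0r -yE0.
by rewrite -yE1.
Qed.

(** * Residues and the maximal ideal of S *)

Variables (k : closedFieldType) (res : {rmorphism R -> k}).
Hypothesis kres : is_residue_field res.
Hypothesis S_int : forall z, z \in S -> integralOver iota z.
Hypothesis S_closed : forall z, q * z \in S -> integralOver iota z -> z \in S.

Let qS : q \in S. Proof. exact: iota_mem. Qed.

Lemma res0P r : res r = 0 <-> exists y, r = y * p.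
Proof. by by case: kres => _ /(_ r) H; split=> [/H/maxE|/maxE/H]. Qed.

Lemma res_unit r : res r != 0 -> r \is a GRing.unit.
Proof. by case: kres => _ /(_ r) H; apply: contraNT => ru; apply/eqP/H. Qed.

Lemma lift_poly (P : {poly k}) : exists Q : {poly R}, map_poly res Q = P.
Proof.
have /choice[l lE] : forall y, exists x, res x = y by case: kres.
exists (\poly_(i < size P) l P`_i); apply/polyP=> i; rewrite coef_map coef_poly.
by case: ltnP => [_|le]; [exact: lE | rewrite nth_default ?raddf0].
Qed.

Section Residue.
Variable a : L.
Hypothesis aS : a \in S.
Let ev (P : {poly R}) := (map_poly iota P).[a].

Let evD P Q : ev (P + Q) = ev P + ev Q. Proof. by rewrite /ev rmorphD hornerD. Qed.
Let evB P Q : ev (P - Q) = ev P - ev Q. Proof. by rewrite /ev rmorphB hornerD hornerN. Qed.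
Let evM P Q : ev (P * Q) = ev P * ev Q. Proof. by rewrite /ev rmorphM hornerM. Qed.
Let ev1 : ev 1 = 1. Proof. by rewrite /ev rmorph1 hornerC. Qed.
Let evXsubC c m : ev (('X - c%:P) ^+ m) = (a - iota c) ^+ m.
Proof. by rewrite /ev rmorphXn /= map_polyXsubC horner_exp hornerXsubC. Qed.

Let ev_mem P : ev P \in S.
Proof.
rewrite /ev horner_coef rpred_sum // => i _.
by rewrite rpredM ?rpredX // coef_map iota_mem.
Qed.

Let ev_res0 P : map_poly res P = 0 -> ev P / q \in S.
Proof.
move=> P0; rewrite /ev horner_coef mulr_suml rpred_sum // => i _.
have /res0P[y yE] : res P`_i = 0 by rewrite -coef_map P0 coef0.
by rewrite coef_map /= yE rmorphM mulrAC mulfK // rpredM ?rpredX ?iota_mem.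
Qed.

Let ev_res P Q : map_poly res P = map_poly res Q -> (ev P - ev Q) / q \in S.
Proof. by move=> E; rewrite -evB ev_res0 // rmorphB /= E subrr. Qed.

(* If the reduction of P had two distinct roots, a Bezout relation would give  *)
(* an idempotent of S / q S, and one of its two factors would vanish at a.     *)
Lemma residue_of_root P : map_poly res P != 0 -> ev P / q \in S ->
  exists c m, (a - iota c) ^+ m / q \in S.
Proof.
have [m] := ubnP (size (map_poly res P)); elim: m P => // m IHm P szP P0 Pa.
have [/eqP/size_poly1P[c c0 PE]|/closed_rootP[c' Pc']] := eqVneq (size (map_poly res P)) 1%N.
  (* A nonzero constant reduction makes [ev P] congruent modulo q to a unit of R; being divisible by
     q, it would put q^-1 in S. *)
  case: (negP qV_nmem).
  have [c'' cE] : exists r, res r = c by case: kres.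
  have cu : c'' \is a GRing.unit by apply: res_unit; rewrite cE.
  have : (ev P - ev c''%:P) / q \in S by apply: ev_res; rewrite map_polyC /= cE.
  rewrite mulrBl rpredBl // /ev map_polyC hornerC => cS.
  have -> : q^-1 = iota c''^-1 * (iota c'' / q).
    by rewrite mulrA -rmorphM mulVr // rmorph1 mul1r.
  by rewrite span_scale.
have [m' [Q' Q'c PE]] := multiplicity_XsubC (map_poly res P) c'.
rewrite P0 /= in Q'c.
have [c cE] : exists r, res r = c' by case: kres.
have [Q QE] := lift_poly Q'.
have cop : coprimep Q' (('X - c'%:P) ^+ m').
  by rewrite coprimep_expr // coprimep_XsubC.
have [[U' V'] /= UV1] := Bezout_eq1_coprimepP _ _ cop.
have [[U UE] [V VE]] := (lift_poly U', lift_poly V').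
have XE : map_poly res (('X - c%:P) ^+ m') = ('X - c'%:P) ^+ m'.
  by rewrite rmorphXn /= map_polyXsubC cE.
have PQ : (ev P - ev Q * (a - iota c) ^+ m') / q \in S.
  by rewrite -evXsubC -evM; apply: ev_res; rewrite rmorphM /= XE QE.
have QP : (ev Q * (a - iota c) ^+ m') / q \in S by move: PQ; rewrite mulrBl rpredBl.
have UV : (1 - ev U * ev Q - ev V * (a - iota c) ^+ m') / q \in S.
  rewrite -addrA -opprD -evXsubC -!evM -evD -ev1; apply: ev_res.
  by rewrite rmorph1 rmorphD !rmorphM /= XE QE UE VE.
set x := ev U * ev Q in UV *; set b := (_ - _) ^+ _ in PQ QP UV *.
have xS : x \in S by rewrite rpredM.
have bS : b \in S by rewrite rpredX // rpredB // iota_mem.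
(* Modulo q, x = U Q, 1 - x = V b and Q b = 0, so x is idempotent. If x vanishes modulo q, so does Q
   at a, and Q has smaller degree; otherwise 1 - x vanishes, and b with it. *)
have [xq|xq] : x / q \in S \/ (1 - x) / q \in S.
- apply: idempotent_lift => //.
  have -> : (x ^+ 2 - x) / q = - x * ((1 - x - ev V * b) / q) - ev V * ev U * (ev Q * b / q).
    by rewrite /x; field.
  by apply: rpredB; apply: rpredM => //; rewrite ?rpredN ?rpredM ?ev_mem.
- apply: (IHm Q); rewrite ?QE.
  + have Q'0 : Q' != 0 by apply: contraNneq Q'c => ->; rewrite root0.
    move: szP; rewrite PE size_Mmonic ?monic_exp ?monicXsubC // size_exp_XsubC addnS ltnS.
    apply: leq_trans; rewrite -addn1 leq_add2l lt0n.
    by apply: contraTneq Pc' => m'0; rewrite PE m'0 expr0 mulr1.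
  + by apply: contraNneq Q'c => ->; rewrite root0.
  have -> : ev Q / q = ev Q * ((1 - x - ev V * b) / q) + ev Q * (x / q) + ev V * (ev Q * b / q).
    by field.
  by apply: rpredD; [apply: rpredD|]; apply: rpredM => //; apply: ev_mem.
exists c, m'; rewrite -/b.
have -> : b / q = b * ((1 - x) / q) + ev U * (ev Q * b / q) by rewrite /x; field.
by apply: rpredD; apply: rpredM => //; apply: ev_mem.
Qed.

Lemma residue_exists : exists c m, (a - iota c) ^+ m / q \in S.
Proof.
have [P mP] := S_int aS; rewrite /root => /eqP Pa.
apply: (@residue_of_root P); last by rewrite /ev Pa mul0r rpred0.
by apply/monic_neq0/monic_map.
Qed.

End Residue.

(* The elements of the maximal ideal of S. *)
Definition qnil z := z \in S /\ exists m, z ^+ m / q \in S.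

Lemma qnil_q : qnil q.
Proof. by split; last by exists 1%N; rewrite expr1 mulfV ?rpred1. Qed.

Lemma qnilM s z : s \in S -> qnil z -> qnil (s * z).
Proof.
move=> sS [zS [m zm]]; split; first exact: rpredM.
by exists m; rewrite exprMn -mulrA rpredM ?rpredX.
Qed.

Lemma qnilN z : qnil z -> qnil (- z).
Proof. by move=> zn; rewrite -mulN1r; apply: qnilM; rewrite // rpredN1. Qed.

Lemma qnilD y z : qnil y -> qnil z -> qnil (y + z).
Proof.
move=> [yS [m ym]] [zS [m' zm]]; split; first exact: rpredD.
exists (m + m')%N; rewrite exprDn mulr_suml rpred_sum // => i _.
rewrite mulrnAl rpredMn //; have [le|lt] := leqP m' i.
  by rewrite -(subnK le) exprD -!mulrA rpredM ?rpredX // rpredM ?rpredX.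
rewrite mulrAC rpredM ?rpredX //.
have aux (a b c : nat) : (c <= a)%N -> (b + a - c = a - c + b)%N.
  by move=> le; rewrite addnC addnBAC.
rewrite (aux m' m i (ltnW lt)).
by rewrite exprD -mulrA rpredM ?rpredX.
Qed.

Lemma qnil_sum (I : finType) (F : I -> L) :
  (forall i, qnil (F i)) -> qnil (\sum_i F i).
Proof.
move=> Fn; elim/big_ind: _ => // [|x y]; last exact: qnilD.
by rewrite -(mul0r q); apply: qnilM qnil_q; rewrite rpred0.
Qed.

(** S is local. Let c in R be a residue of z. If c reduces to 0, then z is nilpotent modulo q.
    Otherwise c is a unit and, with b = c - z, the geometric sum t satisfies z t = c^m' - b^m',
    which is congruent to the unit c^m' modulo q and thus invertible by [one_sub_unit]. *)
Lemma qnil_or_unit z : z \in S -> qnil z \/ z^-1 \in S.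
Proof.
move=> zS; have [c [m cm]] := residue_exists zS.
have cn : qnil (z - iota c) by split; [rewrite rpredB ?iota_mem | exists m].
have [c0|c0] := eqVneq (res c) 0; [left | right].
  have /res0P[y yE] := c0; rewrite -(subrK (iota c) z); apply: qnilD => //.
  by rewrite yE rmorphM; apply: qnilM qnil_q; apply: iota_mem.
have cu : c \is a GRing.unit := res_unit c0.
have [z0|z0] := eqVneq z 0; first by rewrite z0 invr0 rpred0.
pose b := iota c - z.
have [m' bq] : exists m', b ^+ m' / q \in S.
  by have [_ [m' H]] := qnilN cn; exists m'; rewrite /b -opprB.
pose t := \sum_(i < m') iota c ^+ (m'.-1 - i) * b ^+ i.
have bS : b \in S by rewrite rpredB ?iota_mem.
have tS : t \in S by rewrite rpred_sum // => i _; rewrite rpredM ?rpredX ?iota_mem.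
have ztE : z * t = iota c ^+ m' - b ^+ m' by rewrite subrXX /b opprB addrC subrK.
have vS : (1 - q * (iota (c^-1 ^+ m') * (b ^+ m' / q)))^-1 \in S.
  by apply: one_sub_unit; rewrite rpredM ?iota_mem.
have -> : z^-1 = t * iota (c^-1 ^+ m') / (1 - q * (iota (c^-1 ^+ m') * (b ^+ m' / q))).
  have -> : 1 - q * (iota (c^-1 ^+ m') * (b ^+ m' / q)) = z * t * iota (c^-1 ^+ m').
    have -> : q * (iota (c^-1 ^+ m') * (b ^+ m' / q)) = iota (c^-1 ^+ m') * b ^+ m' by field.
    rewrite ztE mulrBl -rmorphXn -rmorphM -exprMn mulrV // expr1n rmorph1.
    by rewrite [b ^+ _ * _]mulrC.
  have: z * t * iota (c^-1 ^+ m') != 0; last first.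
    by rewrite !mulf_eq0 !negb_or => /andP[/andP[_ t0] c'0]; field; rewrite z0 t0 c'0.
  apply: contra_neq (oner_neq0 L) => E.
  suff qE : 1 = q * (iota (c^-1 ^+ m') * (b ^+ m' / q)).
    by case/negP: qV_nmem; rewrite -[q^-1]mul1r qE mulrAC mulfV // mul1r rpredM ?iota_mem.
  have -> : q * (iota (c^-1 ^+ m') * (b ^+ m' / q)) = iota (c^-1 ^+ m') * b ^+ m' by field.
  apply/eqP; rewrite -subr_eq0 -[X in _ == X]E ztE mulrBl -rmorphXn -rmorphM -exprMn mulrV //.
  by rewrite expr1n rmorph1 [b ^+ _ * _]mulrC.
by rewrite !rpredM ?iota_mem.
Qed.

Lemma qnil_nunit z : qnil z -> z != 0 -> z^-1 \notin S.
Proof.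
move=> [zS [m zm]] z0; apply/negP=> zV; case/negP: qV_nmem.
have -> : q^-1 = z^-1 ^+ m * (z ^+ m / q).
  by rewrite mulrA -exprMn mulVf // expr1n mul1r.
by rewrite rpredM ?rpredX.
Qed.

Lemma qnil_iota r : qnil (iota r) -> exists y, r = y * p.
Proof.
move=> rn; apply/res0P/eqP; apply: contraT => /res_unit ru.
have r0 : iota r != 0.
  by rewrite -(rmorph0 iota) (inj_eq iota_inj); apply: contraTneq ru => ->; rewrite unitr0.
have /negP[] := qnil_nunit rn r0.
have -> : (iota r)^-1 = iota r^-1.
  by apply: (mulfI r0); rewrite mulfV // -rmorphM mulrV // rmorph1.
exact: iota_mem.
Qed.

Lemma residue z : z \in S -> exists c, qnil (z - iota c).
Proof.
move=> zS; have [c [m cm]] := residue_exists zS.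
by exists c; split; [rewrite rpredB ?iota_mem | exists m].
Qed.

(* An element x outside S multiplying the maximal ideal into S cannot map it   *)
(* into itself, as it would then be integral; so x z is a unit for some z in   *)
(* the maximal ideal, which z therefore generates.                             *)
Lemma span_uniformizer : exists P, uniformizer S P /\ forall z, qnil z -> z / P \in S.
Proof.
have /choice[c cn] i : exists c, qnil (w i - iota c) by apply/residue/w_mem.
pose v i := w i - iota (c i).
have vS i : v i \in S by case: (cn i).
(* The [v i] and q generate the maximal ideal as an R-module. *)
have gen z : qnil z -> exists (r : 'I_n -> R) (y : R),
    z = \sum_i iota (r i) * v i + iota y * q.
  move=> zn; have [zS _] := zn; have [r zE] := (S_span z).1 zS; exists r.
  have [|y yE] := @qnil_iota (\sum_i r i * c i).
    have -> : iota (\sum_i r i * c i) = z - \sum_i iota (r i) * v i.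
      rewrite zE -sumrB rmorph_sum; apply: eq_bigr => i _.
      by rewrite /v rmorphM -mulrBr opprB addrC subrK.
    apply: qnilD => //; apply/qnilN/qnil_sum => i.
    by apply: qnilM; [exact: iota_mem | exact: cn].
  exists y; rewrite -rmorphM -yE zE rmorph_sum -big_split /=.
  by apply: eq_bigr => i _; rewrite /v rmorphM -mulrDr subrK.
(* Start from q^-1 and multiply by the highest power of each [v j] in turn that keeps the product
   outside S. *)
have step j : (j <= n)%N -> exists x, [/\ x \notin S, x * q \in S &
    forall i : 'I_n, (i < j)%N -> x * v i \in S].
  elim: j => [_|j IHj ltj].
    by exists q^-1; rewrite qV_nmem mulVf ?rpred1.
  have [x [xS xq xv]] := IHj (ltnW ltj); pose vj := v (Ordinal ltj).
  have vjS : vj \in S := vS _.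
  have ex_m : exists m, x * vj ^+ m \in S.
    have [_ [m vm]] := cn (Ordinal ltj); exists m.
    have -> : x * vj ^+ m = (x * q) * (v (Ordinal ltj) ^+ m / q) by rewrite /vj; field.
    exact: rpredM.
  case: (ex_minnP ex_m) => -[|m] xm m_min; first by rewrite expr0 mulr1 (negPf xS) in xm.
  exists (x * vj ^+ m); split=> [||i]; first by apply/negP=> /m_min; rewrite ltnn.
    by rewrite mulrAC rpredM ?rpredX.
  rewrite ltnS leq_eqVlt => /orP[/eqP ij|lt]; last by rewrite mulrAC rpredM ?rpredX // xv.
  have -> : i = Ordinal ltj by apply: val_inj.
  by rewrite -mulrA -exprSr.
have [x [xS xq xv]] := step n (leqnn n).
have xn z : qnil z -> x * z \in S.
  case/gen=> r [y ->]; rewrite mulrDr mulr_sumr rpredD // ?rpred_sum // => [i _|].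
    by rewrite mulrCA span_scale // xv.
  by rewrite mulrCA span_scale.
have [P [Pn xP]] : exists z, qnil z /\ ~ qnil (x * z).
  apply: contrapT => /forallNP nP.
  have xnil z : qnil z -> qnil (x * z).
    by move=> zn; apply: contrapT => nz; apply: (nP z); split.
  case/negP: xS; apply: S_closed; first by rewrite mulrC.
  (* These finitely many generators span a module stable under x, so x would be integral, hence in S
     by [S_closed]. *)
  pose mu (i : 'I_n.+1) := if unlift ord0 i is Some j then v j else q.
  have mun i : qnil (mu i) by rewrite /mu; case: unlift => [j|]; [exact: cn | exact: qnil_q].
  have genmu z : qnil z -> exists r : 'I_n.+1 -> R, z = \sum_i iota (r i) * mu i.
    case/gen=> r [y ->].
    exists (fun i => if unlift ord0 i is Some j then r j else y).
    rewrite big_ord_recl /mu unlift_none addrC; congr (_ + _).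
    by apply: eq_bigr => i _; rewrite liftK.
  apply: (@integral_stable _ _ _ _ mu x ord0); first by rewrite /mu unlift_none.
  by move=> i; apply: genmu; apply: xnil.
have xPV : (x * P)^-1 \in S.
  by case: (qnil_or_unit (xn _ Pn)).
have P0 : P != 0.
  by apply/eqP=> P0; apply: xP; rewrite P0 mulr0 -(mulr0 0) -P0; apply: qnilM; rewrite // P0 rpred0.
have x0 : x != 0 by apply: contraNneq xS => ->; rewrite rpred0.
have nP z : qnil z -> z / P \in S.
  move=> zn; have -> : z / P = (x * z) * (x * P)^-1 by field; rewrite x0 P0.
  by rewrite rpredM // xn.
exists P; split=> //; have [PS [m Pm]] := Pn; split=> // [|z zS z0].
  exact: qnil_nunit.
(* Some power of P is divisible by q, so divisibility by all powers of P would force z = 0. *)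
have ex_i : exists i, z / P ^+ i \notin S.
  apply: contrapT => /forallNP zP; move/eqP: z0; apply; apply: span_sep => j.
  have -> : z / q ^+ j = (z / P ^+ (m * j)) * (P ^+ m / q) ^+ j.
    by rewrite exprM exprMn exprVn; field; rewrite qn0 !expf_neq0.
  by rewrite rpredM ?rpredX //; apply/negPn/negP.
case: (ex_minnP ex_i) => -[|i] zi i_min; first by rewrite expr0 divr1 zS in zi.
have uS : z / P ^+ i \in S by apply: contraT => /i_min; rewrite ltnn.
exists i, (z / P ^+ i); rewrite mulfVK ?expf_neq0 //; split=> //.
case: (qnil_or_unit uS) => // /nP; rewrite -mulrA -invfM -exprSr.
by rewrite (negPf zi).
Qed.

(** * The powers of a uniformizer as a basis *)

Section Ramification.
Variables (P : L) (e : nat).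
Hypothesis P_unif : uniformizer S P.
Hypothesis P_gen : forall z, qnil z -> z / P \in S.
Hypothesis P_val : has_val S P q e.

Let PS := unif_mem P_unif.
Let P0 := unif_neq0 P_unif.
Let Pn0 i : P ^+ i != 0. Proof. by rewrite expf_neq0. Qed.

(** Expansion in base P: every residue has a representative in R, so the digits can be taken there.
    After e digits the remainder is a multiple of P^e, that is, of q. *)
Lemma pow_decomp z : z \in S -> exists (c : 'I_e -> R) s,
  s \in S /\ z = \sum_i iota (c i) * P ^+ i + q * s.
Proof.
move=> zS.
have [c [s [sS zE]]] : exists (c : 'I_e -> R) s,
    s \in S /\ z = \sum_i iota (c i) * P ^+ i + P ^+ e * s.
  elim: e z zS => [|j IHj] z zS.
    by exists (fun=> 0), z; rewrite big_ord0 add0r expr0 mul1r.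
  have [c [s [sS ->]]] := IHj z zS; have [r /P_gen rE] := residue sS.
  exists (fun i => if unlift ord_max i is Some i' then c i' else r), ((s - iota r) / P).
  split=> //; rewrite big_ord_recr /= unlift_none -addrA; congr (_ + _).
    apply: eq_bigr => i _; have -> : widen_ord (leqnSn j) i = lift ord_max i.
      by apply: val_inj; rewrite /= /bump leqNgt ltn_ord.
    by rewrite liftK.
  by rewrite exprS; field.
exists c, ((P ^+ e / q) * s); split; first by rewrite rpredM //; case/and3P: P_val.
by rewrite zE; congr (_ + _); field.
Qed.

(** Modulo P^(i+1), which divides q, the terms above i vanish, and so do those below by induction.
    If c_i were a unit, P^-1 would lie in S. *)
Lemma pow_dvd (c : 'I_e -> R) :
  (\sum_i iota (c i) * P ^+ i) / q \in S -> forall i, exists y, c i = y * p.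
Proof.
move=> cS; suff H j : forall i : 'I_e, (i < j)%N -> exists y, c i = y * p.
  by move=> i; apply: (H e).
elim: j => // j IHj i; rewrite ltnS leq_eqVlt => /orP[/eqP ij|]; last exact: IHj.
apply/res0P/eqP; apply: contraT => /res_unit ciu.
have ciV : (iota (c i))^-1 \in S.
  have ci0 : iota (c i) != 0.
    by rewrite -(rmorph0 iota) (inj_eq iota_inj); apply: contraTneq ciu => ->; rewrite unitr0.
  rewrite (_ : _^-1 = iota (c i)^-1) ?iota_mem //.
  by apply: (mulfI ci0); rewrite mulfV // -rmorphM mulrV // rmorph1.
have qP : q / P ^+ i.+1 \in S by rewrite (has_val_mem P_unif _ P_val).
have lowS : (\sum_(t < e | (t < i)%N) iota (c t) * P ^+ t) / P ^+ i.+1 \in S.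
  rewrite mulr_suml rpred_sum // => t ti; have [|y ->] := IHj t; first by rewrite -ij.
  have -> : iota (y * p) * P ^+ t / P ^+ i.+1 = iota y * P ^+ t * (q / P ^+ i.+1).
    by rewrite rmorphM; ring.
  by rewrite rpredM // rpredM ?rpredX ?iota_mem.
have highS : (\sum_(t < e | (i < t)%N) iota (c t) * P ^+ t) / P ^+ i.+1 \in S.
  rewrite mulr_suml rpred_sum // => t ti; rewrite -mulrA rpredM ?iota_mem //.
  by rewrite unif_pow_mem.
have allS : (\sum_t iota (c t) * P ^+ t) / P ^+ i.+1 \in S.
  by rewrite -[X in X / P ^+ i.+1](divfK q0) -mulrA rpredM.
have /negP[] : P^-1 \notin S by case: P_unif.
have -> : P^-1 = (iota (c i))^-1 * ((\sum_t iota (c t) * P ^+ t) / P ^+ i.+1 -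
   (\sum_(t < e | (t < i)%N) iota (c t) * P ^+ t) / P ^+ i.+1 -
   (\sum_(t < e | (i < t)%N) iota (c t) * P ^+ t) / P ^+ i.+1).
  have -> : \sum_t iota (c t) * P ^+ t = iota (c i) * P ^+ i +
      \sum_(t < e | (t < i)%N) iota (c t) * P ^+ t +
      \sum_(t < e | (i < t)%N) iota (c t) * P ^+ t.
    rewrite (bigD1 i) //= -addrA; congr (_ + _).
    rewrite (bigID (fun t : 'I_e => (t < i)%N)) /=; congr (_ + _); apply: eq_bigl => t.
      by rewrite -val_eqE /=; case: ltngtP.
    by rewrite -val_eqE /=; case: ltngtP.
  move: (\sum_(t < e | (t < i)%N) _) (\sum_(t < e | (i < t)%N) _) => lo hi.
  rewrite [P ^+ i.+1]exprS; field.
  rewrite P0 Pn0 /=; apply: contraTneq ciu => /eqP.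
  by rewrite -(rmorph0 iota) (inj_eq iota_inj) => /eqP ->; rewrite unitr0.
by rewrite rpredM // !rpredB.
Qed.

Lemma pow_free (c : 'I_e -> R) :
  \sum_i iota (c i) * P ^+ i = 0 -> forall i, c i = 0.
Proof.
move=> c0 i; apply: (param_sep p0 maxE factor) => m.
suff [d [dE _]] : exists d : 'I_e -> R, (forall i, c i = d i * p ^+ m) /\
  \sum_i iota (d i) * P ^+ i = 0 by exists (d i).
elim: m => [|m [d [dE d0]]]; first by exists c; split=> // j; rewrite expr0 mulr1.
have /choice[d' d'E] : forall j, exists y, d j = y * p.
  by apply: pow_dvd; rewrite d0 mul0r rpred0.
exists d'; split=> [j|]; first by rewrite dE d'E exprS mulrA.
apply: (mulfI q0); rewrite mulr0 -[RHS]d0 mulr_sumr; apply: eq_bigr => j _.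
by rewrite d'E rmorphM mulrA [q * _]mulrC.
Qed.

(** Nakayama in matrix form. With W the basis and Z the powers of P as columns, Z = B W and W = C Z
    + q D W, so C B = 1 - p D, whose determinant reduces to 1. Hence B has a left inverse, which is
    two-sided because the powers of P are independent; so B is square. *)
Lemma pow_basis : e = n /\ forall z, z \in S -> exists c : 'I_e -> R, z = \sum_i iota (c i) * P ^+ i.
Proof.
pose W := \col_i w i; pose Z := \col_(i < e) P ^+ i.
have /choice[B BE] (i : 'I_e) : exists c : 'I_n -> R, P ^+ i = \sum_j iota (c j) * w j.
  by apply/S_span; rewrite rpredX.
have /choice[C CE] i := pow_decomp (w_mem i).
have /choice[D DE] i : exists d : 'I_n -> R, w i = \sum_j iota (C i j) * P ^+ j
    + q * \sum_j iota (d j) * w j.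
  have [s [sS ->]] := CE i; have [d ->] := (S_span s).1 sS.
  by exists d.
pose Bm := \matrix_(i, j) B i j; pose Cm := \matrix_(i, j) C i j; pose Dm := \matrix_(i, j) D i j.
have ZE : Z = map_mx iota Bm *m W.
  by apply/colP=> i; rewrite !mxE BE; apply: eq_bigr => j _; rewrite !mxE.
have WE : W = map_mx iota Cm *m Z + q *: (map_mx iota Dm *m W).
  apply/colP=> i; rewrite !mxE DE; congr (_ + _); first by apply: eq_bigr => j _; rewrite !mxE.
  by congr (_ * _); apply: eq_bigr => j _; rewrite !mxE.
have W_free (X : 'M[R]_n) : map_mx iota X *m W = 0 -> X = 0.
  move=> X0; apply/matrixP=> i j; rewrite mxE; move: j; apply: w_free.
  move/colP/(_ i): X0; rewrite !mxE => X0; rewrite -[RHS]X0; apply: eq_bigr => j _.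
  by rewrite !mxE.
have Z_free (X : 'M[R]_e) : map_mx iota X *m Z = 0 -> X = 0.
  move=> X0; apply/matrixP=> i j; rewrite mxE; move: j; apply: pow_free.
  move/colP/(_ i): X0; rewrite !mxE => X0; rewrite -[RHS]X0; apply: eq_bigr => j _.
  by rewrite !mxE.
pose U := 1%:M - p *: Dm.
have UE : U = Cm *m Bm.
  apply/eqP; rewrite -subr_eq0; apply/eqP/W_free.
  rewrite !map_mxB map_mx1 map_mxZ map_mxM !mulmxBl mul1mx -mulmxA -ZE -scalemxAl.
  by rewrite {1}WE addrK subrr.
have Uu : U \in unitmx.
  rewrite unitmxE; apply: res_unit; rewrite -det_map_mx map_mxB map_mx1 map_mxZ.
  have -> : res p = 0 by apply/res0P; exists 1; rewrite mul1r.
  by rewrite scale0r subr0 det1 oner_neq0.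
pose C' := invmx U *m Cm.
have C'B : C' *m Bm = 1%:M by rewrite /C' -mulmxA -UE mulVmx.
have WZ : W = map_mx iota C' *m Z by rewrite ZE mulmxA -map_mxM C'B map_mx1 mul1mx.
have BC' : Bm *m C' = 1%:M.
  apply/eqP; rewrite -subr_eq0; apply/eqP/Z_free.
  by rewrite map_mxB map_mxM map_mx1 mulmxBl mul1mx -mulmxA -WZ -ZE subrr.
split; first by apply/eqP; rewrite eqn_leq (mulmx1_min BC') (mulmx1_min C'B).
move=> z /S_span[c ->]; exists (fun j => ((\row_i c i) *m C') 0 j).
transitivity ((map_mx iota (\row_i c i) *m W) 0 0).
  by rewrite mxE; apply: eq_bigr => i _; rewrite !mxE.
by rewrite WZ mulmxA -map_mxM mxE; apply: eq_bigr => i _; rewrite !mxE.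
Qed.

End Ramification.

Theorem totally_ramified : exists P, [/\ uniformizer S P, has_val S P q n,
  forall z, z \in S <-> exists c : 'I_n -> R, z = \sum_i iota (c i) * P ^+ i &
  forall c : 'I_n -> R, \sum_i iota (c i) * P ^+ i = 0 -> forall i, c i = 0].
Proof.
have [P [P_unif P_gen]] := span_uniformizer.
have [e P_val] := has_val_ex P_unif qS q0.
have [en P_span] := pow_basis P_unif P_gen P_val.
have P_free := pow_free P_unif P_val.
subst e; exists P; split=> // z; split=> [/P_span//|[c ->]].
by rewrite rpred_sum // => i _; rewrite rpredM ?iota_mem // rpredX ?(unif_mem P_unif).
Qed.

End CompleteExtension.


(** * The different exponent *)

Section Different.
Variables (R : idomainType) (p : R).
Hypothesis p0 : p != 0.
Hypothesis maxE : forall x : R, maxideal x <-> exists y, x = y * p.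
Hypothesis factor : forall r : R, r != 0 ->
  exists n u, u \is a GRing.unit /\ r = u * p ^+ n.
Variables (L : fieldType) (iota : {rmorphism R -> L}).
Variables (S : subringClosed L) (P : L) (n' : nat).
Notation n := n'.+1.
Notation q := (iota p).
Hypothesis P_unif : uniformizer S P.
Hypothesis P_val : has_val S P q n.
Hypothesis P_span : forall z, z \in S <-> exists c : 'I_n -> R, z = \sum_i iota (c i) * P ^+ i.
Hypothesis P_free : forall c : 'I_n -> R, \sum_i iota (c i) * P ^+ i = 0 -> forall i, c i = 0.

Let PS := unif_mem P_unif.
Let q0 : q != 0. Proof. by case/and3P: P_val. Qed.

Let iota_mem r : iota r \in S.
Proof. by rewrite -[iota r]mulr1; apply: (span_scale P_span); rewrite rpred1. Qed.

Let pow_mem i : P ^+ i \in S. Proof. by rewrite rpredX. Qed.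

Let coord_ex z : exists c : 'I_n -> R, z \in S -> z = \sum_i iota (c i) * P ^+ i.
Proof.
have [zS|zS] := boolP (z \in S); last by exists (fun=> 0).
by have [c zE] := (P_span z).1 zS; exists c.
Qed.

Let crd z : 'I_n -> R := sval (cid (coord_ex z)).
Let crdE z : z \in S -> z = \sum_i iota (crd z i) * P ^+ i.
Proof. exact: svalP (cid (coord_ex z)). Qed.

Let crd_uniq z (c : 'I_n -> R) : z = \sum_i iota (c i) * P ^+ i -> crd z =1 c.
Proof.
move=> zE; apply: (coord_inj P_free); rewrite -crdE //.
by apply/P_span; exists c.
Qed.

Let crdD y z i : y \in S -> z \in S -> crd (y + z) i = crd y i + crd z i.
Proof.
move=> yS zS; apply: (crd_uniq (c := fun i => crd y i + crd z i)).
rewrite {1}(crdE yS) {1}(crdE zS) -big_split /=; apply: eq_bigr => j _.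
by rewrite rmorphD mulrDl.
Qed.

Let crdZ r z i : z \in S -> crd (iota r * z) i = r * crd z i.
Proof.
move=> zS; apply: (crd_uniq (c := fun i => r * crd z i)).
rewrite {1}(crdE zS) mulr_sumr; apply: eq_bigr => j _.
by rewrite rmorphM mulrA.
Qed.

Let crd_pow (i j : 'I_n) : crd (P ^+ i) j = (i == j)%:R.
Proof.
apply: (crd_uniq (c := fun j => (i == j)%:R)).
rewrite (bigD1 i) //= eqxx rmorph1 mul1r big1 ?addr0 // => k ki.
by rewrite eq_sym (negPf ki) rmorph0 mul0r.
Qed.

Let crd_sum (I : finType) (c : I -> R) (F : I -> L) j : (forall i, F i \in S) ->
  crd (\sum_i iota (c i) * F i) j = \sum_i c i * crd (F i) j.
Proof.
move=> FS; elim: (index_enum I) => [|i s IHs].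
  rewrite !big_nil; apply: (crd_uniq (c := fun=> 0)).
  by rewrite big1 // => i _; rewrite rmorph0 mul0r.
rewrite !big_cons crdD ?IHs ?crdZ ?rpredM // rpred_sum // => k _.
by rewrite rpredM.
Qed.

Let mulm z := \matrix_(i < n, j < n) crd (z * P ^+ i) j.

Let mulmM y z : y \in S -> z \in S -> mulm (y * z) = mulm z *m mulm y.
Proof.
move=> yS zS; apply/matrixP=> i j; rewrite !mxE -mulrA.
have zP : z * P ^+ i \in S by rewrite rpredM.
rewrite {1}(crdE zP) mulr_sumr.
under eq_bigr => k _ do rewrite mulrCA.
rewrite crd_sum => [|k]; last by rewrite rpredM.
by apply: eq_bigr => k _; rewrite !mxE.
Qed.

Let mulm_iota r : mulm (iota r) = r%:M.
Proof.
apply/matrixP=> i j; rewrite !mxE crdZ // crd_pow.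
by case: eqP => _; rewrite ?mulr1 ?mulr0.
Qed.

(** The norm from S to R. *)
Let N z := \det (mulm z).

Let NM y z : y \in S -> z \in S -> N (y * z) = N y * N z.
Proof. by move=> yS zS; rewrite /N mulmM // det_mulmx mulrC. Qed.

Let N_iota r : N (iota r) = r ^+ n.
Proof. by rewrite /N mulm_iota det_scalar. Qed.

Let N1 : N 1 = 1. Proof. by rewrite -(rmorph1 iota) N_iota expr1n. Qed.

Let NX z m : z \in S -> N (z ^+ m) = N z ^+ m.
Proof.
move=> zS; elim: m => [|m IHm]; first by rewrite !expr0 N1.
by rewrite !exprS NM ?rpredX // IHm.
Qed.

Let N_unit z : z != 0 -> z \in S -> z^-1 \in S -> N z \is a GRing.unit.
Proof.
move=> z0 zS zV; apply/unitrPr; exists (N z^-1).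
by rewrite -NM // mulfV // N1.
Qed.

Let N_val z w : has_val S P z w -> exists u, u \is a GRing.unit /\ N z = u * N P ^+ w.
Proof.
case/and3P=> z0 zP zPV; exists (N (z / P ^+ w)).
have Pw0 : P ^+ w != 0 by rewrite expf_neq0 // (unif_neq0 P_unif).
split; last by rewrite -NX // -NM ?divfK.
by apply: N_unit => //; [rewrite mulf_neq0 ?invr_eq0 | rewrite invf_div].
Qed.

(** Up to a unit q is P^n, and its norm is p^n, so the norm of P has order 1. *)
Let NP : exists u, u \is a GRing.unit /\ N P = u * p.
Proof.
have [u [uu uE]] := N_val P_val; rewrite N_iota in uE.
have NP0 : N P != 0.
  apply: contraTneq (expf_neq0 n p0) => NP0.
  by rewrite uE NP0 exprS mul0r mulr0 eqxx.
have [m [v [vu vE]]] := factor NP0; exists v; split=> //.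
suff m1 : m = 1%N by rewrite vE m1 expr1.
move: uE; rewrite vE exprMn -exprM => uE; apply/eqP.
have uE' : 1 * p ^+ n = (u * v ^+ n) * p ^+ (m * n) by rewrite mul1r uE mulrA.
rewrite -(eqn_pmul2r (ltn0Sn n')) mul1n eqn_leq.
rewrite (param_dvd_unit p0 maxE (unitr1 _) uE').
by rewrite (param_dvd_unit p0 maxE _ (esym uE')) // unitrM uu unitrX.
Qed.

(* The coefficient of P ^+ n' generates Hom_R (S, R) over S, so that t is its  *)
(* multiple by some delta; both sides of the equivalence then say that the     *)
(* valuation of delta, which is that of \det (t (P ^+ i * P ^+ j)), is at      *)
(* least n * s.                                                                *)
Lemma different_exponent_succ (t : L -> R) :
    (forall r y z, y \in S -> z \in S -> t (iota r * y + z) = r * t y + t z) ->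
    \det (\matrix_(i < n, j < n) t (P ^+ i * P ^+ j)) != 0 ->
  exists w u, [/\ u \is a GRing.unit,
    \det (\matrix_(i < n, j < n) t (P ^+ i * P ^+ j)) = u * p ^+ w &
    forall s, (forall z, z \in S -> exists y, t z = y * p ^+ s) <-> (n * s <= w)%N].
Proof.
set T := \matrix_(i, j) _ => t_lin dT.
have t0 : t 0 = 0.
  have := t_lin 1 0 0 (rpred0 _) (rpred0 _); rewrite rmorph1 mul1r addr0 mul1r.
  by move=> /(congr1 (fun x => x - t 0)); rewrite addrK subrr.
have t_sum (I : finType) (c : I -> R) (F : I -> L) : (forall i, F i \in S) ->
    t (\sum_i iota (c i) * F i) = \sum_i c i * t (F i).
  move=> FS; elim: (index_enum I) => [|i s IHs]; first by rewrite !big_nil.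
  by rewrite !big_cons t_lin ?IHs // rpred_sum // => k _; rewrite rpredM.
pose lam z := crd z ord_max.
(* With the second index reversed, the Gram matrix of [lam] is triangular with ones on the diagonal,
   so the pairing is perfect. *)
pose M := \matrix_(i < n, k < n) lam (P ^+ i * P ^+ rev_ord k).
have M1 : \det M = 1.
  rewrite det_trig; last first.
    apply/is_trig_mxP => i k ik; rewrite mxE /lam -exprD.
    have lt : (i + rev_ord k < n)%N by rewrite /= subSS; have := ltn_ord k; lia.
    rewrite -[(i + _)%N]/(nat_of_ord (Ordinal lt)) crd_pow -val_eqE /= subSS.
    by case: eqP => //; have := ltn_ord k; lia.
  rewrite big1 // => i _; rewrite mxE /lam -exprD.
  have lt : (i + rev_ord i < n)%N by rewrite /= subSS; have := ltn_ord i; lia.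
  rewrite -[(i + _)%N]/(nat_of_ord (Ordinal lt)) crd_pow -val_eqE /= subSS.
  by case: eqP => //; have := ltn_ord i; lia.
have Mu : M \in unitmx by rewrite unitmxE M1 unitr1.
pose T' := \matrix_(i < n, k < n) t (P ^+ i * P ^+ rev_ord k).
have [b T'T] : exists b : bool, \det T = (-1) ^+ b * \det T'.
  pose r := perm (@rev_ord_inj n).
  have -> : T = col_perm r T'.
    by apply/matrixP=> i k; rewrite !mxE permE rev_ordK.
  exists (r^-1)%g; rewrite col_permE det_mulmx det_perm mulrC.
  by congr (_ * _).
(* The coordinates of the multiplier solve lam (del P^k) = t (P^k) for all k < n. *)
pose del := \sum_i iota ((row 0 T' *m invmx M) 0 i) * P ^+ i.
have delS : del \in S by apply/P_span; eexists.
have del_pow (k : 'I_n) : lam (del * P ^+ rev_ord k) = t (P ^+ rev_ord k).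
  rewrite /del mulr_suml; under eq_bigr => i _ do rewrite -mulrA.
  rewrite /lam crd_sum => [|i]; last by rewrite rpredM.
  transitivity ((row 0 T' *m invmx M *m M) 0 k).
    by rewrite [RHS]mxE; apply: eq_bigr => i _; rewrite [M _ _]mxE.
  by rewrite mulmxKV // !mxE expr0 mul1r.
have tE z : z \in S -> t z = lam (del * z).
  move=> zS; rewrite (crdE zS) t_sum // mulr_sumr.
  under [in RHS]eq_bigr => i _ do rewrite mulrCA.
  rewrite /lam crd_sum => [|i]; last by rewrite rpredM.
  by apply: eq_bigr => i _; rewrite -[i]rev_ordK -del_pow.
have T'E : T' = mulm del *m M.
  apply/matrixP=> i k; rewrite !mxE tE ?rpredM // mulrA.
  have dP : del * P ^+ i \in S by rewrite rpredM.
  rewrite {1}(crdE dP) mulr_suml; under eq_bigr => j _ do rewrite -mulrA.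
  rewrite /lam crd_sum => [|j]; last by rewrite rpredM.
  by apply: eq_bigr => j _; rewrite !mxE.
have dT'E : \det T' = N del by rewrite T'E det_mulmx M1 mulr1.
have del0 : del != 0.
  apply: contraNneq dT => d0; rewrite T'T dT'E d0 -(rmorph0 iota) N_iota.
  by rewrite exprS mul0r mulr0.
have [w dw] := has_val_ex P_unif delS del0.
have [u [uu uE]] := N_val dw; have [v [vu vE]] := NP.
exists w, ((-1) ^+ b * (u * v ^+ w)); split.
- by rewrite !unitrM uu (unitrX _ (unitrN1 _)) (unitrX _ vu).
- by rewrite T'T dT'E uE vE exprMn !mulrA.
move=> s.
have qs : has_val S P (q ^+ s) (n * s) by apply: has_valX.
have qs0 : q ^+ s != 0 by rewrite expf_neq0.
have delE : (del / q ^+ s \in S) = (n * s <= w)%N.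
  rewrite -(has_val_mem P_unif _ dw); case/and3P: qs => _ q1 q2.
  have Pn0 : P ^+ (n * s) != 0 by rewrite expf_neq0 // (unif_neq0 P_unif).
  apply/idP/idP => H.
    have -> : del / P ^+ (n * s) = (del / q ^+ s) * (q ^+ s / P ^+ (n * s)).
      by field; rewrite Pn0 qs0.
    exact: rpredM.
  have -> : del / q ^+ s = (del / P ^+ (n * s)) * (P ^+ (n * s) / q ^+ s).
    by field; rewrite Pn0 qs0.
  exact: rpredM.
rewrite -delE; split=> [ts|dS z zS].
  have /choice[y yE] (k : 'I_n) : exists y, t (P ^+ rev_ord k) = y * p ^+ s by apply: ts.
  have rE : row 0 T' = p ^+ s *: \row_k y k.
    by apply/rowP=> k; rewrite !mxE expr0 mul1r yE mulrC.
  rewrite /del rE mulr_suml rpred_sum // => i _.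
  by rewrite -scalemxAl mxE rmorphM rmorphXn -!mulrA mulrC mulrA divfK ?rpredM.
exists (lam (del / q ^+ s * z)); rewrite tE // [RHS]mulrC /lam -crdZ; last exact: rpredM.
by congr crd; rewrite rmorphXn; field.
Qed.

End Different.


Theorem different_exponent (R : idomainType) (p : R) (p0 : p != 0)
    (maxE : forall x : R, maxideal x <-> exists y, x = y * p)
    (factor : forall r : R, r != 0 -> exists n u, u \is a GRing.unit /\ r = u * p ^+ n)
    (L : fieldType) (iota : {rmorphism R -> L})
    (S : subringClosed L) (P : L) (n : nat) (n_gt0 : (0 < n)%N)
    (P_unif : uniformizer S P) (P_val : has_val S P (iota p) n)
    (P_span : forall z, z \in S <-> exists c : 'I_n -> R, z = \sum_i iota (c i) * P ^+ i)
    (P_free : forall c : 'I_n -> R, \sum_i iota (c i) * P ^+ i = 0 -> forall i, c i = 0)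
    (t : L -> R)
    (t_lin : forall r y z, y \in S -> z \in S -> t (iota r * y + z) = r * t y + t z)
    (T0 : \det (\matrix_(i < n, j < n) t (P ^+ i * P ^+ j)) != 0) :
  exists w u, [/\ u \is a GRing.unit,
    \det (\matrix_(i < n, j < n) t (P ^+ i * P ^+ j)) = u * p ^+ w &
    forall s, (forall z, z \in S -> exists y, t z = y * p ^+ s) <-> (n * s <= w)%N].
Proof.
case: n n_gt0 P_val P_span P_free T0 => // n _ P_val P_span P_free T0.
exact: (different_exponent_succ p0 maxE factor P_unif P_val P_span P_free t_lin T0).
Qed.


(** * The function field of a component *)

Lemma nilpotent_sum (A : nzRingType) (I : Type) (s : seq I) (F : I -> A) :
    (forall x y : A, GRing.comm x y) -> (forall i, exists m, F i ^+ m = 0) ->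
  exists m, (\sum_(i <- s) F i) ^+ m = 0.
Proof.
move=> comm Fnil; elim: s => [|i s [m sm]]; first by exists 1%N; rewrite big_nil expr1.
have [m' im] := Fnil i; exists (m' + m)%N; rewrite big_cons exprDn_comm // big1 // => j _.
have [le|lt] := leqP m j.
  by rewrite -[X in _ * _ ^+ X](subnK le) exprD sm !mulr0 mul0rn.
have aux (a b c : nat) : (c <= a)%N -> (b + a - c = a - c + b)%N.
  by move=> ?; rewrite addnC addnBAC.
by rewrite (aux m m' j (ltnW lt)) exprD im mulr0 mul0r mul0rn.
Qed.

Section ComponentType.
Variables (R : idomainType) (gT : finGroupType) (E : gcover R gT) (e : E).

Definition comp_pred : {pred E} := [pred a | e * a == a].
Fact comp_pred_zmod_closed : zmod_closed comp_pred.
Proof.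
by split=> [|x y /eqP ex /eqP ey]; rewrite inE ?mulr0 // mulrBr ex ey.
Qed.
HB.instance Definition _ := GRing.isZmodClosed.Build _ comp_pred comp_pred_zmod_closed.

Record comp_elt := CompElt {comp_val : E; _ : comp_val \in comp_pred}.
HB.instance Definition _ := [isSub for comp_val].
HB.instance Definition _ := [Choice of comp_elt by <:].
HB.instance Definition _ := [SubChoice_isSubZmodule of comp_elt by <:].

End ComponentType.

Section ComponentAlgebra.
Variables (R : idomainType) (gT : finGroupType) (E : gcover R gT) (e : E).
Hypothesis e_comp : is_component e.

Let mulC : commutative (@GRing.mul E) := @gcover_mulC _ _ E.
Let ee : e * e = e. Proof. by case: e_comp. Qed.
Let e0 : e != 0. Proof. by case: e_comp. Qed.

Notation H := (comp_stab e).
Notation act := (gcact E).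

Let EC : comNzRingType := HB.pack (gcover_alg E) (GRing.PzRing_hasCommutativeMul.Build E mulC).
Let mulACA : interchange (@GRing.mul E) (@GRing.mul E) := @mulrACA EC.
Let mulAC : right_commutative (@GRing.mul E) := @mulrAC EC.
Let mulCA : left_commutative (@GRing.mul E) := @mulrCA EC.

(** Idempotents are roots of X (X - 1), so e is primitive among all idempotents of E. *)
Lemma idem_integral (f : E) : f * f = f -> ring_of_cover f.
Proof.
move=> ff; exists (('X - 1) * 'X); first by rewrite monicMr ?monicX // -[1]/(1%:P) monicXsubC.
rewrite rmorphM rmorphB rmorph1 /= map_polyX /root -[1]/(1%:P).
by rewrite hornerMX hornerD hornerX hornerN hornerC mulrDl ff mulN1r subrr.
Qed.

Lemma idem_comp f : f * f = f -> e * f = f -> f = 0 \/ f = e.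
Proof. by move=> ff ef; case: e_comp => _ _ _; apply => //; apply: idem_integral. Qed.

Lemma comp_stabP g : reflect (act g e = e) (g \in H).
Proof. by rewrite inE; apply: eqP. Qed.

Lemma comp_stab_group : group_set H.
Proof.
apply/group_setP; split; first by apply/comp_stabP; rewrite gcact1.
move=> g h /comp_stabP ge /comp_stabP he; apply/comp_stabP.
by rewrite gcactM ge he.
Qed.

Lemma gcactK g a : act g^-1%g (act g a) = a.
Proof. by rewrite -gcactM mulgV gcact1. Qed.

(** The product is an idempotent below e, hence 0 or e. If it is e, then applying g^-1 puts the
    translate of e by g^-1 below e, so the two are equal by primitivity and g stabilizes e. *)
Lemma comp_orth g : g \notin H -> e * act g e = 0.
Proof.
move=> gH; have [|//|//|eg] := @idem_comp (e * act g e).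
- by rewrite mulACA ee -rmorphM ee.
- by rewrite mulrA ee.
case/negP: gH; apply/comp_stabP.
have eV : e * act g^-1%g e = act g^-1%g e.
  by rewrite -{1}(gcactK g e) -rmorphM [act g e * e]mulC eg.
have [||V0|VE] := @idem_comp (act g^-1%g e) => //; first by rewrite -rmorphM ee.
  by case/eqP: e0; rewrite -[e](gcactK g^-1%g) V0 rmorph0.
by rewrite -[in LHS]VE -gcactM mulVg gcact1.
Qed.

(* Artin's independence of characters, read off the torsor condition. *)
Lemma comp_indep (c : gT -> E) :
    (forall a, \sum_(h in H) c h * (e * act h a) = 0) ->
  forall h, h \in H -> c h * e = 0.
Proof.
move=> cH h hH; have [inv _ invK] := gcover_torsor E.
(* Surjectivity of the torsor map gives coefficients whose combination of the basis translates
   isolates h. *)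
pose t : {ffun gT -> E} := [ffun g => (g == h)%:R].
have tE g : \sum_i inv t i * act g (vbasis {:E})`_i = (g == h)%:R.
  by have := congr1 (fun f : {ffun gT -> E} => f g) (invK t); rewrite !ffunE.
have -> : c h * e = \sum_(g in H) c g * (e * (g == h)%:R).
  rewrite (bigD1 h) //= eqxx mulr1 big1 ?addr0 // => g /andP[_ /negPf ->].
  by rewrite !mulr0.
transitivity (\sum_i inv t i * \sum_(g in H) c g * (e * act g (vbasis {:E})`_i)); last first.
  by rewrite big1 // => i _; rewrite cH mulr0.
under [RHS]eq_bigr => i _ do rewrite mulr_sumr.
rewrite exchange_big /=; apply: eq_bigr => g _.
rewrite -tE !mulr_sumr; apply: eq_bigr => i _.
by rewrite [e * _]mulCA mulCA.
Qed.

(** The tensors a (x) e and e (x) a have the same image under the torsor map: they agree on H by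
    invariance, and both vanish off H by [comp_orth]. By injectivity they are equal, and a
    coordinate at which e is nonzero exhibits a as a multiple of e. *)
Lemma comp_fixed a : e * a = a -> (forall h, h \in H -> act h a = a) ->
  exists c : {fraction R}, a = c *: e.
Proof.
move=> ea aH; have inj := bij_inj (gcover_torsor E).
pose u := coord (vbasis {:E}) ^~ e; pose c := coord (vbasis {:E}) ^~ a.
have eE := coord_vbasis (memvf e); have aE := coord_vbasis (memvf a).
have : [ffun i => u i *: a] = [ffun i => c i *: e].
  apply: inj; apply/ffunP=> g; rewrite !ffunE.
  transitivity (a * act g e).
    rewrite [in RHS]eE linear_sum mulr_sumr; apply: eq_bigr => i _.
    by rewrite ffunE linearZ /= -scalerAl -scalerAr.
  transitivity (e * act g a); last first.
    rewrite [in LHS]aE linear_sum mulr_sumr; apply: eq_bigr => i _.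
    by rewrite ffunE linearZ /= -scalerAl -scalerAr.
  have [gH|gH] := boolP (g \in H); first by rewrite aH // (comp_stabP _ gH) mulC.
  by rewrite -ea rmorphM mulrA comp_orth // mul0r mulAC comp_orth // mul0r.
move=> /ffunP uc; have [i ui] : exists i, u i != 0.
  apply: contrapT => /forallNP nu; case/eqP: e0; rewrite eE big1 // => i _.
  by have /negP/negPn/eqP := nu i; rewrite /u => ->; rewrite scale0r.
have := uc i; rewrite !ffunE => ucE; exists ((u i)^-1 * c i).
by rewrite -scalerA -ucE scalerA mulVf ?scale1r.
Qed.

Lemma comp_sum_fixed a : e * a = a ->
  exists c : {fraction R}, \sum_(h in H) act h a = c *: e.
Proof.
move=> ea; apply: comp_fixed.
  rewrite mulr_sumr; apply: eq_bigr => h /comp_stabP he.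
  by rewrite -{1}he -rmorphM ea.
move=> h hH; rewrite linear_sum /=.
have hG := hH; pose G := Group comp_stab_group.
rewrite [RHS](reindex_inj (mulIg h)) /=; apply: eq_big => [g|g _]; last by rewrite gcactM.
by rewrite -[H]/(gval G) groupMr.
Qed.

(** The trace of any multiple of a is nilpotent and a scalar times e, so it vanishes; independence
    of the characters then kills a. *)
Lemma comp_square0 a : e * a = a -> a * a = 0 -> a = 0.
Proof.
move=> ea aa.
have sum0 y : \sum_(h in H) act h (a * y) = 0.
  have [c cE] : exists c : {fraction R}, \sum_(h in H) act h (a * y) = c *: e.
    by apply: comp_sum_fixed; rewrite mulrA ea.
  rewrite cE; have [m] : exists m, (\sum_(h in H) act h (a * y)) ^+ m = 0.
    rewrite -big_enum /=; apply: nilpotent_sum => [x z|h]; first exact: mulC.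
    by exists 2; rewrite -rmorphXn expr2 mulACA aa mul0r rmorph0.
  rewrite cE => cm; have [->|c0] := eqVneq c 0; first by rewrite scale0r.
  have : (c *: e) ^+ m.+1 = 0 by rewrite exprS cm mulr0.
  rewrite exprZn; have -> : e ^+ m.+1 = e.
    by elim: (m) => [|j IHj]; rewrite ?expr1 // exprS IHj ee.
  by move/eqP; rewrite scaler_eq0 (negPf e0) orbF expf_eq0 (negPf c0).
have H1 : 1%g \in H by apply/comp_stabP; rewrite gcact1.
rewrite -ea mulC -[a]gcact1.
apply: (@comp_indep (fun h => act h a) _ 1%g H1) => y; rewrite -[RHS](sum0 y).
apply: eq_bigr => h /comp_stabP he.
have haE : act h a * e = act h a by rewrite -{1}he -rmorphM mulC ea.
by rewrite mulrA haE rmorphM.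
Qed.

Lemma comp_reduced a m : e * a = a -> a ^+ m.+1 = 0 -> a = 0.
Proof.
move=> ea; have eX j : e * a ^+ j.+1 = a ^+ j.+1 by rewrite exprS mulrA ea.
elim: m => [|m IHm] am; first by rewrite -[a]expr1.
apply: IHm; apply: comp_square0 => //.
by rewrite -exprD addSn -addnS exprD am mulr0.
Qed.

(* Fitting's lemma: a suitable power of a generates an ideal spanned by an     *)
(* idempotent.                                                                 *)
Lemma comp_inverse a : e * a = a -> a != 0 -> exists2 b, e * b = b & a * b = e.
Proof.
move=> ea a0; pose V i := (amull (a ^+ i) @: {:E})%VS.
have memV i y : (y \in V i) <-> exists z, y = a ^+ i * z.
  split=> [/memv_imgP[z _ ->]|[z ->]]; first by exists z; rewrite lfunE.
  by apply/memv_imgP; exists z; rewrite ?memvf // lfunE.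
have Vsub i j : (V (i + j)%N <= V i)%VS.
  apply/subvP=> y /memV[z ->]; apply/memV; exists (a ^+ j * z).
  by rewrite mulrA -exprD.
have ex_d : exists d, `[< exists i, \dim (V i) = d >] by exists (\dim (V 0%N)); apply/asboolP; exists 0%N.
case: (ex_minnP ex_d) => d /asboolP[i dE] d_min.
have V_eq j : V (i + j)%N = V i.
  apply/eqP; rewrite eqEdim Vsub dE d_min //; apply/asboolP; eexists; reflexivity.
have [y yE] : exists y, a ^+ i.+1 = a ^+ (i.+1 + i.+1) * y.
  have /memV[y yE] : a ^+ i.+1 \in V (i.+1 + i.+1)%N.
    rewrite addSn -addnS V_eq -(V_eq 1%N) addn1; apply/memV; exists 1.
    by rewrite mulr1.
  by exists y.
pose f := a ^+ i.+1 * y.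
have ff : f * f = f.
  by rewrite /f mulACA -exprD mulrA -yE.
have ef : e * f = f by rewrite /f exprS !mulrA ea.
have [f0|fe] := idem_comp ff ef.
  case/eqP: a0; apply: (@comp_reduced _ i) => //.
  by rewrite yE exprD -mulrA -/f f0 mulr0.
exists (e * (a ^+ i * y)); first by rewrite mulrA ee.
by rewrite mulCA [a * _]mulrA -exprS -/f ef.
Qed.


Theorem component_field : exists (L : fieldType) (iota : {rmorphism {fraction R} -> L})
    (rho : {rmorphism E -> L}) (sec : L -> E),
  [/\ forall z, rho (sec z) = z, forall a, sec (rho a) = e * a &
      forall c a, rho (c *: a) = iota c * rho a].
Proof.
have cinj : injective (@comp_val _ _ E e) := val_inj.
have cD x y : comp_val (x + y : comp_elt e) = comp_val x + comp_val y by [].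
have idP (x : comp_elt e) : e * comp_val x = comp_val x by case: x => x /= /eqP.
have mkP a : e * a \in comp_pred e by rewrite inE mulrA ee.
pose mk a : comp_elt e := CompElt (mkP a).
pose mu (x y : comp_elt e) : comp_elt e := mk (comp_val x * comp_val y).
have muE x y : comp_val (mu x y) = comp_val x * comp_val y.
  by rewrite /= mulrA idP.
have muA : associative mu by move=> x y z; apply: cinj; rewrite !muE mulrA.
have muC : commutative mu by move=> x y; apply: cinj; rewrite !muE mulC.
have mu1 : left_id (mk 1) mu.
  by move=> x; apply: cinj; rewrite muE /= mulr1 idP.
have muD : left_distributive mu +%R.
  by move=> x y z; apply: cinj; rewrite [LHS]muE !cD mulrDl !muE.
have mu10 : mk 1 != 0.
  by apply: contra_neq e0 => /(congr1 (@comp_val _ _ _ _)) /=; rewrite mulr1.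
pose ring_mix := GRing.Zmodule_isComNzRing.Build (comp_elt e) muA muC mu1 muD mu10.
pose A : comNzRingType := HB.pack (comp_elt e) ring_mix.
have /choice[inv invP] (x : A) : exists y : A, (x != 0 -> mu y x = mk 1) /\ (x = 0 -> y = 0).
  have [->|x0] := eqVneq x 0; first by exists 0; split.
  have [|b eb xb] := comp_inverse (idP x).
    by apply: contra_neq x0 => x0; apply: cinj.
  have bP : b \in comp_pred e by rewrite inE eb.
  exists (CompElt bP); split=> [_|x0']; last by rewrite x0' eqxx in x0.
  by apply: cinj; rewrite muE /= mulC xb mulr1.
pose field_mix := GRing.ComNzRing_isField.Build A (fun x => (invP x).1) ((invP 0).2 erefl).
pose L : fieldType := HB.pack (comp_elt e) ring_mix field_mix.
have mk_zmod : zmod_morphism (mk : E -> L).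
  by move=> a b; apply: cinj; rewrite [LHS]mulrBr.
have mk_monoid : monoid_morphism (mk : E -> L).
  by split=> // a b; apply: cinj; rewrite muE /= mulACA ee.
pose rho : {rmorphism E -> L} := HB.pack (mk : E -> L)
  (GRing.isZmodMorphism.Build _ _ _ mk_zmod) (GRing.isMonoidMorphism.Build _ _ _ mk_monoid).
exists L, (rho \o in_alg E), rho, (fun x : L => comp_val x); split=> [z|a|c a] //.
  by apply: cinj; rewrite /= idP.
by rewrite -[c *: a]mulr_algl; apply: (rmorphM rho).
Qed.

End ComponentAlgebra.


(** * Discriminants of etale algebras *)

Lemma row_free_square (F : fieldType) m n (B : 'M[F]_(m, n)) :
  row_free B -> row_free B^T -> m = n.
Proof.
move=> /eqP rB /eqP rBT; apply/eqP; rewrite eqn_leq -{1}rB rank_leq_col.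
by rewrite -{1}rBT rank_leq_col.
Qed.

Lemma mxtrace_conj (F : fieldType) m n (B : 'M[F]_(m, n)) (M : 'M_m) (D : 'M_n) :
  row_free B -> row_free B^T -> B *m D = M *m B -> \tr M = \tr D.
Proof.
move=> rB rBT; have E := row_free_square rB rBT; subst n => BD.
have Bu : B \in unitmx by rewrite -row_free_unit.
by rewrite -[M](mulmxK Bu) -BD mxtrace_mulC mulmxA mulVmx // mul1mx.
Qed.

Section EtaleAlgebra.
Variables (R : idomainType).
Notation K := {fraction R}.
Variables (L : fieldType) (iota : {rmorphism K -> L}).
Variables (gT : finGroupType) (H : {set gT}) (act : gT -> {rmorphism L -> L}).

Record galois_action : Prop := GaloisAction {
  ga_one : 1%g \in H;
  ga_act1 : forall z, act 1%g z = z;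
  ga_indep : forall c : gT -> L,
    (forall z, \sum_(h in H) c h * act h z = 0) -> forall h, h \in H -> c h = 0;
  ga_trace : forall z, exists c, \sum_(h in H) act h z = iota c }.

Variables (V : vectType K) (mul : V -> V -> V) (U : {vspace V}).
Variables (n : nat) (tau : 'I_n -> V -> L).

(* The tau i are all the K-algebra morphisms from U to L. *)
Record all_embeddings : Prop := AllEmbeddings {
  emb_mem : forall u v, u \in U -> v \in U -> mul u v \in U;
  emb_lin : forall i c u v, u \in U -> v \in U ->
    tau i (c *: u + v) = iota c * tau i u + tau i v;
  emb_mul : forall i u v, u \in U -> v \in U -> tau i (mul u v) = tau i u * tau i v;
  emb_act : forall h i, h \in H -> exists j,
    forall u, u \in U -> act h (tau j u) = tau i u;
  emb_inj : forall u, u \in U -> (forall i, tau i u = 0) -> u = 0;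
  emb_indep : forall c : 'I_n -> L,
    (forall u, u \in U -> \sum_i c i * tau i u = 0) -> forall i, c i = 0 }.

Hypotheses (Gal : galois_action) (Emb : all_embeddings).
Let H1 := ga_one Gal.
Let act1 := ga_act1 Gal.
Let act_indep := ga_indep Gal.
Let act_trace := ga_trace Gal.
Let mulU := emb_mem Emb.
Let tau_lin := emb_lin Emb.
Let tau_mul := emb_mul Emb.
Let tau_act := emb_act Emb.
Let tau_inj := emb_inj Emb.
Let tau_indep := emb_indep Emb.

Lemma tau0 i : tau i 0 = 0.
Proof.
have := tau_lin i 1 (mem0v U) (mem0v U); rewrite scaler0 addr0 rmorph1 mul1r.
by move=> /(congr1 (fun x => x - tau i 0)); rewrite addrK subrr.
Qed.

Lemma tau_sum i (J : finType) (c : J -> K) (b : J -> V) : (forall j, b j \in U) ->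
  tau i (\sum_j c j *: b j) = \sum_j iota (c j) * tau i (b j).
Proof.
move=> bU; elim: (index_enum J) => [|j s IHs]; first by rewrite !big_nil tau0.
by rewrite !big_cons tau_lin ?IHs // memv_suml // => k _; apply: memvZ.
Qed.

Lemma tauZ i c u : u \in U -> tau i (c *: u) = iota c * tau i u.
Proof. by move=> uU; rewrite -[c *: u]addr0 tau_lin ?mem0v // tau0 addr0. Qed.

Definition tau_mx m (b : m.-tuple V) := \matrix_(i < m, j < n) tau j b`_i.

Lemma basis_nth_mem m (b : m.-tuple V) (i : 'I_m) : basis_of U b -> b`_i \in U.
Proof. by move=> bU; rewrite (basis_mem bU) // mem_nth ?size_tuple. Qed.

(* Galois descent: a relation with coefficients in L yields, by taking traces, *)
(* relations with coefficients in K.                                           *)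
Lemma tau_mx_free m (b : m.-tuple V) : basis_of U b -> row_free (tau_mx b).
Proof.
move=> bU; have bmem i := basis_nth_mem i bU.
apply: inj_row_free => a aB; apply/rowP=> k; rewrite [RHS]mxE.
have aE j : \sum_i a 0 i * tau j b`_i = 0.
  by move/rowP/(_ j): aB; rewrite !mxE => aB; rewrite -[RHS]aB; apply: eq_bigr => i _; rewrite mxE.
rewrite -[LHS]act1; apply: (act_indep (c := fun h => act h (a 0 k)) _ H1) => z.
have /choice[t tE] i := act_trace (z * a 0 i).
have uE : \sum_(i < m) t i *: b`_i = 0.
  apply: tau_inj => [|j]; first by rewrite memv_suml // => i _; apply: memvZ.
  rewrite tau_sum //; under eq_bigr => i _ do rewrite -tE mulr_suml.
  rewrite exchange_big big1 //= => h hH; have [j' j'E] := tau_act j hH.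
  transitivity (act h (z * \sum_i a 0 i * tau j' b`_i)); last by rewrite aE mulr0 rmorph0.
  rewrite mulr_sumr rmorph_sum; apply: eq_bigr => i _.
  by rewrite [in RHS]mulrA [RHS]rmorphM j'E.
have t0 : t k = 0.
  by move/freeP: (basis_free bU) => /(_ t uE).
have := tE k; rewrite t0 rmorph0 => t0'; rewrite -[RHS]t0'; apply: eq_bigr => h _.
by rewrite rmorphM mulrC.
Qed.

Lemma tau_mx_tr_free m (b : m.-tuple V) : basis_of U b -> row_free (tau_mx b)^T.
Proof.
move=> bU; apply: inj_row_free => c cB; apply/rowP=> k; rewrite mxE; move: k.
apply: tau_indep => u uU; rewrite (coord_basis bU uU).
have bmem i := basis_nth_mem i bU.
under eq_bigr => j _ do rewrite tau_sum // mulr_sumr.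
rewrite exchange_big big1 //= => i _.
under eq_bigr => j _ do rewrite mulrCA.
rewrite -mulr_sumr; move/rowP/(_ i): cB; rewrite mxE [in RHS]mxE => cB.
rewrite (_ : \sum_j _ = 0) ?mulr0 // -[RHS]cB.
by apply: eq_bigr => j _; rewrite !mxE.
Qed.

Lemma etale_dim : \dim U = n.
Proof.
have bU := vbasisP U.
exact: row_free_square (tau_mx_free bU) (tau_mx_tr_free bU).
Qed.

(** The matrix of embeddings diagonalizes multiplication by u, with eigenvalues the [tau j u]. *)
Lemma iota_alg_trace u : u \in U -> iota (alg_trace mul U u) = \sum_j tau j u.
Proof.
move=> uU; have bU := vbasisP U; set b := vbasis U in bU *.
pose M := \matrix_(i < \dim U, k < \dim U) iota (coord b k (mul u b`_i)).
pose D := diag_mx (\row_j tau j u).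
have BD : tau_mx b *m D = M *m tau_mx b.
  rewrite mul_mx_diag; apply/matrixP=> i j; rewrite !mxE.
  have biU : b`_i \in U by exact: basis_nth_mem.
  rewrite mulrC -tau_mul // [mul u _](coord_basis bU (mulU uU biU)).
  rewrite tau_sum => [|k]; last exact: basis_nth_mem.
  by apply: eq_bigr => k _; rewrite !mxE.
have := mxtrace_conj (tau_mx_free bU) (tau_mx_tr_free bU) BD.
rewrite mxtrace_diag /mxtrace /alg_trace rmorph_sum /=.
under [X in X = _ -> _]eq_bigr => i _ do rewrite mxE.
by under [X in _ = X -> _]eq_bigr => i _ do rewrite mxE.
Qed.

Lemma iota_basis_disc (b : (\dim U).-tuple V) : (forall i, tnth b i \in U) ->
  iota (basis_disc mul b) = \det (tau_mx b *m (tau_mx b)^T).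
Proof.
move=> bmem; rewrite /basis_disc -det_map_mx; congr (\det _); apply/matrixP=> i j.
have bU (k : 'I_(\dim U)) : b`_k \in U by rewrite -tnth_nth.
rewrite !mxE iota_alg_trace ?mulU //; apply: eq_bigr => k _.
by rewrite tau_mul // !mxE.
Qed.

(** * Integral bases and the discriminant ideal *)

Section Lattice.
Variable O : subringClosed L.
Hypothesis O_frac : forall c : K, (iota c \in O) = (c \in @int_frac R).
Variable p : R.
Hypothesis p_unif : uniformizer (@int_frac R) p%:F.
Hypothesis O_span : forall z, exists m, iota p%:F ^+ m * z \in O.

Definition lattice : set V := [set u | u \in U /\ forall j, tau j u \in O]%classic.

Let pF0 : p%:F != 0 :> K. Proof. exact: unif_neq0 p_unif. Qed.

Let lin_mem m (b : 'I_m -> V) (c : 'I_m -> K) : (forall i, c i \in @int_frac R) ->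
  (forall i, lattice (b i)) -> lattice (\sum_i c i *: b i).
Proof.
move=> cR bO; split; first by rewrite memv_suml // => i _; apply/memvZ; case: (bO i).
move=> j; rewrite tau_sum => [|i]; last by case: (bO i).
by rewrite rpred_sum // => i _; rewrite rpredM ?O_frac //; case: (bO i).
Qed.

Lemma lattice_span_ex (s : seq V) : {subset s <= U} ->
  exists m, forall u, u \in s -> lattice (p%:F ^+ m *: u).
Proof.
elim: s => [_|u s IHs sU]; first by exists 0%N.
have [|m ms] := IHs; first by move=> x xs; apply: sU; rewrite inE xs orbT.
have uU : u \in U by apply: sU; rewrite mem_head.
have /choice[k kE] j := O_span (tau j u).
exists (m + \sum_j k j)%N => v; rewrite inE => /orP[/eqP->|vs].
  split=> [|j]; first exact: memvZ.
  rewrite tauZ // rmorphXn (bigD1 j) //= addnCA addnC exprD -mulrA rpredM //.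
  by rewrite rpredX // O_frac; case: p_unif.
have [vU vO] := ms v vs; split=> [|j]; first by rewrite memvZ // sU // inE vs orbT.
rewrite addnC exprD -scalerA tauZ // rpredM // O_frac rpredX //.
by case: p_unif.
Qed.

(** Take a K-basis b1 of integral vectors, with trace matrix T. An integral u has integral traces
    against b1, so its coordinates lie in (det T)^-1 R. The lattice is thus caught between the span
    of b1 and p^-k times it, and Hermite reduction applies. *)
Theorem lattice_basis : exists b : (\dim U).-tuple V, basis_of U b /\
  forall u, lattice u <-> exists c : 'I_(\dim U) -> R, u = \sum_i (c i)%:F *: b`_i.
Proof.
have [m mE] := lattice_span_ex (fun u => @vbasis_mem _ _ u U).
set N := \dim U in mE *.
have b0U := vbasisP U; set b0 := vbasis U in mE b0U.
have pm0 : p%:F ^+ m != 0 :> K by rewrite expf_neq0.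
have b0mem (i : 'I_N) : b0`_i \in U by exact: basis_nth_mem.
pose b1 (i : 'I_N) := p%:F ^+ m *: b0`_i.
have b1O i : lattice (b1 i) by apply: mE; rewrite mem_nth ?size_tuple.
have b1U i : b1 i \in U by case: (b1O i).
have b1_coord u : u \in U -> exists x : 'rV[K]_N, u = \sum_i x 0 i *: b1 i.
  move=> uU; exists (\row_i (coord b0 i u / p%:F ^+ m)).
  rewrite {1}(coord_basis b0U uU); apply: eq_bigr => i _.
  by rewrite mxE /b1 scalerA divfK.
have b1_free (x : 'rV[K]_N) : \sum_i x 0 i *: b1 i = 0 -> x = 0.
  move=> x0; apply/rowP=> i; rewrite mxE; apply: (mulIf pm0); rewrite mul0r.
  move/freeP: (basis_free b0U) => /(_ (fun i => x 0 i * p%:F ^+ m)); apply.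
  by rewrite -[RHS]x0; apply: eq_bigr => j _; rewrite -scalerA.
pose T := \matrix_(i < N, j < N) alg_trace mul U (mul (b1 i) (b1 j)).
have tr_int u j : lattice u -> alg_trace mul U (mul u (b1 j)) \in @int_frac R.
  move=> [uU uO]; rewrite -O_frac iota_alg_trace ?mulU // rpred_sum // => k _.
  by rewrite tau_mul // rpredM //; case: (b1O j).
have TS : T \is a mxOver (@int_frac R) by apply/mxOverP=> i j; rewrite mxE tr_int.
(* T is the matrix of embeddings times its transpose, and that matrix is invertible. *)
have T0 : \det T != 0.
  rewrite -(fmorph_eq0 iota) -det_map_mx.
  pose t1 : N.-tuple V := [tuple b1 i | i < N].
  have t1E (i : 'I_N) : t1`_i = b1 i by rewrite -tnth_nth tnth_mktuple.
  have t1U : basis_of U t1.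
    rewrite basisEfree size_tuple leqnn andbT; apply/andP; split.
      apply/freeP=> c c0 i; have := b1_free (\row_i c i).
      rewrite (_ : \sum_i _ = \sum_(i < N) c i *: t1`_i); last first.
        by apply: eq_bigr => j _; rewrite mxE t1E.
      by move=> /(_ c0)/rowP/(_ i); rewrite !mxE.
    by apply/span_subvP=> v /tnthP[i ->]; rewrite tnth_mktuple.
  have -> : map_mx iota T = tau_mx t1 *m (tau_mx t1)^T.
    apply/matrixP=> i j; rewrite !mxE iota_alg_trace ?mulU //.
    by apply: eq_bigr => k _; rewrite tau_mul // !mxE !t1E.
  have := tau_mx_free t1U; have := tau_mx_tr_free t1U.
  move: (tau_mx t1) etale_dim; rewrite -/N => B NE; move: B; rewrite NE => B BT BF.
  by rewrite det_mulmx det_tr mulf_neq0 // -unitfE -unitmxE -row_free_unit.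
have [k kT] := has_val_ex p_unif (det_mem TS) T0.
have pk0 : p%:F ^+ k != 0 :> K by rewrite expf_neq0.
pose vec (y : 'rV[K]_N) := \sum_i (y 0 i / p%:F ^+ k) *: b1 i.
pose Q : set 'rV[K]_N := [set y | lattice (vec y)]%classic.
have QS y : Q y -> y \is a mxOver (@int_frac R).
  move=> Qy; pose x := (p%:F ^+ k)^-1 *: y.
  have vecE : vec y = \sum_i x 0 i *: b1 i.
    by apply: eq_bigr => i _; rewrite mxE mulrC.
  have xT : x *m T \is a mxOver (@int_frac R).
    apply/mxOverP=> a j; rewrite ord1 (_ : _ 0 j = alg_trace mul U (mul (vec y) (b1 j))) ?tr_int //.
    have vU : vec y \in U by case: Qy.
    apply: (fmorph_inj iota); rewrite iota_alg_trace ?mulU // mxE rmorph_sum.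
    under eq_bigr => i _ do rewrite [T i j]mxE rmorphM iota_alg_trace ?mulU // mulr_sumr.
    rewrite exchange_big; apply: eq_bigr => h _ /=.
    rewrite tau_mul // vecE tau_sum // mulr_suml; apply: eq_bigr => i _.
    by rewrite tau_mul // mulrA.
  have yE : y = (p%:F ^+ k / \det T) *: (x *m T *m \adj T).
    by rewrite -mulmxA mul_mx_adj mul_mx_scalar !scalerA mulfVK // mulfV // scale1r.
  rewrite yE; apply/mxOverP=> a j; rewrite mxE rpredM //; first by case/and3P: kT.
  exact: (mxOverP (mxOver_mulS xT (adj_mxOver TS))).
have vecD y z : vec (y + z) = vec y + vec z.
  by rewrite -big_split; apply: eq_bigr => i _; rewrite mxE mulrDl scalerDl.
have vecZ a y : vec (a *: y) = a *: vec y.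
  by rewrite scaler_sumr; apply: eq_bigr => i _; rewrite mxE scalerA mulrA.
have [T' [T'0 QE]] : exists T', \det T' != 0 /\ Q = row_span (@int_frac R) T'.
  apply: (row_submod_free p_unif (N := k)) => // [|i].
    split=> [|u v [uU uO] [vU vO]|a u aR [uU uO]].
    - rewrite /Q /= -(scale0r 0) vecZ scale0r; split=> [|j]; first exact: mem0v.
      by rewrite tau0 rpred0.
    - rewrite /Q /= vecD; split=> [|j]; first exact: memvD.
      by rewrite -[vec u]scale1r tau_lin // rmorph1 mul1r rpredD.
    rewrite /Q /= vecZ; split=> [|j]; first exact: memvZ.
    by rewrite tauZ // rpredM // O_frac.
  rewrite /Q /= (_ : vec _ = b1 i) // /vec (bigD1 i) //= big1 ?addr0 => [|j ji].
    by rewrite !mxE !eqxx mulr1 mulfV // scale1r.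
  by rewrite !mxE (negPf ji) andbF mulr0 mul0r scale0r.
have T'u : T' \in unitmx by rewrite unitmxE unitfE.
have vec_sum M (c : 'rV[K]_M) (A : 'M_(M, N)) : vec (c *m A) = \sum_i c 0 i *: vec (row i A).
  rewrite mulmx_sum_row; elim: (index_enum _) => [|i s IHs].
    by rewrite !big_nil -(scale0r 0) vecZ scale0r.
  by rewrite !big_cons vecD IHs vecZ.
pose b : N.-tuple V := [tuple vec (row i T') | i < N].
have bE (i : 'I_N) : b`_i = vec (row i T') by rewrite -tnth_nth tnth_mktuple.
have vec_surj u : u \in U -> exists y, u = vec y.
  move=> /b1_coord[x ->]; exists (p%:F ^+ k *: x); apply: eq_bigr => i _.
  by rewrite mxE mulrAC mulfV // mul1r.
have vecU y : vec y \in U by rewrite memv_suml // => i _; apply: memvZ.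
exists b; split.
  rewrite basisEdim size_tuple leqnn andbT; apply/subvP=> u /vec_surj[y ->].
  rewrite -(mulmxKV T'u y) vec_sum memv_suml // => i _; apply/memvZ/memv_span.
  by rewrite -bE mem_nth ?size_tuple.
move=> u; split=> [uO|[c ->]].
  have [y uE] : exists y, u = vec y by apply: vec_surj; case: uO.
  have : Q y by rewrite /Q /= -uE.
  rewrite QE => -[c cS yE].
  have /choice[r rE] i : exists r : R, c 0 i = r%:F by apply/int_fracP; apply: (mxOverP cS).
  exists r; rewrite uE yE vec_sum; apply: eq_bigr => i _.
  by rewrite rE bE.
apply: lin_mem => [i|i]; first by apply/int_fracP; exists (c i).
rewrite bE; suff : Q (row i T') by [].
rewrite QE; exists (delta_mx 0 i); last by rewrite rowE.
by apply/mxOverP=> a j; rewrite mxE; case: (_ && _); rewrite ?rpred1 ?rpred0.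
Qed.

(** A basis of U inside the lattice is b times an integral matrix, and its discriminant is that of b
    times the square of the determinant; so the one of b generates. *)
Theorem lattice_disc (b : (\dim U).-tuple V) : basis_of U b ->
    (forall u, lattice u <-> exists c : 'I_(\dim U) -> R, u = \sum_i (c i)%:F *: b`_i) ->
  exists D : R, iota D%:F = \det (tau_mx b *m (tau_mx b)^T) /\
    disc_ideal mul U lattice = [set r * D | r in [set: R]]%classic.
Proof.
move=> bU bO; have bmem i : tnth b i \in U by apply: (basis_mem bU); apply: mem_tnth.
have bL i : lattice (tnth b i).
  apply/bO; exists (fun j => (j == i)%:R); rewrite (bigD1 i) //= eqxx rmorph1 scale1r.
  by rewrite big1 ?addr0 -?tnth_nth // => j /negPf ->; rewrite rmorph0 scale0r.
have [D DE] : exists D : R, basis_disc mul b = D%:F.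
  apply/int_fracP/det_mem/mxOverP=> i j; rewrite mxE -O_frac.
  have bk (k : 'I_(\dim U)) : b`_k \in U by rewrite -tnth_nth.
  rewrite iota_alg_trace ?mulU // rpred_sum // => k _; rewrite tau_mul // -!tnth_nth.
  by rewrite rpredM //; case: (bL i); case: (bL j).
exists D; split; first by rewrite -DE iota_basis_disc.
apply/predeqP=> r; split=> [[m [a [s [sP ->]]]]|[y _ <-]]; last first.
  exists 1%N, (fun=> y), (fun=> D); split; last by rewrite big_ord1.
  by move=> _; exists b.
elim/big_ind: _ => [|_ _ [x _ <-] [y _ <-]|i _].
- by exists 0; rewrite ?mul0r.
- by exists (x + y); rewrite ?mulrDl.
have [b' [b'U b'O sE]] := sP i.
have /choice[c cE] j : exists c : 'I_(\dim U) -> R, tnth b' j = \sum_k (c k)%:F *: b`_k.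
  exact/bO.
pose M := \matrix_(j, k) c j k.
suff -> : s i = \det M ^+ 2 * D by exists (a i * \det M ^+ 2); rewrite -?mulrA.
apply/eqP; rewrite -tofrac_eq; apply/eqP/(fmorph_inj iota).
rewrite sE iota_basis_disc => [|j]; last by case: (b'O j).
have -> : tau_mx b' = map_mx iota (map_mx (@FracField.tofrac R) M) *m tau_mx b.
  apply/matrixP=> j k; rewrite !mxE -tnth_nth cE tau_sum => [|l]; last by rewrite -tnth_nth.
  by apply: eq_bigr => l _; rewrite !mxE.
rewrite tofracM rmorphM -DE iota_basis_disc // trmx_mul mulmxA -(mulmxA _ (tau_mx b)).
rewrite !det_mulmx det_tr !det_map_mx tofracXn rmorphXn expr2.
by rewrite mulrAC.
Qed.

End Lattice.
End EtaleAlgebra.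


(* The field e E, as a Galois extension of the fraction field of R with group  *)
(* the stabilizer of e; cd_rho is the projection a |-> e a of E onto it, and   *)
(* cd_sec its inclusion into E.                                                *)
Record comp_data (R : idomainType) (gT : finGroupType) (E : gcover R gT) (e : E) := CompData {
  cd_field : fieldType;
  cd_iota : {rmorphism {fraction R} -> cd_field};
  cd_rho : {rmorphism E -> cd_field};
  cd_sec : cd_field -> E;
  cd_act : gT -> {rmorphism cd_field -> cd_field};
  cd_secK : forall z, cd_rho (cd_sec z) = z;
  cd_rhoK : forall a, cd_sec (cd_rho a) = e * a;
  cd_rhoZ : forall c a, cd_rho (c *: a) = cd_iota c * cd_rho a;
  cd_act_rho : forall h a, h \in comp_stab e -> cd_act h (cd_rho a) = cd_rho (gcact E h a);
  cd_act_iota : forall h c, cd_act h (cd_iota c) = cd_iota c;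
  cd_indep : forall c : gT -> cd_field,
    (forall z, \sum_(h in comp_stab e) c h * cd_act h z = 0) ->
    forall h, h \in comp_stab e -> c h = 0;
  cd_fixed : forall z, (forall h, h \in comp_stab e -> cd_act h z = z) ->
    exists c, z = cd_iota c }.

Lemma comp_data_exists (R : idomainType) (gT : finGroupType) (E : gcover R gT) (e : E) :
  is_component e -> inhabited (comp_data e).
Proof.
move=> e_comp; have [L [iota [rho [sec [secK rhoK rhoZ]]]]] := component_field e_comp.
have ee : e * e = e by case: e_comp.
have mulC : commutative (@GRing.mul E) := @gcover_mulC _ _ E.
have rho_e : rho e = 1.
  by rewrite -[LHS]secK -[RHS]secK; congr (rho _); rewrite -[1](rmorph1 rho) !rhoK ee mulr1.
have rho_inj a b : rho a = rho b -> e * a = e * b by rewrite -!rhoK => ->.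
have rho_ea a : rho (e * a) = rho a by rewrite rmorphM rho_e mul1r.
(* Elements outside the stabilizer do not preserve e E; the identity is a default value for them. *)
pose act0 h z := if h \in comp_stab e then rho (gcact E h (sec z)) else z.
have act0_rho h a : h \in comp_stab e -> act0 h (rho a) = rho (gcact E h a).
  move=> hH; 
  have he := comp_stabP _ _ hH; have gea : gcact E h (e * a) = e * gcact E h a.
    by rewrite -[X in X * gcact E h a]he -rmorphM.
  by rewrite /act0 hH rhoK gea rho_ea.
have act0_zmod h : zmod_morphism (act0 h).
  move=> y z; case: (boolP (h \in comp_stab e)) => [hH|/negPf hH]; last by rewrite /act0 hH.
  by rewrite -[y]secK -[z]secK -rmorphB !act0_rho // linearB rmorphB.
have act0_monoid h : monoid_morphism (act0 h).
  case: (boolP (h \in comp_stab e)) => [hH|/negPf hH]; last by rewrite /act0 hH; split.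
  split=> [|y z]; first by rewrite -(rmorph1 rho) act0_rho // (rmorph1 (gcact E h)).
  by rewrite -[y]secK -[z]secK -rmorphM !act0_rho // (rmorphM (gcact E h)) rmorphM.
pose act h : {rmorphism L -> L} := HB.pack (act0 h)
  (GRing.isZmodMorphism.Build _ _ _ (act0_zmod h))
  (GRing.isMonoidMorphism.Build _ _ _ (act0_monoid h)).
have iotaE c : iota c = rho (c *: 1) by rewrite rhoZ rmorph1 mulr1.
constructor; apply: (@CompData _ _ E e L iota rho sec act) => //.
- move=> h c; case: (boolP (h \in comp_stab e)) => [hH|/negPf hH]; last by rewrite /= /act0 hH.
  by rewrite iotaE /= act0_rho // linearZ /= (rmorph1 (gcact E h)).
- move=> c cH h hH; have sec0 : sec 0 = 0 by rewrite -(rmorph0 rho) rhoK mulr0.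
  have key a : \sum_(g in comp_stab e) sec (c g) * (e * gcact E g a) = 0.
    transitivity (e * \sum_(h in comp_stab e) sec (c h) * gcact E h a).
      by rewrite mulr_sumr; apply: eq_bigr => g _; rewrite !mulrA [e * _]mulC.
    rewrite -rhoK -[RHS]sec0 rmorph_sum; congr sec; rewrite -[RHS](cH (rho a)).
    by apply: eq_bigr => g gH; rewrite rmorphM secK /= act0_rho.
  have := comp_indep key hH.
  by move/(congr1 rho); rewrite rmorphM secK rho_e mulr1 rmorph0.
move=> z zH; have esec : e * sec z = sec z by rewrite -rhoK secK.
have [h hH|c cE] := comp_fixed e_comp esec.
  rewrite -[RHS](congr1 sec (zH h hH)) -[in RHS](secK z) /= act0_rho // rhoK.
  by rewrite -[in RHS](comp_stabP _ _ hH) -rmorphM esec.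
by exists c; rewrite -[LHS]secK cE rhoZ rho_e mulr1.
Qed.


(** * The ring of integers of a component *)

Section IntegralClosure.
Variables (R : nzRingType) (L : comNzRingType) (iota : {rmorphism R -> L}).
Definition int_closure : {pred L} := [pred z | `[< integralOver iota z >]].
End IntegralClosure.

Section IntegralClosureRing.
Variables (R L : comNzRingType) (iota : {rmorphism R -> L}).
Lemma int_closure_closed : subring_closed (int_closure iota).
Proof.
split=> [|x y /asboolP xi /asboolP yi|x y /asboolP xi /asboolP yi]; apply/asboolP.
- exact: integral1.
- exact: integral_sub.
exact: integral_mul.
Qed.
HB.instance Definition _ := GRing.isSubringClosed.Build _ (int_closure iota)
  int_closure_closed.
End IntegralClosureRing.

Lemma int_closureP (R L : comNzRingType) (iota : {rmorphism R -> L}) z :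
  reflect (integralOver iota z) (z \in int_closure iota).
Proof. exact: asboolP. Qed.

Section Component.
Variables (R : idomainType) (p : R).
Hypothesis p0 : p != 0.
Hypothesis maxE : forall x : R, maxideal x <-> exists y, x = y * p.
Hypothesis factor : forall r : R, r != 0 ->
  exists n u, u \is a GRing.unit /\ r = u * p ^+ n.
Variables (gT : finGroupType) (E : gcover R gT) (e : E).
Hypothesis e_comp : is_component e.
Variable X : comp_data e.
Notation K := {fraction R}.
Notation L := (cd_field X).
Notation iota := (cd_iota X).
Notation rho := (cd_rho X).
Notation sec := (@cd_sec _ _ _ _ X).
Notation act := (cd_act X).
Notation H := (comp_stab e).

Definition cd_iotaR : {rmorphism R -> L} := iota \o @FracField.tofrac R.
Notation O := (int_closure cd_iotaR).

Lemma cd_iotaR_inj : injective cd_iotaR.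
Proof.
by move=> x y /= /(fmorph_inj iota)/eqP; rewrite tofrac_eq => /eqP.
Qed.

Lemma int_frac_or_inv (c : K) : c \in @int_frac R \/ c^-1 \in @int_frac R.
Proof.
have [->|c0] := eqVneq c 0; first by left; rewrite rpred0.
have [n /int_fracP[r rE]] := frac_denom factor c.
have pF0 : p%:F != 0 :> K by rewrite tofrac_eq0.
have r0 : r != 0 by rewrite -tofrac_eq0 -rE mulf_neq0 // expf_neq0.
have [m [u [uu uE]]] := factor r0.
have u0 : u%:F != 0 :> K by rewrite tofrac_eq0; apply: contraTneq uu => ->; rewrite unitr0.
have cE : c = u%:F * (p%:F ^+ m / p%:F ^+ n).
  rewrite mulrA -tofracXn -tofracM -uE -rE mulfK // expf_neq0 //.
have uV : (u^-1)%:F = (u%:F)^-1 :> K.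
  by apply: (mulfI u0); rewrite -tofracM mulrV // tofrac1 mulfV.
have unif := int_frac_uniformizer p0 maxE factor.
have [le|/ltnW le] := leqP n m; [left | right].
  rewrite cE rpredM ?(unif_pow_mem unif) //; first by apply/int_fracP; exists u.
rewrite cE invfM invf_div rpredM ?(unif_pow_mem unif) //.
by apply/int_fracP; exists u^-1.
Qed.

(** R is integrally closed: c or c^-1 lies in R and, in the second case, dividing a monic equation
    by a power of c writes c as a polynomial in c^-1. *)
Lemma O_frac (c : K) : (iota c \in O) = (c \in @int_frac R).
Proof.
apply/int_closureP/idP => [[P mP rP]|/int_fracP[r ->]]; last exact: integral_id.
have [//|cV] := int_frac_or_inv c.
have [->|c0] := eqVneq c 0; first by rewrite rpred0.
have Pc : root (map_poly (@FracField.tofrac R) P) c.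
  by rewrite -(fmorph_root iota) -map_poly_comp.
have Pm : map_poly (@FracField.tofrac R) P \is monic by apply: monic_map.
move: Pc Pm; rewrite /root horner_coef; set Q := map_poly _ P => Qc mQ.
have QR i : Q`_i \in @int_frac R by apply/int_fracP; exists P`_i; rewrite coef_map.
case szQ : (size Q) => [|[|n]].
- by move: (monic_neq0 mQ); rewrite -size_poly_gt0 szQ.
- move: Qc; rewrite szQ big_ord1 expr0 mulr1 => /eqP Q0.
  by move: mQ; rewrite monicE lead_coefE szQ /= Q0 eq_sym oner_eq0.
move: Qc; rewrite szQ big_ord_recr /=.
have -> : Q`_n.+1 = 1 by move/monicP: mQ; rewrite lead_coefE szQ.
rewrite mul1r addrC addr_eq0 => /eqP cE.
have -> : c = - \sum_(i < n.+1) Q`_i * c^-1 ^+ (n - i).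
  have cn0 : c ^+ n != 0 by rewrite expf_neq0.
  apply: (mulIf cn0); rewrite -exprS cE mulNr mulr_suml; congr (- _).
  apply: eq_bigr => i _; rewrite -mulrA; congr (_ * _).
  have le : (i <= n)%N by rewrite -ltnS.
  by rewrite -[X in _ * c ^+ X](subnK le) exprD mulrA -exprMn mulVf // expr1n mul1r.
by rewrite rpredN rpred_sum // => i _; rewrite rpredM // rpredX.
Qed.

Lemma iotaR_mem r : cd_iotaR r \in O.
Proof. by apply/int_closureP; apply: integral_id. Qed.

Lemma O_act h z : z \in O -> act h z \in O.
Proof.
move=> /int_closureP[P mP Pz]; apply/int_closureP; exists P => //.
rewrite -(fmorph_root (act h)) -map_poly_comp in Pz.
rewrite (_ : map_poly _ P = map_poly (act h \o cd_iotaR) P) //.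
by apply: eq_map_poly => r /=; rewrite cd_act_iota.
Qed.

(** Multiplication by z has a matrix over K; a power of p clears its denominators, and
    [integral_stable] applies. *)
Lemma O_span z : exists m, iota p%:F ^+ m * z \in O.
Proof.
pose a := sec z; pose v (i : 'I_(\dim {:E})) := rho (vbasis {:E})`_i.
pose M (i j : 'I_(\dim {:E})) : K := coord (vbasis {:E}) j (a * (vbasis {:E})`_i).
have ME (i : 'I_(\dim {:E})) : z * v i = \sum_j iota (M i j) * v j.
  rewrite -[z]cd_secK -rmorphM {1}(coord_vbasis (memvf (_ * _))) rmorph_sum.
  by apply: eq_bigr => j _; rewrite cd_rhoZ.
have /choice[k kP] ij : exists n, M ij.1 ij.2 * p%:F ^+ n \in @int_frac R.
  exact: (frac_denom factor).
pose m := (\sum_(ij : 'I_(\dim {:E}) * 'I_(\dim {:E})) k ij)%N.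
have mP i j : exists r : R, p%:F ^+ m * M i j = r%:F.
  apply/int_fracP; rewrite /m (bigD1 (i, j)) //= addnC exprD -mulrA rpredM //.
    by rewrite rpredX //; apply/int_fracP; exists p.
  by rewrite mulrC; apply: (kP (i, j)).
exists m; apply/int_closureP.
have [i0 vi0] : exists i, v i != 0.
  apply: contrapT => /forallNP v0; case/eqP: (oner_neq0 L).
  rewrite -(rmorph1 rho) (coord_vbasis (memvf 1)) rmorph_sum big1 // => i _.
  by have /negP/negPn/eqP vi0 := v0 i; rewrite cd_rhoZ -/(v i) vi0 mulr0.
apply: (integral_stable (mu := v) vi0) => i.
have /choice[r rE] := mP i; exists r.
rewrite -mulrA ME mulr_sumr; apply: eq_bigr => j _.
by rewrite mulrA -rmorphXn -rmorphM rE.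
Qed.

Lemma rho_e : rho e = 1.
Proof.
rewrite -[LHS]cd_secK -[RHS]cd_secK -[1](rmorph1 rho) !cd_rhoK mulr1.
by case: e_comp => _ ->.
Qed.

Lemma rho_ea a : rho (e * a) = rho a.
Proof. by rewrite rmorphM rho_e mul1r. Qed.

Lemma sec_rho a : e * a = a -> sec (rho a) = a.
Proof. by rewrite cd_rhoK. Qed.

Lemma e_sec z : e * sec z = sec z.
Proof. by rewrite -(@cd_rhoK _ _ _ _ X) cd_secK. Qed.

Lemma rho_inj a b : e * a = a -> e * b = b -> rho a = rho b -> a = b.
Proof. by move=> /sec_rho aE /sec_rho bE ab; rewrite -aE ab. Qed.

Lemma ring_of_componentP a : ring_of_component e a <-> e * a = a /\ rho a \in O.
Proof.
have mulC : commutative (@GRing.mul E) := @gcover_mulC _ _ E.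
have ee : e * e = e by case: e_comp.
have map_rho P : map_poly rho (map_poly (in_alg E \o @FracField.tofrac R) P) = map_poly cd_iotaR P.
  rewrite -map_poly_comp; apply: eq_map_poly => r /=.
  by rewrite cd_rhoZ rmorph1 mulr1.
split=> [[b [P mP Pb] <-]|[ea /int_closureP[P mP Pa]]].
  rewrite mulrA ee; split=> //; rewrite rho_ea; apply/int_closureP; exists P => //.
  by rewrite -map_rho; apply: rmorph_root.
(* The equation of [rho a] holds for a only after multiplication by e; the extra factor X supplies
   it, since a = e a. *)
exists a => //; exists (P * 'X); first by rewrite monicMr ?monicX.
pose b := (map_poly (in_alg E \o @FracField.tofrac R) P).[a].
have eb : e * b = 0.
  rewrite -(@cd_rhoK _ _ _ _ X) (_ : rho b = rho 0) ?cd_rhoK ?mulr0 //.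
  by rewrite rmorph0; apply/eqP; rewrite /b -horner_map map_rho.
rewrite rmorphM /= map_polyX /root hornerMX -/b -ea.
by rewrite mulrA [b * e]mulC eb mul0r.
Qed.

Lemma cd_act1 z : act 1%g z = z.
Proof.
have H1 : 1%g \in H by case/group_setP: (comp_stab_group e).
by rewrite -[z in LHS]cd_secK cd_act_rho // gcact1 cd_secK.
Qed.

Lemma cd_actM g h z : g \in H -> h \in H -> act (g * h)%g z = act h (act g z).
Proof.
move=> gH hH; have ghH : (g * h)%g \in H.
  by case/group_setP: (comp_stab_group e) => _ /(_ g h gH hH).
by rewrite -[z]cd_secK !cd_act_rho // gcactM.
Qed.

Lemma cd_act_trace z : exists c, \sum_(h in H) act h z = iota c.
Proof.
apply: cd_fixed => g gH; rewrite rmorph_sum /=.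
rewrite [RHS](reindex_inj (mulIg g)) /=; apply: eq_big => [h|h hH].
  by rewrite -[H]/(gval (Group (comp_stab_group e))) groupMr.
by rewrite cd_actM.
Qed.

End Component.


(** * Subextensions of a component *)

Section Ramified.
Variables (R : idomainType) (p : R).
Hypothesis p0 : p != 0.
Hypothesis maxE : forall x : R, maxideal x <-> exists y, x = y * p.
Hypothesis factor : forall r : R, r != 0 ->
  exists n u, u \is a GRing.unit /\ r = u * p ^+ n.
Hypothesis complete : forall u : nat -> R, adic_cauchy u -> exists l, adic_limit u l.
Variables (k : closedFieldType) (res : {rmorphism R -> k}).
Hypothesis kres : is_residue_field res.
Variables (gT : finGroupType) (E : gcover R gT) (e : E).
Variable X : comp_data e.
Notation K := {fraction R}.
Notation L := (cd_field X).
Notation iota := (cd_iota X).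
Notation rho := (cd_rho X).
Notation sec := (@cd_sec _ _ _ _ X).
Notation act := (cd_act X).
Notation H := (comp_stab e).
Notation iotaR := (cd_iotaR X).
Notation O := (int_closure iotaR).

Let unif := int_frac_uniformizer p0 maxE factor.
Lemma comp_galois : galois_action iota H act.
Proof.
split; [| exact: cd_act1 | exact: cd_indep | exact: cd_act_trace].
by case/group_setP: (comp_stab_group e).
Qed.
Let Gal := comp_galois.

Section Subalgebra.
Variables (U : {vspace E}) (n : nat) (sigma : 'I_n -> L -> L).
Variable S : subringClosed L.
Hypothesis Ue : forall u, u \in U -> e * u = u.
Hypothesis S_lattice : forall u, lattice U (fun i u => sigma i (rho u)) O u <->
  e * u = u /\ rho u \in S.
Hypothesis S_O : forall z, z \in S -> z \in O.
Hypothesis S_closed : forall z, iotaR p * z \in S -> z \in O -> z \in S.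
Hypothesis n_gt0 : (0 < n)%N.
Notation tau := (fun i u => sigma i (rho u)).
Hypothesis Emb : all_embeddings iota H act *%R U tau.

Lemma sub_dim : \dim U = n.
Proof.
exact: (etale_dim Gal Emb).
Qed.

Lemma sub_basis_span (b : (\dim U).-tuple E) : basis_of U b ->
    (forall u, lattice U tau O u <->
       exists c : 'I_(\dim U) -> R, u = \sum_i (c i)%:F *: b`_i) ->
  (forall z, z \in S <-> exists c : 'I_(\dim U) -> R, z = \sum_i iotaR (c i) * rho b`_i) /\
  (forall c : 'I_(\dim U) -> R, \sum_i iotaR (c i) * rho b`_i = 0 -> forall i, c i = 0).
Proof.
move=> bU bO; have rho_sum (c : 'I_(\dim U) -> R) :
    rho (\sum_i (c i)%:F *: b`_i) = \sum_i iotaR (c i) * rho b`_i.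
  by rewrite rmorph_sum; apply: eq_bigr => i _; rewrite cd_rhoZ.
split=> [z|c c0 i].
  split=> [zS|[c ->]]; last first.
    by rewrite -rho_sum; apply: ((S_lattice _).1 _).2; apply/bO; exists c.
  have : lattice U tau O (sec z) by apply/S_lattice; rewrite e_sec cd_secK.
  by move/bO=> [c cE]; exists c; rewrite -rho_sum -cE cd_secK.
have bmem (j : 'I_(\dim U)) : b`_j \in U by apply: basis_nth_mem.
have : \sum_i (c i)%:F *: b`_i = 0.
  apply: (rho_inj (X := X)); rewrite ?mulr0 ?rmorph0 ?rho_sum //.
  by rewrite Ue // memv_suml // => j _; apply: memvZ.
move/freeP: (basis_free bU) => /[apply]/(_ i)/eqP.
by rewrite tofrac_eq0 => /eqP.
Qed.

(** Needed twice: for L itself, and for the invariants K(C_j) of a point stabilizer. *)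
Lemma sub_ramified : exists P, [/\ uniformizer S P, has_val S P (iotaR p) n,
  forall z, z \in S <-> exists c : 'I_(\dim U) -> R, z = \sum_i iotaR (c i) * P ^+ i &
  forall c : 'I_(\dim U) -> R, \sum_i iotaR (c i) * P ^+ i = 0 -> forall i, c i = 0].
Proof.
have [b [bU bO]] := lattice_basis Gal Emb (O_frac p0 maxE factor X) unif (O_span factor (X := X)).
have [S_span w_free] := sub_basis_span bU bO.
have [P [P_unif P_val P_span P_free]] := totally_ramified p0 maxE factor complete
  (@cd_iotaR_inj _ _ _ _ X) S_span w_free kres (fun z zS => int_closureP _ _ (S_O zS))
  (fun z qz zO => S_closed qz (introT (int_closureP _ _) zO)).
by exists P; split=> //; rewrite sub_dim in P_val.
Qed.

(** The powers of a uniformizer form an integral basis, so their trace determinant generates the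
    discriminant ideal and the exponent w of [different_exponent] is the discriminant exponent. The
    condition n s <= w is then the bound of s by an integral quotient. *)
Lemma sub_disc (S_set : set E) : (forall u, S_set u <-> e * u = u /\ rho u \in S) ->
  forall s, (forall z, z \in S -> exists y, \sum_i sigma i z = iotaR (y * p ^+ s)) <->
    (s <= disc_exp *%R U S_set %/ \dim U)%N.
Proof.
move=> S_setE; have [P [P_unif P_val P_span P_free]] := sub_ramified.
have PS i : P ^+ i \in S by rewrite rpredX // (unif_mem P_unif).
have rhoO u : lattice U tau O u -> u \in U by case.
have secU z : z \in S -> sec z \in U.
  by move=> zS; apply: rhoO; apply/S_lattice; rewrite e_sec cd_secK.
pose b : (\dim U).-tuple E := [tuple sec (P ^+ i) | i < \dim U].
have bE (i : 'I_(\dim U)) : b`_i = sec (P ^+ i) by rewrite -tnth_nth tnth_mktuple.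
have rho_sum (c : 'I_(\dim U) -> K) :
    rho (\sum_i c i *: b`_i) = \sum_i iota (c i) * P ^+ i.
  by rewrite rmorph_sum; apply: eq_bigr => i _; rewrite cd_rhoZ bE cd_secK.
have bmem (i : 'I_(\dim U)) : b`_i \in U by rewrite bE secU.
have bU : basis_of U b.
  rewrite basisEfree size_tuple leqnn andbT; apply/andP; split; last first.
    by apply/span_subvP=> v /tnthP[i ->]; rewrite tnth_mktuple secU.
  apply/freeP=> c c0; have /choice[m mE] i := frac_denom factor (c i).
  pose M := (\sum_i m i)%N.
  have /choice[r rE] i : exists r : R, p%:F ^+ M * c i = r%:F.
    apply/int_fracP; rewrite /M (bigD1 i) //= addnC exprD -mulrA rpredM //.
      by rewrite rpredX //; apply/int_fracP; exists p.
    by rewrite mulrC; apply: mE.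
  have r0 : forall i, r i = 0.
    apply: P_free; transitivity (iota (p%:F ^+ M) * rho (\sum_i c i *: b`_i)); last first.
      by rewrite c0 rmorph0 mulr0.
    rewrite rho_sum mulr_sumr.
    by apply: eq_bigr => i _; rewrite mulrA -rmorphM rE.
  move=> i; apply: (@mulfI _ (p%:F ^+ M)); first by rewrite expf_neq0 // tofrac_eq0.
  by rewrite mulr0 rE r0 rmorph0.
have bO u : lattice U tau O u <-> exists c : 'I_(\dim U) -> R, u = \sum_i (c i)%:F *: b`_i.
  split=> [/S_lattice[eu /P_span[c cE]]|[c ->]].
    exists c; apply: (rho_inj (X := X)) => //; last by rewrite rho_sum.
    by rewrite Ue // memv_suml // => j _; apply: memvZ.
  apply/S_lattice; rewrite Ue ?memv_suml // => [|j _]; last exact: memvZ.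
  by split=> //; rewrite rho_sum; apply/P_span; exists c.
have [D [DE discE]] := lattice_disc Gal Emb (O_frac p0 maxE factor X) bU bO.
have S_setO : S_set = lattice U tau O.
  by apply/predeqP=> u; split=> [/S_setE/S_lattice|/S_lattice/S_setE].
have /choice[t tP] z : exists r : R, z \in S -> \sum_i sigma i z = iotaR r.
  have [zS|] := boolP (z \in S); last by exists 0.
  have zU := secU z zS; have trE := iota_alg_trace Gal Emb zU.
  rewrite cd_secK in trE; have /int_fracP[r rE] : alg_trace *%R U (sec z) \in @int_frac R.
    rewrite -(O_frac p0 maxE factor X) trE rpred_sum // => i _.
    have [_ /(_ i)] : lattice U tau O (sec z) by apply/S_lattice; rewrite e_sec cd_secK.
    by rewrite cd_secK.
  by exists r => _; rewrite -trE rE.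
have dimU_gt0 : (0 < \dim U)%N by rewrite sub_dim.
have sigma_lin i r y z : y \in S -> z \in S ->
    sigma i (iotaR r * y + z) = iotaR r * sigma i y + sigma i z.
  move=> yS zS; have := emb_lin Emb i r%:F (secU y yS) (secU z zS).
  by rewrite rmorphD cd_rhoZ !cd_secK.
have t_lin r y z : y \in S -> z \in S -> t (iotaR r * y + z) = r * t y + t z.
  move=> yS zS; apply: (@cd_iotaR_inj _ _ _ _ X).
  have rS : iotaR r * y \in S by apply: (span_scale P_span).
  rewrite rmorphD rmorphM -!tP ?rpredD //.
  under eq_bigr => i _ do rewrite sigma_lin //.
  by rewrite big_split mulr_sumr.
pose T := \matrix_(i < \dim U, j < \dim U) t (P ^+ i * P ^+ j).
have TD : \det T = D.
  apply: (@cd_iotaR_inj _ _ _ _ X); rewrite -[RHS]/(iota D%:F) DE -det_map_mx.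
  congr (\det _); apply/matrixP=> i j; rewrite !mxE -tP ?rpredM //.
  apply: eq_bigr => a _; rewrite !mxE.
  by have /= <- := emb_mul Emb a (bmem i) (bmem j); rewrite rmorphM !bE !cd_secK.
have D0 : D != 0.
  rewrite -(inj_eq (@cd_iotaR_inj _ _ _ _ X)) rmorph0 -[iotaR D]/(iota D%:F) DE.
  have := tau_mx_free Gal Emb bU.
  have := tau_mx_tr_free Emb bU.
  move: (tau_mx _ b) sub_dim => B nE; move: B; rewrite nE => B BT BF.
  by rewrite det_mulmx det_tr mulf_neq0 // -unitfE -unitmxE -row_free_unit.
have P_val' : has_val S P (iotaR p) (\dim U) by rewrite sub_dim.
rewrite -TD in D0.
have [w [u [uu wE ws]]] := different_exponent p0 maxE factor dimU_gt0 P_unif P_val' P_span P_free t_lin D0.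
rewrite (disc_exp_eq p0 maxE (n := w) uu); last by rewrite S_setO discE -TD wE.
move=> s; rewrite leq_divRL // mulnC; split=> [ts|/ws ts z zS].
  by apply/ws => z zS; have [y yE] := ts z zS; exists y; apply: (@cd_iotaR_inj _ _ _ _ X);
    rewrite -tP.
by have [y yE] := ts z zS; exists y; rewrite tP // yE.
Qed.

End Subalgebra.
End Ramified.


(** Subtract y_i times row i0 from every other row i, and add all columns to column i0. Both
    operations, by Y and Z, have determinant 1, and column i0 becomes t at i0 and 0 elsewhere. *)
Lemma det_row_sums (F : fieldType) n (A : 'M[F]_n) (i0 : 'I_n) (y : 'I_n -> F) (t : F) :
    y i0 = 1 -> (forall i, \sum_j A i j = y i * t) ->
  \det A = t * \det (\matrix_(a < n.-1, b < n.-1)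
    (A (lift i0 a) (lift i0 b) - y (lift i0 a) * A i0 (lift i0 b))).
Proof.
move=> y0 rowA.
pose Y := (\matrix_j (if j == i0 then \row_i (if i == i0 then 1 else - y i)
                      else delta_mx 0 j))^T.
pose Z : 'M[F]_n := (\matrix_j (if j == i0 then const_mx 1 else delta_mx 0 j))^T.
have dY : \det Y = 1 by rewrite det_tr det_replace_row mxE eqxx.
have dZ : \det Z = 1 by rewrite det_tr det_replace_row mxE.
have YE B i j : (Y *m B) i j = if i == i0 then B i0 j else B i j - y i * B i0 j.
  rewrite mxE (bigD1 i0) //= !mxE eqxx mxE.
  have [->|ii0] := eqVneq i i0.
    rewrite mul1r big1 ?addr0 // => k ki; rewrite !mxE (negPf ki) !mxE eqxx /=.
    by rewrite eq_sym (negPf ki) mul0r.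
  rewrite (bigD1 i) //= !mxE (negPf ii0) !mxE !eqxx mul1r big1 ?addr0 => [|k /andP[ki0 ki]].
    by rewrite mulNr addrC.
  by rewrite !mxE (negPf ki0) !mxE eq_sym (negPf ki) andbF mul0r.
have ZE B i j : (B *m Z) i j = if j == i0 then \sum_k B i k else B i j.
  rewrite mxE; case: eqP => [->|/eqP ji0].
    by apply: eq_bigr => k _; rewrite !mxE eqxx mxE mulr1.
  rewrite (bigD1 j) //= !mxE (negPf ji0) !mxE !eqxx mulr1 big1 ?addr0 // => k kj.
  by rewrite !mxE (negPf ji0) !mxE (negPf kj) andbF mulr0.
have -> : \det A = \det (Y *m A *m Z) by rewrite !det_mulmx dY dZ mul1r mulr1.
rewrite (expand_det_col _ i0) (bigD1 i0) //= big1 ?addr0 => [|i ii0].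
  rewrite ZE eqxx; have -> : \sum_k (Y *m A) i0 k = t.
    by rewrite -[RHS]mul1r -y0 -rowA; apply: eq_bigr => k _; rewrite YE eqxx.
  rewrite /cofactor addnn -signr_odd odd_double expr0 mul1r; congr (_ * \det _).
  apply/matrixP=> a b; rewrite [RHS]mxE [LHS]mxE [LHS]mxE.
  by rewrite ZE YE ![_ == i0]eq_sym !(negPf (neq_lift _ _)).
rewrite ZE eqxx; have -> : \sum_k (Y *m A) i k = 0; last by rewrite mul0r.
under eq_bigr => k _ do rewrite YE (negPf ii0).
by rewrite sumrB -mulr_sumr !rowA y0 mul1r subrr.
Qed.

(** The initial value of the iterated minimum is the maximum of the family, which does no harm when
    the family is nonempty. *)
Lemma min_overP l (f : 'I_l -> nat) s : (0 < l)%N ->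
  (s <= min_over f)%N <-> (forall j, s <= f j)%N.
Proof.
move=> l0; rewrite /min_over; split=> [le j|le].
  apply: leq_trans le _; have : j \in index_enum 'I_l by rewrite mem_index_enum.
  move: (\max_(_ < _) _)%N => m.
  elim: (index_enum _) => //= i r IHr; rewrite inE big_cons geq_min => /orP[/eqP ->|/IHr ->].
    by rewrite leqnn.
  by rewrite orbT.
elim/big_ind: _ => [|a b sa sb|//]; last by rewrite leq_min sa.
by apply: leq_trans (le (Ordinal l0)) _; apply: leq_bigmax.
Qed.


(** * The associated cover and the function v *)

Section AssociatedCover.
Variables (R : idomainType) (p : R).
Hypothesis p0 : p != 0.
Hypothesis maxE : forall x : R, maxideal x <-> exists y, x = y * p.
Hypothesis factor : forall r : R, r != 0 ->
  exists n u, u \is a GRing.unit /\ r = u * p ^+ n.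
Hypothesis complete : forall u : nat -> R, adic_cauchy u -> exists l, adic_limit u l.
Variables (k : closedFieldType) (res : {rmorphism R -> k}).
Hypothesis kres : is_residue_field res.
Variables (gT : finGroupType) (E : gcover R gT) (e : E).
Hypothesis e_comp : is_component e.
Variable X : comp_data e.
Notation L := (cd_field X).
Notation iota := (cd_iota X).
Notation rho := (cd_rho X).
Notation sec := (@cd_sec _ _ _ _ X).
Notation act := (cd_act X).
Notation H := (comp_stab e).
Notation iotaR := (cd_iotaR X).
Notation O := (int_closure iotaR).

Let unif := int_frac_uniformizer p0 maxE factor.
Let mulC : commutative (@GRing.mul E) := @gcover_mulC _ _ E.
Let ee : e * e = e. Proof. by case: e_comp. Qed.
Let Gal := comp_galois X.
Let H1 := ga_one Gal.
Let HM g h : g \in H -> h \in H -> (g * h)%g \in H.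
Proof. by case/group_setP: (comp_stab_group e) => _; apply. Qed.
Let HV g : (g^-1%g \in H) = (g \in H).
Proof. by rewrite -[H]/(gval (Group (comp_stab_group e))) groupV. Qed.

Lemma act_O g z : g \in H -> (act g z \in O) = (z \in O).
Proof.
move=> gH; apply/idP/idP; last exact: O_act.
by move=> gz; rewrite -[z]cd_act1 -(mulgV g) cd_actM ?HV //; apply: O_act.
Qed.

Lemma mem_comp_space u : u \in ({:E} * <[e]>)%VS <-> e * u = u.
Proof.
split=> [/memv_cosetP[v _ ->]|eu]; first by rewrite mulC -mulrA ee.
by apply/memv_cosetP; exists u; rewrite ?memvf // mulC eu.
Qed.

Lemma comp_ramified : exists P, uniformizer O P /\ has_val O P (iotaR p) #|H|.
Proof.
pose sigma (i : 'I_#|H|) z := act (enum_val i) z.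
pose rk := enum_rank_in H1.
have Emb : all_embeddings iota H act *%R ({:E} * <[e]>)%VS (fun i u => sigma i (rho u)).
  split.
  - by move=> u v /mem_comp_space eu /mem_comp_space ev; apply/mem_comp_space; rewrite mulrA eu.
  - by move=> i c u v _ _; rewrite /sigma rmorphD cd_rhoZ rmorphD rmorphM cd_act_iota.
  - by move=> i u v _ _; rewrite /sigma !rmorphM.
  - move=> h i hH; exists (rk (enum_val i * h^-1)%g) => u _.
    have gH : (enum_val i * h^-1)%g \in H by rewrite HM ?HV ?enum_valP.
    by rewrite /sigma enum_rankK_in // -cd_actM // mulgKV.
  - move=> u /mem_comp_space eu /(_ (rk 1%g)); rewrite /sigma enum_rankK_in // cd_act1 => u0.
    by apply: (rho_inj (X := X)); rewrite ?mulr0 ?rmorph0.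
  move=> c cU i; rewrite -(enum_valK_in H1 i); move: (enum_valP i).
  apply: (ga_indep Gal (c := fun h => c (rk h))) => z.
  rewrite big_enum_val -[RHS](cU (sec z)); last by apply/mem_comp_space; apply: e_sec.
  by apply: eq_bigr => j _; rewrite /rk enum_valK_in cd_secK.
have [|u|||P [P_unif P_val _ _]] := @sub_ramified _ _ p0 maxE factor complete _ _ kres
   _ _ _ X ({:E} * <[e]>)%VS #|H| sigma O _ _ _ _ Emb.
- by move=> u /mem_comp_space.
- split=> [[/mem_comp_space eu /(_ (rk 1%g))]|[/mem_comp_space uU uO]].
    by rewrite /sigma enum_rankK_in // cd_act1.
  by split=> // i; rewrite /sigma act_O // enum_valP.
- by [].
- by [].
by exists P.
Qed.

Variables (d l : nat) (to : {action gT &-> 'I_d}) (x : 'I_l -> 'I_d).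
Hypothesis x_reps : orbit_reps to e x.

Notation stab j := 'C_(comp_stab e)[x j | to]%g.

(* [orb i] is the index of the orbit of i, and [trans i] maps its chosen       *)
(* element to i.                                                               *)
Lemma transporter_exists : exists (orb : 'I_d -> 'I_l) (trans : 'I_d -> gT),
  [/\ forall i, trans i \in H, forall i, to (x (orb i)) (trans i) = i &
      forall i j, (i \in orbit to H (x j)) = (orb i == j)].
Proof.
have /choice[orb orbP] i : exists j, i \in orbit to H (x j) /\
    forall j', i \in orbit to H (x j') -> j = j' by have [j] := x_reps i; exists j.
have /choice[trans tP] i : exists g, g \in H /\ to (x (orb i)) g = i.
  by have [/orbitP[g gH gi] _] := orbP i; exists g.
exists orb, trans; split=> [i|i|i j]; try by case: (tP i).
by apply/idP/eqP => [/((orbP i).2)|<-]; case: (orbP i).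
Qed.

Variables (orb : 'I_d -> 'I_l) (trans : 'I_d -> gT).
Hypothesis trans_mem : forall i, trans i \in H.
Hypothesis trans_to : forall i, to (x (orb i)) (trans i) = i.
Hypothesis orbE : forall i j, (i \in orbit to H (x j)) = (orb i == j).

Definition conj_emb i z := act (trans i) z.
Definition stab_fixed j z := forall h, h \in stab j -> act h z = z.

Lemma mem_stab j h : (h \in stab j) = (h \in H) && (to (x j) h == x j).
Proof. by rewrite inE; congr (_ && _); apply/astab1P/eqP. Qed.

Let to_eq g i i' : (to i g == to i' g) = (i == i') := inj_eq (act_inj to g) i i'.

Lemma orb_x j : orb (x j) = j.
Proof. by apply/eqP; rewrite -orbE; apply/orbitP; exists 1%g => //; rewrite act1. Qed.

Lemma orb_to i g : g \in H -> orb (to i g) = orb i.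
Proof.
move=> gH; apply/eqP; rewrite -orbE; apply/orbitP; exists (trans i * g)%g.
  exact: HM.
by rewrite actM trans_to.
Qed.

(** The elements [trans i * g] and [trans (to i g)] differ by an element of the stabilizer of the
    chosen point, which fixes z. So H permutes the conjugates as it does the coordinates. *)
Lemma conj_emb_act i g z : g \in H -> stab_fixed (orb i) z ->
  act g (conj_emb i z) = conj_emb (to i g) z.
Proof.
move=> gH zf; pose i' := to i g.
have sH : (trans i * g * (trans i')^-1)%g \in stab (orb i).
  rewrite mem_stab !HM ?HV //= !actM trans_to -/i' -(orb_to i gH) -/i'.
  by rewrite -[X in to X _](trans_to i') actK.
rewrite /conj_emb -cd_actM // -[(_ * g)%g](mulgKV (trans i')) cd_actM ?(zf _ sH) //.
by move: sH; rewrite mem_stab => /andP[].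
Qed.

(** Test the relation on traces from L over the stabilizer of x_j. Grouping H by the image of x_j,
    that is by cosets, turns it into a relation among the elements of H. *)
Lemma conj_emb_indep j (c : 'I_d -> L) :
    (forall z, stab_fixed j z -> \sum_(i | orb i == j) c i * conj_emb i z = 0) ->
  forall i, orb i = j -> c i = 0.
Proof.
move=> cj i ij; rewrite -(trans_to i) ij.
apply: (ga_indep Gal (c := fun g => c (to (x j) g))) (trans_mem i) => y.
pose z := \sum_(s in stab j) act s y.
have zf : stab_fixed j z.
  move=> h; rewrite mem_stab => /andP[hH /eqP hx]; rewrite rmorph_sum /=.
  rewrite [RHS](reindex_inj (mulIg h)) /=; apply: eq_big => [s|s].
    rewrite !mem_stab actM -[H]/(gval (Group (comp_stab_group e))) groupMr //.
    by rewrite -[X in _ = _ && (_ == X)]hx to_eq.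
  by rewrite mem_stab => /andP[sH _]; rewrite cd_actM.
rewrite -[RHS](cj z zf) (partition_big (fun g => to (x j) g) (fun i => orb i == j)) /=.
  apply: eq_bigr => i' /eqP i'j; rewrite /conj_emb /z rmorph_sum mulr_sumr.
  rewrite (reindex_inj (mulIg (trans i'))) /=; apply: eq_big => [s|s].
    rewrite mem_stab -[H]/(gval (Group (comp_stab_group e))) groupMr ?trans_mem //.
    rewrite actM; congr (_ && _).
    by rewrite -[X in (_ == X) = _](trans_to i') i'j to_eq.
  move=> /andP[sH /eqP sx]; rewrite sx cd_actM //.
  by move: sH; rewrite -[H]/(gval (Group (comp_stab_group e))) groupMr ?trans_mem.
by move=> g gH; rewrite orb_to // orb_x.
Qed.

Lemma mem_assoc_comp j u : u \in assoc_comp to e x j <-> e * u = u /\ stab_fixed j (rho u).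
Proof.
have fixE h : e * u = u -> h \in H -> gcact E h u = u <-> act h (rho u) = rho u.
  move=> eu hH; rewrite cd_act_rho //; split=> [->//|hu].
  apply: (rho_inj (X := X)) => //.
  by rewrite -{1}(comp_stabP _ _ hH) -rmorphM eu.
rewrite /assoc_comp memv_cap; split=> [/andP[/mem_comp_space eu uf]|[eu uf]].
  split=> // h hj; apply/fixE => //; first by move: hj; rewrite mem_stab => /andP[].
  by move: uf; rewrite memvE => /subv_bigcapP/(_ h hj); rewrite -memvE => /fixedSpaceP.
apply/andP; split; first exact/mem_comp_space.
rewrite memvE; apply/subv_bigcapP => h hj; rewrite -memvE; apply/fixedSpaceP.
by apply/fixE => //; [move: hj; rewrite mem_stab => /andP[] | apply: uf].
Qed.

Section AssociatedComponent.
Variable j : 'I_l.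

Definition comp_ring : {pred L} := [pred z | (z \in O) && `[< stab_fixed j z >]].

Lemma comp_ring_closed : subring_closed comp_ring.
Proof.
have memE z : (z \in comp_ring) = (z \in O) && `[< stab_fixed j z >] by [].
split=> [|y z|y z]; rewrite !memE.
- by rewrite rpred1; apply/asboolP=> h _; rewrite rmorph1.
- move=> /andP[yO /asboolP yf] /andP[zO /asboolP zf]; rewrite rpredB //=.
  by apply/asboolP=> h hj; rewrite rmorphB yf ?zf.
move=> /andP[yO /asboolP yf] /andP[zO /asboolP zf]; rewrite rpredM //=.
by apply/asboolP=> h hj; rewrite rmorphM yf ?zf.
Qed.
HB.instance Definition _ := GRing.isSubringClosed.Build _ comp_ring comp_ring_closed.

Lemma comp_ringP z : z \in comp_ring <-> z \in O /\ stab_fixed j z.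
Proof.
have memE : (z \in comp_ring) = (z \in O) && `[< stab_fixed j z >] by [].
by rewrite memE; split=> [/andP[zO /asboolP zf]|[zO zf]] //; rewrite zO; apply/asboolP.
Qed.

Lemma ring_of_assoc_compP u : ring_of_assoc_comp to e x j u <-> e * u = u /\ rho u \in comp_ring.
Proof.
split=> [[/(ring_of_componentP e_comp X)[eu uO] uf]|[eu /comp_ringP[uO uf]]].
  split=> //; apply/comp_ringP; split=> // h hj.
  by rewrite cd_act_rho ?uf //; move: hj; rewrite mem_stab => /andP[].
have /mem_assoc_comp : e * u = u /\ stab_fixed j (rho u) by [].
rewrite /assoc_comp memv_cap memvE => /andP[_ /subv_bigcapP ufix]; split.
  by apply/(ring_of_componentP e_comp X).
by move=> h hj; have := ufix h hj; rewrite -memvE => /fixedSpaceP.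
Qed.

Notation orb_j := (orbit to H (x j)).
Notation n := #|orb_j|.
Let sigma (i : 'I_n) z := conj_emb (enum_val i) z.
Let x_orb : x j \in orb_j. Proof. by rewrite orbE orb_x. Qed.
Let rk := enum_rank_in x_orb.
Let orb_val (i : 'I_n) : orb (enum_val i) = j.
Proof. by apply/eqP; rewrite -orbE enum_valP. Qed.

Lemma comp_embeddings :
  all_embeddings iota H act *%R (assoc_comp to e x j) (fun i u => sigma i (rho u)).
Proof.
split.
- move=> u v /mem_assoc_comp[eu uf] /mem_assoc_comp[ev vf]; apply/mem_assoc_comp.
  split=> [|h hj]; first by rewrite mulrA eu.
  by rewrite !rmorphM (uf h hj) (vf h hj).
- by move=> i c u v _ _; rewrite /sigma /conj_emb rmorphD cd_rhoZ rmorphD rmorphM cd_act_iota.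
- by move=> i u v _ _; rewrite /sigma /conj_emb !rmorphM.
- move=> h i hH; exists (rk (to (enum_val i) h^-1)%g) => u /mem_assoc_comp[_ uf].
  have hi : to (enum_val i) h^-1%g \in orb_j by rewrite orbE orb_to ?HV // orb_val.
  rewrite /sigma enum_rankK_in // conj_emb_act // ?actKV //.
  by rewrite orb_to ?HV // orb_val.
- move=> u /mem_assoc_comp[eu uf] /(_ (rk (x j)))/eqP; rewrite fmorph_eq0 => /eqP u0.
  by apply: (rho_inj (X := X)); rewrite ?mulr0 ?rmorph0.
move=> c cU i; rewrite -(enum_valK_in x_orb i) -/rk.
apply: (conj_emb_indep (c := fun i => c (rk i)) _ (orb_val i)) => z zf.
rewrite -[RHS](cU (sec z)); last by apply/mem_assoc_comp; rewrite e_sec cd_secK.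
rewrite -(eq_bigl _ _ (orbE^~ j)) big_enum_val.
by apply: eq_bigr => i' _; rewrite /rk enum_valK_in cd_secK.
Qed.

Lemma comp_trace_disc s :
  (forall z, z \in comp_ring ->
     exists y, \sum_(i | orb i == j) conj_emb i z = iotaR (y * p ^+ s)) <->
  (s <= assoc_comp_disc_exp to e x j %/ assoc_comp_deg to e x j)%N.
Proof.
have n0 : (0 < n)%N by apply/card_gt0P; exists (x j).
have := @sub_disc _ _ p0 maxE factor complete _ _ kres _ _ _ X (assoc_comp to e x j) n
  sigma comp_ring _ _ _ _ n0 comp_embeddings (ring_of_assoc_comp to e x j)
  ring_of_assoc_compP s.
have sumE z : \sum_i sigma i z = \sum_(i | orb i == j) conj_emb i z.
  transitivity (\sum_(i in orb_j) conj_emb i z); first by rewrite [RHS]big_enum_val.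
  by apply: eq_bigl => i; rewrite orbE.
move=> [|u|z /comp_ringP[]|z /comp_ringP[_ zf] zO|H1' H2'] //.
- by move=> u /mem_assoc_comp[].
- split=> [[/mem_assoc_comp[eu uf] /(_ (rk (x j)))]|[eu /comp_ringP[uO uf]]].
    by rewrite /sigma act_O ?trans_mem // => uO; split=> //; apply/comp_ringP.
  split=> [|i]; first by apply/mem_assoc_comp.
  by rewrite /sigma act_O ?trans_mem.
- apply/comp_ringP; split=> // h hj.
  have q0 : iotaR p != 0 by rewrite -(rmorph0 iotaR) (inj_eq (@cd_iotaR_inj _ _ _ _ X)).
  by apply: (mulfI q0); rewrite -[RHS](zf h hj) rmorphM cd_act_iota.
by split=> [zs|/H2' zs z /zs]; [apply: H1' => z /zs|]; rewrite sumE.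
Qed.

End AssociatedComponent.

(** * The cover C as the product of its components *)

Notation CE := {ffun 'I_l -> E}.
Let cmul (f g : CE) : CE := [ffun j => f j * g j].
Definition cover_emb (i : 'I_d) (f : CE) := conj_emb i (rho (f (orb i))).

Lemma mem_assoc_cover (f : CE) :
  f \in assoc_cover to e x <-> forall j, f j \in assoc_comp to e x j.
Proof.
have ev_lin j : linear (fun g : CE => g j) by move=> c g h; rewrite !ffunE.
pose ev j : {linear CE -> E} := HB.pack (fun g : CE => g j)
  (GRing.isLinear.Build _ _ _ _ _ (ev_lin j)).
have evE j : linfun (fun g : CE => g j) f = f j by exact: (lfunE (ev j)).
rewrite memvE; split=> [/subv_bigcapP fC j|fC].
  by have := fC j isT; rewrite -memvE -memv_preim evE.
by apply/subv_bigcapP => j _; rewrite -memvE -memv_preim evE.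
Qed.

Lemma ring_of_assoc_coverP (f : CE) : ring_of_assoc_cover to e x f <->
  forall j, e * f j = f j /\ rho (f j) \in comp_ring j.
Proof. by split=> fC j; apply/ring_of_assoc_compP. Qed.

Lemma cover_embeddings : all_embeddings iota H act cmul (assoc_cover to e x) cover_emb.
Proof.
split.
- move=> f g /mem_assoc_cover fC /mem_assoc_cover gC; apply/mem_assoc_cover => j.
  by rewrite /cmul ffunE; exact: (emb_mem (comp_embeddings j) (fC j) (gC j)).
- move=> i c f g _ _.
  by rewrite /cover_emb /conj_emb !ffunE rmorphD cd_rhoZ rmorphD rmorphM cd_act_iota.
- by move=> i f g _ _; rewrite /cover_emb /conj_emb /cmul ffunE !rmorphM.
- move=> h i hH; exists (to i h^-1)%g => f /mem_assoc_cover/(_ (orb i))/mem_assoc_comp[_ ff].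
  by rewrite /cover_emb orb_to ?HV // conj_emb_act ?actKV // orb_to ?HV.
- move=> f /mem_assoc_cover fC f0; apply/ffunP=> j; rewrite ffunE.
  have /mem_assoc_comp[ef _] := fC j.
  have /eqP := f0 (x j); rewrite /cover_emb orb_x fmorph_eq0 => /eqP fj0.
  by apply: (rho_inj (X := X)); rewrite ?mulr0 ?rmorph0.
move=> c cC i; apply: (conj_emb_indep (j := orb i) _ erefl) => z zf.
pose f : CE := [ffun j => if j == orb i then sec z else 0].
rewrite -[RHS](cC f).
  rewrite [RHS](bigID (fun i' => orb i' == orb i)) /= [X in _ + X]big1 => [|i' i'i].
    rewrite addr0; apply: eq_bigr => i' /eqP i'i.
    by rewrite /cover_emb ffunE i'i eqxx cd_secK.
  by rewrite /cover_emb /conj_emb ffunE (negPf i'i) !rmorph0 mulr0.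
apply/mem_assoc_cover => j; rewrite ffunE; case: eqP => [->|_]; last exact: mem0v.
by apply/mem_assoc_comp; rewrite e_sec cd_secK.
Qed.

Lemma cover_lattice : lattice (assoc_cover to e x) cover_emb O = ring_of_assoc_cover to e x.
Proof.
apply/predeqP=> f; split=> [[/mem_assoc_cover fC fO]|/ring_of_assoc_coverP fC].
  apply/ring_of_assoc_coverP => j; have /mem_assoc_comp[ef ff] := fC j; split=> //.
  apply/comp_ringP; split=> //; have := fO (x j).
  by rewrite /cover_emb orb_x act_O ?trans_mem.
split=> [|i].
  by apply/mem_assoc_cover => j; apply/mem_assoc_comp; have [ef /comp_ringP[]] := fC j.
by have [_ /comp_ringP[fO _]] := fC (orb i); rewrite /cover_emb act_O ?trans_mem.
Qed.

Lemma cover_basis : exists (B : 'I_d -> CE) (D : R),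
  [/\ forall f, ring_of_assoc_cover to e x f <->
        exists c : 'I_d -> R, f = \sum_i (c i)%:F *: B i,
      D != 0, iotaR D = \det (\matrix_(i < d, m < d) cover_emb m (B i)) ^+ 2 &
      forall n u, u \is a GRing.unit -> D = u * p ^+ n -> assoc_disc_exp to e x = n].
Proof.
have [b [bU bO]] := lattice_basis Gal cover_embeddings (O_frac p0 maxE factor X) unif
  (O_span factor (X := X)).
have [D [DE discE]] := lattice_disc Gal cover_embeddings (O_frac p0 maxE factor X) bU bO.
have BF := tau_mx_free Gal cover_embeddings bU.
have BT := tau_mx_tr_free cover_embeddings bU.
rewrite cover_lattice in bO discE.
have nE : \dim (assoc_cover to e x) = d := etale_dim Gal cover_embeddings.
have [B [BO BD B0]] : exists B : 'I_d -> CE,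
  [/\ forall f, ring_of_assoc_cover to e x f <->
        exists c : 'I_d -> R, f = \sum_i (c i)%:F *: B i,
     iotaR D = \det (\matrix_(i < d, m < d) cover_emb m (B i)) ^+ 2 &
     \det (\matrix_(i < d, m < d) cover_emb m (B i)) != 0].
  move: (\dim _) nE b bO DE BF BT {bU discE} => n nE; subst n => b bO DE BF _.
  exists (fun i => b`_i); split=> //; first by rewrite [LHS]DE det_mulmx det_tr.
  by rewrite -unitfE -unitmxE -row_free_unit.
exists B, D; split=> // [|n u uu DuE].
  by apply: contraNneq B0 => D0; rewrite -sqrf_eq0 -BD D0 rmorph0.
by apply: (disc_exp_eq p0 maxE uu); rewrite -DuE -discE.
Qed.

Lemma cover_trace f s : ring_of_assoc_cover to e x f -> (forall j, s <=
    assoc_comp_disc_exp to e x j %/ assoc_comp_deg to e x j)%N ->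
  exists y, \sum_i cover_emb i f = iotaR (y * p ^+ s).
Proof.
move=> /ring_of_assoc_coverP fC sj.
have /choice[y yE] j : exists y, \sum_(i | orb i == j) conj_emb i (rho (f j)) = iotaR (y * p ^+ s).
  by apply: ((comp_trace_disc j s).2 (sj j)); case: (fC j).
exists (\sum_j y j); rewrite mulr_suml rmorph_sum (partition_big orb xpredT) //=.
by apply: eq_bigr => j _; apply: etrans (yE j); apply: eq_bigr => i /eqP <-.
Qed.

Lemma cover_trace_disc s :
  (forall f, ring_of_assoc_cover to e x f ->
     exists y, \sum_i cover_emb i f = iotaR (y * p ^+ s)) <->
  (forall j, s <= assoc_comp_disc_exp to e x j %/ assoc_comp_deg to e x j)%N.
Proof.
split=> [fs j|sj f fC]; last exact: cover_trace.
(* An element supported on one component has as trace its trace from that component. *)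
apply/comp_trace_disc => z zj; pose f : CE := [ffun j' => if j' == j then sec z else 0].
have [|y yE] := fs f.
  apply/ring_of_assoc_coverP => j'; rewrite ffunE; case: eqP => [->|_].
    by rewrite e_sec cd_secK.
  by rewrite mulr0 rmorph0 rpred0.
exists y; rewrite -yE [RHS](bigID (fun i => orb i == j)) /= [X in _ + X]big1 => [|i ij].
  by rewrite addr0; apply: eq_bigr => i /eqP ij; rewrite /cover_emb ffunE ij eqxx cd_secK.
by rewrite /cover_emb ffunE (negPf ij) /conj_emb !rmorph0.
Qed.

(** * Homomorphisms from the linear forms on the hyperplane *)

Notation N := (hyperplane R to).
Let hgen (i : 'I_d) : N := hyp_pi (delta_mx 0 i).

Let secD y z : sec (y + z) = sec y + sec z.
Proof. by apply: (rho_inj (X := X)); rewrite ?rmorphD ?mulrDr ?cd_secK ?e_sec. Qed.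
Let sec0 : sec 0 = 0.
Proof. by apply: (rho_inj (X := X)); rewrite ?rmorph0 ?mulr0 ?cd_secK ?e_sec. Qed.
Let secM y z : sec (y * z) = sec y * sec z.
Proof. by apply: (rho_inj (X := X)); rewrite ?rmorphM ?mulrA ?cd_secK ?e_sec. Qed.
Let secZ c z : sec (iota c * z) = c *: sec z.
Proof. by apply: (rho_inj (X := X)); rewrite -?scalerAr ?cd_rhoZ ?cd_secK ?e_sec. Qed.

(** The homomorphism with value a_i at x_i. It is defined through a chosen representative, which is
    immaterial when the a_i sum to zero ([hom_of_pi]). *)
Definition hom_of (a : 'I_d -> L) (q : N) : E :=
  sec (\sum_i iotaR (hyp_repr q 0 i) * a i).

Lemma hom_of_pi a (w : 'rV[R]_d) : \sum_i a i = 0 ->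
  hom_of a (hyp_pi w) = sec (\sum_i iotaR (w 0 i) * a i).
Proof.
move=> a0; rewrite /hom_of; congr sec.
have : hyp_pi (hyp_repr (hyp_pi w)) = hyp_pi w by exact: hyp_reprK.
case/hyp_piP=> c; rewrite sum_coordsE => /rowP cE.
apply/eqP; rewrite -subr_eq0 -sumrB.
rewrite (eq_bigr (fun i => iotaR c * a i)) => [|i _]; first by rewrite -mulr_sumr a0 mulr0.
by have := cE i; rewrite !mxE mulr1 => <-; rewrite rmorphB mulrBl.
Qed.

Lemma hom_of_gen a i : \sum_i a i = 0 -> rho (hom_of a (hgen i)) = a i.
Proof.
move=> a0; rewrite hom_of_pi // cd_secK (bigD1 i) //= mxE !eqxx rmorph1 mul1r.
by rewrite big1 ?addr0 // => j ji; rewrite mxE (negPf ji) andbF rmorph0 mul0r.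
Qed.

Lemma homs_hom_of a : (forall i, a i \in O) -> \sum_i a i = 0 -> homs e (hom_of a).
Proof.
move=> aO a0; split=> [c y z|y].
  have [v <-] := hyp_pi_surj y; have [w <-] := hyp_pi_surj z.
  rewrite -linearP !hom_of_pi // -secZ -secD; congr sec.
  rewrite mulr_sumr -big_split; apply: eq_bigr => i _ /=.
  by rewrite !mxE !rmorphD !rmorphM mulrDl mulrA.
apply/(ring_of_componentP e_comp X); rewrite e_sec cd_secK; split=> //.
by rewrite rpred_sum // => i _; rewrite rpredM // iotaR_mem.
Qed.

Lemma homs_sum (f : N -> E) (J : finType) (c : J -> R) (q : J -> N) : homs e f ->
  f (\sum_j c j *: q j) = \sum_j (c j)%:F *: f (q j).
Proof.
move=> [f_lin _]; elim: (index_enum J) => [|j s IHs]; last by rewrite !big_cons f_lin IHs.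
rewrite !big_nil; have := f_lin 1 0 0; rewrite scaler0 addr0 rmorph1 scale1r.
by move=> /(congr1 (fun u => u - f 0)); rewrite addrK subrr.
Qed.

Lemma homs_gen_sum (f : N -> E) : homs e f -> \sum_i rho (f (hgen i)) = 0.
Proof.
move=> fh; have := homs_sum (fun=> 1) hgen fh.
have -> : \sum_i (1 : R) *: hgen i = \sum_(j < 0) 0 *: (0 : N).
  rewrite big_ord0 (eq_bigr hgen) => [|i _]; last exact: scale1r.
  rewrite -linear_sum -/(sum_coords R d) -[RHS](linear0 (@hyp_pi R d)).
  by apply/hyp_piP; exists 1; rewrite subr0 scale1r.
rewrite homs_sum // big_ord0 => /(congr1 rho); rewrite rmorph0 rmorph_sum /= => fE.
by rewrite [RHS]fE; apply: eq_bigr => i _; rewrite rmorph1 scale1r.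
Qed.

Lemma homs_eq (f : N -> E) : homs e f -> f = hom_of (fun i => rho (f (hgen i))).
Proof.
move=> fh; apply/funext => q; have [w <-] := hyp_pi_surj q.
rewrite hom_of_pi; last exact: homs_gen_sum.
have [_ fO] := fh; have ef y : e * f y = f y.
  by have [] := (ring_of_componentP e_comp X _).1 (fO y).
have -> : hyp_pi w = \sum_i w 0 i *: hgen i.
  rewrite {1}[w]row_sum_delta linear_sum; apply: eq_bigr => i _; exact: linearZ.
rewrite homs_sum //; apply: (rho_inj (X := X)); rewrite ?e_sec //.
  by rewrite mulr_sumr; apply: eq_bigr => i _; rewrite -scalerAr ef.
by rewrite cd_secK rmorph_sum; apply: eq_bigr => i _; rewrite cd_rhoZ.
Qed.

Lemma homs_gen_mem (f : N -> E) i : homs e f -> rho (f (hgen i)) \in O.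
Proof. by case=> _ /(_ (hgen i))/(ring_of_componentP e_comp X)[]. Qed.

Lemma hgen_act h i : glact N h (hgen i) = hgen (to i h).
Proof.
rewrite /= hyp_act_pi; congr hyp_pi; apply/rowP=> j.
by rewrite perm_linE !mxE -(to_eq h) actKV.
Qed.

(** An equivariant f is determined by its values at the chosen orbit elements. Each is fixed by the
    stabilizer of that element, so lies in O_(C_j), and the other values are its conjugates. *)
Lemma equiv_homs_cover (f : N -> E) : equiv_homs e f ->
  exists g, [/\ ring_of_assoc_cover to e x g, \sum_i cover_emb i g = 0 &
                forall i, rho (f (hgen i)) = cover_emb i g].
Proof.
move=> [fh f_eq]; pose g : CE := [ffun j => f (hgen (x j))].
have gE i : rho (f (hgen i)) = cover_emb i g.
  rewrite /cover_emb /conj_emb ffunE cd_act_rho // -f_eq // hgen_act.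
  by rewrite trans_to.
exists g; split=> //; last by rewrite -[RHS](homs_gen_sum fh); apply: eq_bigr.
move=> j; rewrite ffunE; split=> [|h]; first by case: fh.
rewrite mem_stab => /andP[hH /eqP hx].
by rewrite -f_eq // hgen_act hx.
Qed.

Lemma cover_equiv_homs g : ring_of_assoc_cover to e x g -> \sum_i cover_emb i g = 0 ->
  equiv_homs e (hom_of (cover_emb^~ g)).
Proof.
move=> gC g0; have embO i : cover_emb i g \in O.
  have [_ /comp_ringP[gO _]] := (ring_of_assoc_coverP g).1 gC (orb i).
  by rewrite /cover_emb act_O ?trans_mem.
split; first exact: homs_hom_of.
move=> h q hH; have [w <-] := hyp_pi_surj q.
rewrite /= hyp_act_pi !hom_of_pi //; apply: (rho_inj (X := X)); first exact: e_sec.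
  by rewrite -{1}(comp_stabP _ _ hH) -rmorphM e_sec.
rewrite -cd_act_rho // !cd_secK rmorph_sum (reindex_inj (act_inj to h)) /=.
apply: eq_bigr => i _; rewrite perm_linE actK rmorphM cd_act_iota; congr (_ * _).
have [_ /comp_ringP[_ gf]] := (ring_of_assoc_coverP g).1 gC (orb i).
by rewrite /cover_emb orb_to // conj_emb_act.
Qed.

(** * The length as the valuation of a determinant *)

Section Length.
Variable i0 : 'I_d.

(* The coordinates x_i with i != i0 form a basis of the linear forms on the    *)
(* hyperplane.                                                                 *)
Definition hom_coords (f : N -> E) : 'rV[L]_d.-1 := \row_m rho (f (hgen (lift i0 m))).

Definition coords_ext (v : 'rV[L]_d.-1) (i : 'I_d) : L :=
  if unlift i0 i is Some m then v 0 m else - \sum_m v 0 m.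

Definition coords_hom (v : 'rV[L]_d.-1) : N -> E := hom_of (coords_ext v).

Let ext_lift v m : coords_ext v (lift i0 m) = v 0 m.
Proof. by rewrite /coords_ext liftK. Qed.

Lemma coords_ext_sum v : \sum_i coords_ext v i = 0.
Proof.
rewrite (bigD1_ord i0) //= {1}/coords_ext unlift_none.
by rewrite (eq_bigr (fun m => v 0 m)) ?addNr.
Qed.

Lemma coords_homK v : hom_coords (coords_hom v) = v.
Proof.
by apply/rowP=> m; rewrite mxE hom_of_gen ?ext_lift //; apply: coords_ext_sum.
Qed.

Lemma coords_ext_eq (v : 'rV[L]_d.-1) (a : 'I_d -> L) : \sum_i a i = 0 ->
  (forall m, v 0 m = a (lift i0 m)) -> coords_ext v = a.
Proof.
move=> a0 va; apply/funext => i; have [m ->|->] := unliftP i0 i; first by rewrite ext_lift va.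
rewrite /coords_ext unlift_none (eq_bigr _ (fun m _ => va m)).
by apply/eqP; rewrite eq_sym -addr_eq0 -[X in _ == X]a0 (bigD1_ord i0).
Qed.

Lemma hom_coordsK f : homs e f -> coords_hom (hom_coords f) = f.
Proof.
move=> fh; rewrite [RHS]homs_eq // /coords_hom.
congr hom_of; apply: coords_ext_eq; first exact: homs_gen_sum.
by move=> m; rewrite mxE.
Qed.

Lemma homs_coords_hom v : v \is a mxOver O -> homs e (coords_hom v).
Proof.
move=> /mxOverP vO; apply: homs_hom_of; last exact: coords_ext_sum.
move=> i; rewrite /coords_ext; case: (unlift _ _) => [m|] //.
by rewrite rpredN rpred_sum.
Qed.

Lemma hom_coords_mem f : homs e f -> hom_coords f \is a mxOver O.
Proof. by move=> fh; apply/mxOverP=> a m; rewrite mxE homs_gen_mem. Qed.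

Lemma hom_coordsD f g : hom_coords (fun q => f q + g q) = hom_coords f + hom_coords g.
Proof. by apply/rowP=> m; rewrite !mxE rmorphD. Qed.

Lemma hom_coordsZ a f : hom_coords (fun q => a * f q) = rho a *: hom_coords f.
Proof. by apply/rowP=> m; rewrite !mxE rmorphM. Qed.

Lemma coords_homD u v q : coords_hom (u + v) q = coords_hom u q + coords_hom v q.
Proof.
rewrite /coords_hom /hom_of -secD -big_split; congr sec; apply: eq_bigr => i _ /=.
rewrite -mulrDr; congr (_ * _); rewrite /coords_ext; case: (unlift _ _) => [m|].
  by rewrite mxE.
by rewrite -opprD -big_split; congr (- _); apply: eq_bigr => m _; rewrite mxE.
Qed.

Lemma coords_homZ a v q : coords_hom (a *: v) q = sec a * coords_hom v q.
Proof.
rewrite /coords_hom /hom_of -secM mulr_sumr; congr sec; apply: eq_bigr => i _ /=.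
rewrite mulrCA; congr (_ * _); rewrite /coords_ext; case: (unlift _ _) => [m|].
  by rewrite mxE.
by rewrite mulrN mulr_sumr; congr (- _); apply: eq_bigr => m _; rewrite mxE.
Qed.

Lemma homsD (f g : N -> E) : homs e f -> homs e g -> homs e (fun q => f q + g q).
Proof.
move=> [f_lin fO] [g_lin gO]; split=> [c y z|y]; first by rewrite f_lin g_lin scalerDr addrACA.
have [[ef fy] [eg gy]] := ((ring_of_componentP e_comp X _).1 (fO y),
                           (ring_of_componentP e_comp X _).1 (gO y)).
by apply/(ring_of_componentP e_comp X); rewrite mulrDr ef eg rmorphD rpredD.
Qed.

Lemma homsM a (f : N -> E) : ring_of_component e a -> homs e f -> homs e (fun q => a * f q).
Proof.
move=> /(ring_of_componentP e_comp X)[ea aO] [f_lin fO]; split=> [c y z|y].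
  by rewrite f_lin mulrDr scalerAr.
have [ef fy] := (ring_of_componentP e_comp X _).1 (fO y).
by apply/(ring_of_componentP e_comp X); rewrite mulrA ea rmorphM rpredM.
Qed.

Lemma homs0 : homs e ((fun=> 0) : N -> E).
Proof.
split=> [c y z|y]; first by rewrite scaler0 addr0.
by apply/(ring_of_componentP e_comp X); rewrite mulr0 rmorph0 rpred0.
Qed.

Lemma component_sec a : a \in O -> ring_of_component e (sec a).
Proof. by move=> aO; apply/(ring_of_componentP e_comp X); rewrite e_sec cd_secK. Qed.

Lemma quot_length_row (Q : set (N -> E)) (M : 'M[L]_d.-1) P len :
    uniformizer O P -> M \is a mxOver O -> has_val O P (\det M) len ->
    (forall f, Q f <-> homs e f /\ row_span O M (hom_coords f)) ->
  quot_length e Q (@homs _ _ _ e N) = Some len.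
Proof.
move=> P_unif MO M_val QE.
have coords0 : coords_hom 0 = fun=> 0.
  by apply/funext => q; rewrite -(scale0r 0) coords_homZ sec0 mul0r.
have spanO v : row_span O M v -> v \is a mxOver O.
  by move=> [c cO ->]; apply: mxOver_mulS.
have chainE m : submod_chain e Q (@homs _ _ _ e N) m <->
    row_chain O (row_span O M) [set v | v \is a mxOver O]%classic m.
  split=> [[c [c0 cm csub clt]]|[c [c0 cm csub clt]]].
    (* Every member of the chain consists of homomorphisms, on which [coords_hom] inverts
       [hom_coords]. *)
    have mono i' j : (i' + j <= m)%N -> (c i' `<=` c (i' + j)%N)%classic.
      elim: j => [|j IHj]; first by rewrite addn0 => _ v.
      rewrite addnS => lt; apply: (subset_trans (IHj (ltnW lt))).
      by case: (clt _ lt).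
    have c_homs i : (i <= m)%N -> (c i `<=` @homs _ _ _ e N)%classic.
      by move=> le; rewrite -cm -(subnKC le); apply: mono; rewrite subnKC.
    exists (fun i v => c i (coords_hom v)); split=> [||i le|i lt].
    - apply/predeqP=> v; rewrite c0; split=> [/QE[_]|vM]; first by rewrite coords_homK.
      by apply/QE; rewrite coords_homK; split=> //; apply/homs_coords_hom/spanO.
    - apply/predeqP=> v; rewrite cm; split=> [/hom_coords_mem|]; last exact: homs_coords_hom.
      by rewrite coords_homK.
    - have [s0 sD sM] := csub i le; split=> [|u v cu cv|a u aO cu].
      + by rewrite coords0.
      + rewrite (_ : coords_hom _ = fun q => coords_hom u q + coords_hom v q); first exact: sD.
        by apply/funext => q; rewrite coords_homD.
      rewrite (_ : coords_hom _ = fun q => sec a * coords_hom u q).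
        by apply: sM => //; apply: component_sec.
      by apply/funext => q; rewrite coords_homZ.
    have [sub nsub] := clt i lt; split=> [v|vsub]; first exact: sub.
    apply: nsub => f cf; have fh : homs e f by apply: (c_homs i.+1).
    by rewrite -(hom_coordsK fh); apply: vsub; rewrite /= hom_coordsK.
  have mono i' j : (i' + j <= m)%N -> (c i' `<=` c (i' + j)%N)%classic.
    elim: j => [|j IHj]; first by rewrite addn0 => _ v.
    rewrite addnS => lt; apply: (subset_trans (IHj (ltnW lt))).
    by case: (clt _ lt).
  have cO i : (i <= m)%N -> (c i `<=` [set v | v \is a mxOver O])%classic.
    by move=> le; rewrite -cm -(subnKC le); apply: mono; rewrite subnKC.
  exists (fun i f => homs e f /\ c i (hom_coords f)); split=> [||i le|i lt].
  - by apply/predeqP=> f; rewrite c0; split=> [/QE|/QE].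
  - apply/predeqP=> f; rewrite cm; split=> [[]//|fh].
    by split=> //; apply: hom_coords_mem.
  - have [s0 sD sM] := csub i le; split=> [|f g [fh cf] [gh cg]|a f aO [fh cf]].
    + split; first exact: homs0.
      by rewrite (_ : hom_coords _ = 0) //; apply/rowP=> a; rewrite !mxE rmorph0.
    + by split; [exact: homsD | rewrite hom_coordsD; apply: sD].
    split; first exact: homsM.
    by rewrite hom_coordsZ; apply: sM => //; case/(ring_of_componentP e_comp X): aO.
  have [sub nsub] := clt i lt; split=> [f [fh cf]|fsub]; first by split=> //; apply: sub.
  apply: nsub => v cv; have vO := cO i.+1 lt v cv.
  have [|_] := fsub (coords_hom v).
    by split; [exact: homs_coords_hom | rewrite coords_homK].
  by rewrite coords_homK.
have len_max : has_length e Q (@homs _ _ _ e N) len.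
  split; first by apply/chainE; apply: (row_chain_exists P_unif).
  by move=> m /chainE; apply: (row_chain_bound P_unif).
apply: xget_unique; first by exists len.
move=> _ [m [m_chain m_max] <-]; congr Some; apply/eqP; rewrite eqn_leq m_max.
  by rewrite len_max.2.
by case: len_max.
Qed.

End Length.

(** * The trace ideal and the final count of valuations *)

Lemma has_val_iotaR P r m u : uniformizer O P -> has_val O P (iotaR p) #|H| ->
  u \is a GRing.unit -> r = u * p ^+ m -> has_val O P (iotaR r) (#|H| * m).
Proof.
move=> P_unif P_val uu ->; rewrite rmorphM rmorphXn -[(_ * m)%N]add0n.
apply: has_valM; last exact: has_valX.
have u0 : iotaR u != 0.
  rewrite -(rmorph0 iotaR) (inj_eq (@cd_iotaR_inj _ _ _ _ X)).
  by apply: contraTneq uu => ->; rewrite unitr0.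
apply/has_val0P; split=> //; first exact: iotaR_mem.
have -> : (iotaR u)^-1 = iotaR u^-1.
  by apply: (mulfI u0); rewrite mulfV // -rmorphM mulrV // rmorph1.
exact: iotaR_mem.
Qed.

(** A trace of least order divides all the others. For the traces of an integral basis, it generates
    the trace ideal. *)
Lemma minimal_generator (tr : 'I_d -> R) : (exists i, tr i != 0) ->
  exists i0 t u (y : 'I_d -> R), [/\ u \is a GRing.unit, tr i0 = u * p ^+ t, y i0 = 1 &
    forall i, tr i = y i * tr i0].
Proof.
move=> [i1 tr1]; have [n1 [u1 [u1u tr1E]]] := factor tr1.
pose val n := `[< exists i u, u \is a GRing.unit /\ tr i = u * p ^+ n >].
have val_ex : exists n, val n by exists n1; apply/asboolP; exists i1, u1.
case: (ex_minnP val_ex) => t /asboolP[i0 [u [uu trE]]] t_min.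
have /choice[y yE] i : exists y, tr i = y * tr i0.
  have [->|tri] := eqVneq (tr i) 0; first by exists 0; rewrite mul0r.
  have [n [v [vu vE]]] := factor tri.
  have le : (t <= n)%N by apply: t_min; apply/asboolP; exists i, v.
  exists (v * u^-1 * p ^+ (n - t)); rewrite vE trE -{1}(subnKC le) exprD.
  by rewrite mulrACA -[v / u * u]mulrA mulVr // mulr1 [p ^+ t * _]mulrC mulrA.
exists i0, t, u, (fun i => if i == i0 then 1 else y i); split=> // [|i]; first by rewrite eqxx.
by case: eqP => [->|_]; rewrite ?mul1r.
Qed.

Theorem vfun_hyperplane : (0 < d)%N ->
  vfun e N = Some ((assoc_disc_exp to e x)%:Q / 2%:Q -
    (min_over (fun j => assoc_comp_disc_exp to e x j %/ assoc_comp_deg to e x j)%N)%:Q).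
Proof.
move=> d_gt0; have l_gt0 : (0 < l)%N by case: (orb (Ordinal d_gt0)) => j; case: (l).
have [P [P_unif P_val]] := comp_ramified.
have [B [D [BO D0 DE discE]]] := cover_basis.
have BC i : ring_of_assoc_cover to e x (B i).
  apply/BO; exists (fun j => (j == i)%:R); rewrite (bigD1 i) //= eqxx rmorph1 scale1r.
  by rewrite big1 ?addr0 // => j /negPf ->; rewrite rmorph0 scale0r.
have embC f i : ring_of_assoc_cover to e x f -> cover_emb i f \in O.
  by rewrite -cover_lattice => -[].
have emb_sum (J : finType) (c : J -> R) (F : J -> CE) i :
    cover_emb i (\sum_j (c j)%:F *: F j) = \sum_j iotaR (c j) * cover_emb i (F j).
  rewrite /cover_emb sum_ffunE rmorph_sum /conj_emb rmorph_sum; apply: eq_bigr => j _.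
  by rewrite ffunE cd_rhoZ rmorphM cd_act_iota.
pose S := \matrix_(i < d, m < d) cover_emb m (B i).
have S0 : \det S != 0.
  by rewrite -sqrf_eq0 -DE -(rmorph0 iotaR) (inj_eq (@cd_iotaR_inj _ _ _ _ X)).
have /choice[tr trE] i : exists r, \sum_m cover_emb m (B i) = iotaR r.
  by have [y yE] := cover_trace (BC i) (fun=> leq0n _); exists (y * p ^+ 0).
(* Otherwise all rows of S would sum to zero and S would be singular. *)
have tr_neq0 : exists i, tr i != 0.
  apply: contrapT => /forallNP tr0; case/eqP: S0.
  rewrite (@det_row_sums _ _ _ (Ordinal d_gt0) (fun=> 1) 0) ?mul0r // => i.
  have /negP/negPn/eqP tri := tr0 i.
  rewrite mulr0 (eq_bigr (fun m => cover_emb m (B i))) => [|m _]; last by rewrite mxE.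
  by rewrite trE tri rmorph0.
have [i0 [t [u [y [uu tr0 y0 yE]]]]] := minimal_generator tr_neq0.
pose M := \matrix_(a < d.-1, b < d.-1)
  (S (lift i0 a) (lift i0 b) - iotaR (y (lift i0 a)) * S i0 (lift i0 b)).
have detS : \det S = iotaR (tr i0) * \det M.
  apply: (@det_row_sums _ _ S i0 (fun i => iotaR (y i))); first by rewrite y0 rmorph1.
  by move=> i; rewrite -rmorphM -yE -trE; apply: eq_bigr => m _; rewrite mxE.
(* The basis elements other than [B i0], corrected to have trace zero; their conjugates away from i0
   are the rows of M. *)
pose B' (a : 'I_d.-1) : CE := B (lift i0 a) - (y (lift i0 a))%:F *: B i0.
have B'emb a m : cover_emb m (B' a) = S (lift i0 a) m - iotaR (y (lift i0 a)) * S i0 m.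
  rewrite /B' /cover_emb /conj_emb !ffunE !rmorphB cd_rhoZ rmorphM cd_act_iota.
  by rewrite !mxE.
have B'C a : ring_of_assoc_cover to e x (B' a).
  apply/BO; exists (fun j => (j == lift i0 a)%:R - (j == i0)%:R * y (lift i0 a)).
  rewrite /B' (bigD1 (lift i0 a)) //= (bigD1 i0) ?neq_lift //= big1 => [|j /andP[ja j0]].
    have ia : (i0 == lift i0 a) = false := negPf (neq_lift _ _).
    rewrite !eqxx [lift i0 a == i0]eq_sym ia mul0r subr0 rmorph1 scale1r addr0.
    by rewrite sub0r mul1r rmorphN scaleNr.
  by rewrite (negPf ja) (negPf j0) mul0r subr0 rmorph0 scale0r.
have B'tr a : \sum_m cover_emb m (B' a) = 0.
  rewrite (eq_bigr _ (fun m _ => B'emb a m)) sumrB -mulr_sumr.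
  have SE i : \sum_m S i m = iotaR (tr i) by rewrite -trE; apply: eq_bigr => m _; rewrite mxE.
  by rewrite !SE yE rmorphM subrr.
have MO : M \is a mxOver O.
  by apply/mxOverP=> a b; rewrite mxE -B'emb embC.
have SO : S \is a mxOver O by apply/mxOverP=> a b; rewrite mxE embC.
have M0 : \det M != 0 by apply: contraNneq S0 => M0; rewrite detS M0 mulr0.
have [len lenM] := has_val_ex P_unif (det_mem MO) M0.
have [w [v [vu DvE]]] := factor D0.
(* Both sides are the valuation in O of the discriminant, computed as the square of det S and as a
   unit times p^w. *)
have lenE : ((#|H| * t + len) * 2 = #|H| * w)%N.
  apply: (has_val_uniq P_unif _ (has_val_iotaR P_unif P_val vu DvE)).
  by rewrite DE -/S detS; apply/has_valX/has_valM => //; apply: has_val_iotaR tr0.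
have minE : min_over (fun j => assoc_comp_disc_exp to e x j %/ assoc_comp_deg to e x j)%N = t.
  have minP s : (s <= min_over (fun j =>
      assoc_comp_disc_exp to e x j %/ assoc_comp_deg to e x j))%N = (s <= t)%N.
    apply/idP/idP => [/(min_overP _ _ l_gt0).1/(cover_trace_disc s).2 /(_ _ (BC i0))[z]|le].
      rewrite trE => /(@cd_iotaR_inj _ _ _ _ X); rewrite tr0.
      exact: (param_dvd_unit p0 maxE uu).
    apply/(min_overP _ _ l_gt0)/(cover_trace_disc s) => f /BO[c ->].
    exists (\sum_i c i * y i * u * p ^+ (t - s)).
    under eq_bigr => m _ do rewrite emb_sum.
    rewrite exchange_big mulr_suml rmorph_sum; apply: eq_bigr => i _ /=.
    rewrite -mulr_sumr trE -(rmorphM iotaR); congr (iota _%:F).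
    by rewrite yE tr0 -{1}(subnK le) exprD; ring.
  by apply/eqP; rewrite eqn_leq -minP leqnn minP leqnn.
have spanE (f : N -> E) : span_equiv_homs e f <-> homs e f /\ row_span O M (hom_coords i0 f).
  have rowM a : row a M = hom_coords i0 (hom_of (cover_emb^~ (B' a))).
    by apply/rowP=> b; rewrite mxE mxE -B'emb mxE hom_of_gen.
  have uE a : equiv_homs e (hom_of (cover_emb^~ (B' a))) by apply: cover_equiv_homs.
  split=> [[m [a [g [aO gE ->]]]]|[fh [c cO fE]]].
    have [span0 spanD spanZ] := row_span_submod O M.
    elim: (index_enum _) => [|j r [homs_r span_r]].
      rewrite (_ : (fun q => _) = fun=> 0); last by apply/funext => q; rewrite big_nil.
      split; first exact: homs0.
      by rewrite (_ : hom_coords _ _ = 0) //; apply/rowP=> b; rewrite !mxE rmorph0.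
    rewrite (_ : (fun q => _) = fun q => a j * g j q + \sum_(k <- r) a k * g k q); last first.
      by apply/funext => q; rewrite big_cons.
    have gh : homs e (g j) by case: (gE j).
    split; first by apply: homsD => //; apply: homsM.
    rewrite hom_coordsD hom_coordsZ; apply: spanD => //.
    apply: spanZ; first by case/(ring_of_componentP e_comp X): (aO j).
    have [h [hC htr gh_emb]] := equiv_homs_cover (gE j).
    have [c hE] := (BO h).1 hC.
    (* The vanishing of the trace gives this relation, which eliminates [B i0] and leaves a
       combination of the [B']. *)
    have cy0 : \sum_i c i * y i = 0.
      have tr_neq : iotaR (tr i0) != 0.
        by apply: contraNneq S0 => tr00; rewrite detS tr00 mul0r.
      apply: (@cd_iotaR_inj _ _ _ _ X); apply: (mulIf tr_neq).
      rewrite rmorph0 mul0r -[RHS]htr -(rmorphM iotaR) mulr_suml rmorph_sum.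
      rewrite [RHS](eq_bigr (fun b => \sum_i iotaR (c i) * cover_emb b (B i))) => [|b _].
        rewrite exchange_big; apply: eq_bigr => i _ /=.
        rewrite -mulr_sumr trE -(rmorphM iotaR); congr (iota _%:F).
        by rewrite [tr i]yE mulrA.
      by rewrite hE emb_sum.
    exists (\row_b iotaR (c (lift i0 b))).
      by apply/mxOverP=> b b'; rewrite mxE iotaR_mem.
    apply/rowP=> b; rewrite !mxE gh_emb hE emb_sum (bigD1_ord i0) //=.
    transitivity (\sum_b' (iotaR (c (lift i0 b')) * S (lift i0 b') (lift i0 b)
        - iotaR (c (lift i0 b') * y (lift i0 b')) * S i0 (lift i0 b))); last first.
      by apply: eq_bigr => b' _; rewrite [M _ _]mxE !mxE mulrBr rmorphM mulrA.
    rewrite sumrB -mulr_suml -rmorph_sum.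
    have -> : \sum_b' c (lift i0 b') * y (lift i0 b') = - c i0.
      apply/eqP; rewrite -addr_eq0 addrC; move/eqP: cy0.
      by rewrite (bigD1_ord i0) //= y0 mulr1.
    rewrite rmorphN mulNr opprK addrC mxE; congr (_ + _).
    by apply: eq_bigr => b' _; rewrite mxE.
  exists d.-1, (fun a => sec (c 0 a)), (fun a => hom_of (cover_emb^~ (B' a))); split=> //.
    by move=> a; apply/component_sec/(mxOverP cO).
  apply/funext => q; rewrite -(hom_coordsK i0 fh) fE mulmx_sum_row.
  elim: (index_enum _) => [|a r IHr].
    by rewrite !big_nil -(scale0r 0) coords_homZ sec0 mul0r.
  rewrite !big_cons coords_homD IHr coords_homZ rowM hom_coordsK //.
  by case: (uE a).
have quotE := quot_length_row P_unif MO lenM spanE.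
rewrite /vfun quotE /= (discE _ _ vu DvE) minE; congr Some.
have H_gt0 : (0 < #|H|)%N by apply/card_gt0P; exists 1%g.
have lenQ : (#|H|%:Q * t%:Q + len%:Q) * 2%:Q = #|H|%:Q * w%:Q.
  have /(congr1 (fun k : nat => k%:Q)) := lenE.
  by rewrite !PoszM PoszD PoszM !intrM intrD intrM.
have H_neq0 : #|H|%:Q != 0 by rewrite intr_eq0 -lt0n.
apply: (mulfI H_neq0); rewrite mulrCA mulfV // mulr1 mulrBr mulrA -lenQ mulfK //.
by rewrite addrC addKr.
Qed.

End AssociatedCover.

Theorem proposition1p4 (R : idomainType) (k : closedFieldType)
    (res : {rmorphism R -> k}) (gT : finGroupType) (d : nat)
    (to : {action gT &-> 'I_d}) (E : gcover R gT) (e : E)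
    (l : nat) (x : 'I_l -> 'I_d)
    (R_cdvr : is_complete_dvr R) (k_res : is_residue_field res)
    (d_gt0 : (0 < d)%N)
    (to_faithful : [faithful [set: gT], on [set: 'I_d] | to])
    (e_comp : is_component e) (x_reps : orbit_reps to e x) :
  vfun e (hyperplane R to) =
    Some ((assoc_disc_exp to e x)%:Q / 2%:Q -
          (min_over (fun j => assoc_comp_disc_exp to e x j
                              %/ assoc_comp_deg to e x j)%N)%:Q).
Proof.
have [R_dvr complete] := R_cdvr.
have [p [p0 maxE factor]] := dvr_uniformizer_exists R_dvr k_res.
have [X] := comp_data_exists e_comp.
have [orb [trans [trans_mem trans_to orbE]]] := transporter_exists x_reps.
exact: (vfun_hyperplane p0 maxE factor complete k_res e_comp X trans_mem trans_to orbE d_gt0).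
Qed.
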